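(* For every odd integer $n\ge3$ and every real $\alpha$ with $\tfrac12<\alpha<1$, $$N_n^{\mathrm{loc}}(T)\le\frac{4\pi^4\kappa_1}{9(1-\alpha)^{1/2}}\cdot\frac{T^2}{\sqrt{\log T}}+o\!\left(\frac{T^2}{\sqrt{\log T}}\right),$$ and $$N_n^{\mathrm{loc}}(T)\ge\frac{16\kappa_1\kappa_2}{5}\cdot\frac{T^2}{\sqrt{\log T}}+o\!\left(\frac{T^2}{\sqrt{\log T}}\right),$$ as $T\to\infty$, where $\kappa_1,\kappa_2>0$ are the constants defined below.
   Context: For nonzero integers $B,C$, $\mathcal{Y}_{B,C}$ is the stacky curve $[S/\mathbb{G}_m]$, $S:x^2+By^2=Cz^n$ minus the origin with weights $(n,n,2)$; $\mathcal{Y}_{B,C}(\mathbb{Z}_p)\neq\emptyset$ means there is a primitive solution $(x,y,z)\in\mathbb{Z}_p^3$ (not all divisible by $p$). $N_n^{\mathrm{loc}}(T)=\#\{(B,C)$ nonzero integers with $|B|,|C|<T$ and $\mathcal{Y}_{B,C}(\mathbb{Z}_p)\neq\emptyset$ for all primes $p\}$. $\kappa_1=\pi^{-1/2}\prod_p\left(1+\frac1{2p}\right)\left(1-\frac1p\right)^{1/2}$, and $\kappa_2>0$ is the constant with $\sum_{1\le B<T}\mu(B)^2\prod_{p\mid B}\left(1+\frac1{2p}\right)^{-1}\sim\kappa_2T$ ($\mu$ the Möbius function). *)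

(* Defs.v *)
From HB Require Import structures.
From mathcomp Require Import all_boot all_order all_algebra.
From mathcomp Require Import finmap.
From mathcomp Require Import all_classical all_reals all_analysis.

Set Implicit Arguments.
Unset Strict Implicit.
Unset Printing Implicit Defensive.

Import Order.TTheory GRing.Theory Num.Theory.
Import numFieldNormedType.Exports.

Local Open Scope classical_set_scope.
Local Open Scope ring_scope.

(* Z_p as the inverse limit of the rings Z/p^k: the k-th component of a point
   is the least nonnegative residue mod p^k (the coherence condition forces
   this), so p-adic integers are equal iff all their components are. *)
Record padic_int (p : nat) := PadicInt {
  padic_res :> nat -> int;
  padic_resP : forall k, (padic_res k.+1 %% (p ^ k)%N)%Z = padic_res k
}.

Section PadicRing.
Variable p : nat.
Implicit Types x y z : padic_int p.

Lemma padic_eq x y : (forall k, x k = y k) -> x = y.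
Proof.
case: x y => [x xP] [y yP] /= /funext exy.
by case: y / exy yP => yP; congr PadicInt; exact: Prop_irrelevance.
Qed.

Lemma padic_modz x k : (x k %% (p ^ k)%N)%Z = x k.
Proof. by rewrite -[in LHS]padic_resP modz_mod padic_resP. Qed.

Fact padic_of_key (f : nat -> int)
    (fP : forall k, (f k.+1 = f k %[mod (p ^ k)%N])%Z) (k : nat) :
  ((f k.+1 %% (p ^ k.+1)%N)%Z %% (p ^ k)%N)%Z = (f k %% (p ^ k)%N)%Z.
Proof.
by rewrite -(fP k) {2}(divz_eq (f k.+1) (p ^ k.+1)%N) expnS PoszM mulrA modzMDl.
Qed.

Definition padic_of f fP : padic_int p := PadicInt (@padic_of_key f fP).

Lemma padic_constP (a : int) k : (a = a %[mod (p ^ k)%N])%Z. Proof. by []. Qed.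

Lemma padic_addP x y k : (x k.+1 + y k.+1 = x k + y k %[mod (p ^ k)%N])%Z.
Proof. by rewrite -modzDm !padic_resP. Qed.

Lemma padic_oppP x k : (- x k.+1 = - x k %[mod (p ^ k)%N])%Z.
Proof. by rewrite -modzNm padic_resP. Qed.

Lemma padic_mulP x y k : (x k.+1 * y k.+1 = x k * y k %[mod (p ^ k)%N])%Z.
Proof. by rewrite -modzMm !padic_resP. Qed.

Definition padic_const (a : int) : padic_int p := padic_of (padic_constP a).
Definition padic_add x y : padic_int p := padic_of (padic_addP x y).
Definition padic_opp x : padic_int p := padic_of (padic_oppP x).
Definition padic_mul x y : padic_int p := padic_of (padic_mulP x y).

HB.instance Definition _ := gen_eqMixin (padic_int p).
HB.instance Definition _ := gen_choiceMixin (padic_int p).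

Fact padic_addA : associative padic_add.
Proof. by move=> x y z; apply: padic_eq => k /=; rewrite modzDml modzDmr addrA. Qed.
Fact padic_addC : commutative padic_add.
Proof. by move=> x y; apply: padic_eq => k /=; rewrite addrC. Qed.
Fact padic_add0 : left_id (padic_const 0) padic_add.
Proof. by move=> x; apply: padic_eq => k /=; rewrite mod0z add0r padic_modz. Qed.
Fact padic_addN : left_inverse (padic_const 0) padic_opp padic_add.
Proof. by move=> x; apply: padic_eq => k /=; rewrite modzDml addNr. Qed.

HB.instance Definition _ := GRing.isZmodule.Build (padic_int p)
  padic_addA padic_addC padic_add0 padic_addN.

Fact padic_mulA : associative padic_mul.
Proof. by move=> x y z; apply: padic_eq => k /=; rewrite modzMml modzMmr mulrA. Qed.
Fact padic_mulC : commutative padic_mul.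
Proof. by move=> x y; apply: padic_eq => k /=; rewrite mulrC. Qed.
Fact padic_mul1 : left_id (padic_const 1) padic_mul.
Proof. by move=> x; apply: padic_eq => k /=; rewrite modzMml mul1r padic_modz. Qed.
Fact padic_mulD : left_distributive padic_mul padic_add.
Proof.
by move=> x y z; apply: padic_eq => k /=; rewrite modzMml modzDml modzDmr mulrDl.
Qed.

HB.instance Definition _ := GRing.Zmodule_isComPzRing.Build (padic_int p)
  padic_mulA padic_mulC padic_mul1 padic_mulD.

End PadicRing.

Definition p_divides (p : nat) (x : padic_int p) : Prop :=
  exists w : padic_int p, x = p%:R * w.

(* Y_{B,C}(Z_p) is nonempty: x^2 + B y^2 = C z^n has a primitive solution *)
Definition has_Zp_point (n : nat) (B C : int) (p : nat) : Prop :=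
  exists x y z : padic_int p,
    x ^+ 2 + B%:~R * y ^+ 2 = C%:~R * z ^+ n /\
    ~ [/\ p_divides x, p_divides y & p_divides z].

Definition locally_soluble_pairs {R : realType} (n : nat) (T : R) :
    set (int * int) :=
  [set BC | [/\ BC.1 != 0, BC.2 != 0, `|BC.1|%:~R < T, `|BC.2|%:~R < T
              & forall p, prime p -> has_Zp_point n BC.1 BC.2 p]].

Definition Nloc {R : realType} (n : nat) (T : R) : nat :=
  #|` fset_set (locally_soluble_pairs n T)|%fset.

Canonical pinfty_filter_on (R : numFieldType) : filter_on R :=
  FilterType (pinfty_nbhs R) _.

(* Moebius function, for m > 0 *)
Definition moebius (m : nat) : int :=
  if all (fun p => logn p m == 1%N) (primes m) then (-1) ^+ size (primes m)
  else 0.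

Definition kappa1 (R : realType) : R :=
  (Num.sqrt pi)^-1 *
  lim ((fun N : nat => \prod_(0 <= p < N | prime p)
          ((1 + (2 * p%:R)^-1) * Num.sqrt (1 - p%:R^-1)) : R) @ \oo).

Definition kappa2_sum {R : realType} (T : R) : R :=
  \sum_(1 <= B < (Num.truncn T).+1 | B%:R < T)
    (moebius B)%:~R ^+ 2 * \prod_(p <- primes B) (1 + (2 * p%:R)^-1)^-1.

(* [get] returns 0 when nothing satisfies the property, so [0 < kappa2 R]
   expresses that the constant exists. *)
Definition kappa2 (R : realType) : R :=
  get [set k : R | 0 < k /\
    kappa2_sum ~_ (+oo%R) (fun T : R => k * T)].

Definition growth {R : realType} (T : R) : R := T ^+ 2 / Num.sqrt (ln T).

(* Main.v *)
Require Import Defs.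
From HB Require Import structures.
From mathcomp Require Import all_boot all_order all_algebra.
From mathcomp Require Import all_classical all_reals all_analysis.
From mathcomp Require finmap.
From mathcomp Require Import zify ring lra.
Import Order.TTheory GRing.Theory Num.Theory.
Import numFieldNormedType.Exports.
Local Open Scope classical_set_scope.
Local Open Scope ring_scope.
Set Implicit Arguments.
Unset Strict Implicit.
Unset Printing Implicit Defensive.

(** Write [C = +-c m^2] with [c] squarefree. If [Y_{B,C}] has a point over [Z_p]
for some [p | c], then [-B] is a square mod [p]: otherwise [x^2 + B y^2] has even
valuation at [p]. Conversely, if [c] is odd and [-B] is a nonzero square mod every
[p | c], there are points at all [p]: [(sqrt(-B), 1, 0)] when [p | c], and a point
with [y = 0] when [C] has even valuation at [p]. Each condition describes a set of
residue classes of [B] mod [c], of density [g(c)] with [g] multiplicative and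
[g(p) = 1/2 + O(1/p)]. Counting periods of length [c] in [[-X, X]] thus bounds
[N_n^loc] on both sides by sums of [g] over squarefree [c <= X / m^2].

With [L(x) = sum_(n <= x) g(n)/n], the identity [log = 1 * Lambda] and Chebyshev's
bounds for primes compare [sum_(c <= x) g(c)] with [x L(x) / log x], and pointwise
comparison of [g * g] with [1] compares [L(x)^2] with [log x]. All constants are
explicit, and the outcome
  [(7/8) T^2 / sqrt(log T) <= N_n^loc(T) <= 20 T^2 / sqrt(log T)]
for large [T] beats both claims, as [sqrt(1/2) <= sqrt(pi) kappa_1 <= 37/45],
[kappa_2 <= 156/275] and [pi >= 3]; the error terms can be taken to be [0]. *)

(** * Local solubility *)

(** The square root of the logarithm appears because [2 g(p) = 1 + O(1/p)]: up to a convergent Euler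
    product, [g * g] is [1], so [L(x)] has the size of [sqrt(log x)]. Sharp asymptotics are avoided
    since both claims leave room, but on the lower side little: its constant is about [0.871],
    against [7/8] and a numerical bound of [15/17]. The explicit constants are tuned to three
    losses. First, [c] may be as large as [X], so [[-X, X]] holds few periods: counting whole
    periods costs a factor [3/2] above and [2m^2/(2m^2+1)] below. Second, Chebyshev gives [log 4]
    and [log 2] where the prime number theorem gives [1]. Third, bounding [L(x)^2] from above needs
    all [n <= x^2], which doubles the logarithm. The hypothesis [alpha > 1/2] meets the lower bound
    for [kappa_1] exactly: [sqrt(1 - alpha) < sqrt(1/2) <= sqrt(pi) kappa_1], so the upper claim has
    a constant of at least [(4/9) pi^(7/2) > 20]. *)

Lemma padic_addE p (x y : padic_int p) k :
  (x + y) k = ((x k + y k) %% (p ^ k)%N)%Z.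
Proof. by []. Qed.

Lemma padic_mulE p (x y : padic_int p) k :
  (x * y) k = ((x k * y k) %% (p ^ k)%N)%Z.
Proof. by []. Qed.

Lemma padic_natE p (a : nat) k :
  (a%:R : padic_int p) k = (a%:Z %% (p ^ k)%N)%Z.
Proof.
elim: a => [|a IH]; first by [].
by rewrite -addn1 natrD padic_addE IH modzDm PoszD.
Qed.

Lemma padic_intE p (a : int) k :
  (a%:~R : padic_int p) k = (a %% (p ^ k)%N)%Z.
Proof.
case: a => a; first by rewrite padic_natE.
by rewrite NegzE mulrNz -[LHS]/((- (a.+1%:R : padic_int p)) k)
   -[LHS]/((- (a.+1%:R : padic_int p) k %% (p ^ k)%N)%Z) padic_natE modzNm.
Qed.

Lemma padic_expE p (x : padic_int p) n k :
  (x ^+ n) k = ((x k ^+ n) %% (p ^ k)%N)%Z.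
Proof.
elim: n => [|n IH]; first by [].
by rewrite exprS padic_mulE IH modzMmr -exprS.
Qed.

(** Coherence makes every later residue divisible by [p]. Dividing by [p] costs one digit, so the
    [k]-th component of the quotient is [z k.+1 / p]. *)
Lemma padic_res1_eq0 p (z : padic_int p) :
  (0 < p)%N -> z 1%N = 0 -> p_divides z.
Proof.
move=> p0 z1.
have pz k : (p %| z k.+1)%Z.
  elim: k => [|k IH]; first by rewrite z1.
  rewrite (divz_eq (z k.+2) (p ^ k.+1)%N) padic_resP rpredD ?IH//.
  by rewrite expnS PoszM mulrCA dvdz_mulr.
have pn0 : p%:Z != 0 by lia.
pose f k := (z k.+1 %/ p)%Z.
have fE k : z k.+1 = f k * p by rewrite /f divzK.
have fP k : (f k.+1 = f k %[mod (p ^ k)%N])%Z.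
  apply/eqP; rewrite eqz_mod_dvd.
  have : ((p ^ k.+1)%N %| z k.+2 - z k.+1)%Z.
    by rewrite -eqz_mod_dvd padic_resP padic_modz.
  by rewrite !fE -mulrBl expnSr PoszM dvdz_mul2r.
exists (padic_of fP); apply: padic_eq => k.
by rewrite padic_mulE padic_natE modzMm -(padic_resP z k) fE mulrC.
Qed.

Lemma p_divides_res1 p (z : padic_int p) : p_divides z -> z 1%N = 0.
Proof.
case=> w ->; rewrite padic_mulE padic_natE expn1 modzz mul0r.
by rewrite mod0z.
Qed.

(** Newton iteration with a frozen derivative: [v] inverts [2 r] mod [p] once and for all. Since
    every iterate stays congruent to [r] mod [p], each step gains one factor [p], which is
    enough. *)
Lemma hensel_sqr p (b r : int) : prime p -> odd p -> ~~ (p %| r)%Z ->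
  (p %| r ^+ 2 - b)%Z -> exists x : padic_int p, x ^+ 2 = b%:~R.
Proof.
move=> pp op npr prb.
have cop : coprimez p (2 * r).
  rewrite coprimezE abszM coprimeMr.
  rewrite coprimen2 op /= prime_coprime//.
case: (Bezoutz p%:Z (2 * r)) => u [v].
move/eqP: cop => ->; move=> uv.
pose f := fix f k := if k is k'.+1 then (f k' - v * (f k' ^+ 2 - b)) else r.
have fr k : (p %| f k - r)%Z /\ ((p ^ k.+1)%N %| f k ^+ 2 - b)%Z.
  elim: k => [|k [IH1 IH2]]; first by rewrite subrr expn1.
  have pk : (p %| f k ^+ 2 - b)%Z.
    by apply: dvdz_trans IH2; rewrite expnS PoszM dvdz_mulr.
  split=> /=.
    rewrite addrAC rpredB// dvdz_mull//.
  have -> : (f k - v * (f k ^+ 2 - b)) ^+ 2 - b =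
     (f k ^+ 2 - b) * (u * p - 2 * v * (f k - r) + v ^+ 2 * (f k ^+ 2 - b)).
    rewrite (canRL (addrK _) uv).
    ring.
  rewrite expnSr PoszM dvdz_mul// rpredD //; last by rewrite dvdz_mull.
  by rewrite rpredB// ?dvdz_mull.
have fP k : (f k.+1 = f k %[mod (p ^ k)%N])%Z.
  apply/eqP; rewrite eqz_mod_dvd /= addrAC subrr add0r rpredN dvdz_mull//.
  by apply: dvdz_trans (fr k).2; rewrite expnS PoszM dvdz_mull.
exists (padic_of fP); apply: padic_eq => k.
rewrite padic_expE padic_intE /= modzXm.
apply/eqP; rewrite eqz_mod_dvd.
by apply: dvdz_trans (fr k).2; rewrite expnS PoszM dvdz_mull.
Qed.

(* The point is [(x, 1, 0)] with [x^2 = -B]. *)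
Lemma has_Zp_point_sqr n (B C : int) p (r : int) : prime p -> odd p ->
  (0 < n)%N -> ~~ (p %| r)%Z -> (p %| r ^+ 2 + B)%Z -> has_Zp_point n B C p.
Proof.
move=> pp op n0 npr prB.
have [|x xE] := @hensel_sqr p (- B) r pp op npr; first by rewrite opprK.
exists x, 1, 0; split.
  by rewrite xE expr1n expr0n gtn_eqF// mulr0 mulr1 mulrNz addNr.
case=> _ /p_divides_res1 + _.
rewrite -[1]/(1%:R) padic_natE expn1 modz_small//.
by rewrite /= ltz_nat prime_gt1.
Qed.

(* With [n] odd and [C = e^2 D], [p] not dividing [D], take
   [x = e D^((n+1)/2)], [y = 0], [z = D]. *)
Lemma has_Zp_point_even n (B e D : int) p : prime p -> odd n ->
  ~~ (p %| D)%Z -> has_Zp_point n B (e ^+ 2 * D) p.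
Proof.
move=> pp on npD.
exists (e * D ^+ (n.+1)./2)%:~R, 0, D%:~R; split.
  rewrite expr0n /= mulr0 addr0 -!rmorphXn -!rmorphM; congr (_%:~R).
  rewrite exprMn -exprM -mulrA -exprS; congr (_ * _ ^+ _).
  by have := odd_double_half n.+1; rewrite /= on; lia.
case=> _ _ /p_divides_res1; rewrite padic_intE expn1 => /dvdz_mod0P.
exact/negP.
Qed.

(** If [y] were invertible mod [p], [x / y] would be a square root of [-B]; so [p] divides [y], and
    then [x]. *)
Lemma dvdz_sum_sqr p (B x y : int) : prime p ->
  ~ (exists r : int, (p %| r ^+ 2 + B)%Z) -> (p %| x ^+ 2 + B * y ^+ 2)%Z ->
  (p %| x)%Z /\ (p %| y)%Z.
Proof.
move=> pp nsq pxy.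
have py : (p %| y)%Z.
  apply/negPn/negP => npy; apply: nsq.
  have cop : coprimez p y.
    by rewrite coprimezE prime_coprime.
  have [[u v] /= uv] := coprimezP _ _ cop.
  exists (v * x).
  have -> : (v * x) ^+ 2 + B =
     v ^+ 2 * (x ^+ 2 + B * y ^+ 2) + B * (u * p) * (1 + v * y).
    rewrite (canRL (addrK _) uv).
    ring.
  apply: rpredD; first exact: dvdz_mull.
  by apply: dvdz_mulr; apply: dvdz_mull; exact: dvdz_mull.
split=> //.
have : (p %| x ^+ 2)%Z.
  rewrite -(rpredDr _ (x := B * y ^+ 2)) ?pxy// expr2 mulrA dvdz_mull//.
by rewrite expr2 !dvdzE abszM Euclid_dvdM// orbb.
Qed.

(** Descent: as long as [p] divides the form it divides [x] and [y], and [p^2] comes out. Hence the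
    form never has odd valuation. *)
Lemma dvdz_sum_sqr_even p (B x y : int) j : prime p ->
  ~ (exists r : int, (p %| r ^+ 2 + B)%Z) ->
  ((p ^ (j.*2.+1))%N %| x ^+ 2 + B * y ^+ 2)%Z ->
  ((p ^ (j.*2.+2))%N %| x ^+ 2 + B * y ^+ 2)%Z.
Proof.
move=> pp nsq.
have p0 : p%:Z ^+ 2 != 0 by rewrite expf_neq0//; have := prime_gt0 pp; lia.
have dE k : (p ^ k.+2)%N%:Z = p%:Z ^+ 2 * (p ^ k)%N%:Z.
  by rewrite !expnS !PoszM expr2 mulrA.
elim: j x y => [|j IH] x y pxy.
  have [|px py] := dvdz_sum_sqr pp nsq (x := x) (y := y).
    by move: pxy; rewrite expn1.
  rewrite dE mulr1; apply: rpredD; first exact: dvdz_exp2r.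
  by apply: dvdz_mull; exact: dvdz_exp2r.
have [|/dvdzP[x' xE] /dvdzP[y' yE]] := dvdz_sum_sqr pp nsq (x := x) (y := y).
  by apply: dvdz_trans pxy; rewrite expnS PoszM dvdz_mulr.
move: pxy; rewrite xE yE.
have -> : (x' * p) ^+ 2 + B * (y' * p) ^+ 2 = (p%:Z ^+ 2) * (x' ^+ 2 + B * y' ^+ 2).
  by ring.
rewrite doubleS [X in (X %| _)%Z -> _]dE [X in _ -> (X %| _)%Z]dE.
rewrite !dvdz_mul2l//; exact: IH.
Qed.

(** If [-B] is not a square mod [p], primitivity forces [z] to be a unit: [p | z] would give [p | x]
    and [p | y]. The right side then has the odd valuation of [C], which the left side cannot
    have. *)
Lemma Zp_point_sqr n (B C : int) p : prime p -> (0 < n)%N -> C != 0 ->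
  odd (logn p `|C|) -> has_Zp_point n B C p ->
  exists r : int, (p %| r ^+ 2 + B)%Z.
Proof.
move=> pp n0 C0 oC [x [y [z [E prim]]]].
apply: contrapT => nsq.
have Ek k : (x k ^+ 2 + B * y k ^+ 2 = C * z k ^+ n %[mod (p ^ k)%N])%Z.
  have := congr1 (fun t : padic_int p => t k) E.
  rewrite padic_addE !padic_mulE !padic_expE !padic_intE.
  by rewrite modzDm (modzMm C) -modzDmr modzMm modzDmr -!expr2.
have p0 := prime_gt0 pp.
have [z1|z1] := boolP (p %| z 1%N)%Z.
  apply: prim.
  have zz : z 1%N = 0.
    have := padic_modz z 1; rewrite expn1 => <-; exact/dvdz_mod0P.
  have := Ek 1%N; rewrite zz expr0n gtn_eqF// mulr0 expn1 mod0z => /dvdz_mod0P h.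
  have [px py] := dvdz_sum_sqr pp nsq h.
  split; apply: padic_res1_eq0 => //.
    by have := padic_modz x 1; rewrite expn1 => <-; exact/dvdz_mod0P.
  by have := padic_modz y 1; rewrite expn1 => <-; exact/dvdz_mod0P.
set j := (logn p `|C|)./2.
have jE : logn p `|C| = j.*2.+1 by rewrite -[LHS]odd_double_half oC.
(* One power of [p] beyond the valuation of [C]: a congruence at this precision already shows the
   contradiction. *)
set k := j.*2.+2.
have zk : ~~ (p %| z k)%Z.
  apply: contra z1 => pz.
  have : forall i, (p %| z i.+1)%Z -> (p %| z 1%N)%Z.
    elim=> // i IH h; apply: IH; rewrite -padic_resP.
    rewrite /modz rpredB// dvdz_mull// expnS PoszM dvdz_mulr//.
  by apply; exact: pz.
have := Ek k => /eqP; rewrite eqz_mod_dvd => hk.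
have h1 : ((p ^ j.*2.+1)%N %| x k ^+ 2 + B * y k ^+ 2)%Z.
  rewrite -(rpredBr _ (x := C * z k ^+ n)).
    by apply: dvdz_trans hk; rewrite /k [(p ^ _.+2)%N]expnS PoszM dvdz_mull.
  rewrite dvdz_mulr// dvdzE /= -jE pfactor_dvdn ?absz_gt0//.
have h2 := dvdz_sum_sqr_even pp nsq h1.
have : ((p ^ k)%N %| C * z k ^+ n)%Z.
  by rewrite -[C * _](subKr (x k ^+ 2 + B * y k ^+ 2)); exact: rpredB.
rewrite dvdzE abszM /= Gauss_dvdl; last first.
  by rewrite coprimeXl// prime_coprime// abszX Euclid_dvdX// negb_and zk.
by rewrite pfactor_dvdn ?absz_gt0// jE ltnn.
Qed.

(** * Counting residue classes *)

Definition sqfree (n : nat) : bool :=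
  (0 < n)%N && all (fun p => logn p n == 1%N) (primes n).

Lemma sqfree_gt0 n : sqfree n -> (0 < n)%N. Proof. by case/andP. Qed.

Lemma sqfree_logn n p : sqfree n -> logn p n = (p \in primes n).
Proof.
case/andP => n0 /allP h; have [/h/eqP//|] := boolP (p \in primes n).
by rewrite -logn_gt0 -eqn0Ngt => /eqP.
Qed.

Lemma perm_primes_prime_mul p c : prime p -> (0 < c)%N -> ~~ (p %| c)%N ->
  perm_eq (primes (p * c)) (p :: primes c).
Proof.
move=> pp c0 pc; apply: uniq_perm; first exact: primes_uniq.
  by rewrite /= primes_uniq andbT mem_primes pp c0 (negbTE pc).
by move=> q; rewrite primesM ?(prime_gt0 pp)// primes_prime// !inE.
Qed.

Lemma sqfree_prime_mul p c : prime p -> ~~ (p %| c)%N ->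
  sqfree (p * c) = sqfree c.
Proof.
move=> pp pc; rewrite /sqfree muln_gt0 (prime_gt0 pp) /=.
case: (posnP c) => // c0 /=.
rewrite (perm_all _ (perm_primes_prime_mul pp c0 pc)) /=.
rewrite lognM ?(prime_gt0 pp)// logn_prime// eqxx lognE pp c0 (negbTE pc) /=.
apply: eq_in_all => q qc; rewrite lognM ?(prime_gt0 pp)// logn_prime//.
have -> // : (q == p) = false.
by apply: contraNF pc => /eqP <-; move: qc; rewrite mem_primes => /and3P[].
Qed.

Lemma sqfree_ind (P : nat -> Prop) : P 1%N ->
  (forall p c, prime p -> ~~ (p %| c)%N -> sqfree c -> P c -> P (p * c)%N) ->
  forall c, sqfree c -> P c.
Proof.
move=> P1 PS; elim/ltn_ind => c IH sc.
have c0 := sqfree_gt0 sc.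
have [c1|c1] := leqP c 1; first by have -> : c = 1%N by lia.
have pp := pdiv_prime c1; have pc := pdiv_dvd c.
set p := pdiv c in pp pc.
have cE : c = (p * (c %/ p))%N by rewrite mulnC divnK.
have p0 := prime_gt0 pp.
have c'0 : (0 < c %/ p)%N by rewrite divn_gt0// dvdn_leq.
have npc : ~~ (p %| c %/ p)%N.
  have := sqfree_logn p sc; rewrite mem_primes pp c0 pc /=.
  rewrite {1}cE lognM// logn_prime// eqxx => -[/eqP].
  by rewrite -leqn0 leqNgt logn_gt0 mem_primes pp c'0.
have sc' : sqfree (c %/ p) by rewrite -(sqfree_prime_mul pp npc) -cE.
rewrite cE; apply: PS => //; apply: IH => //.
by rewrite ltn_Pdiv// prime_gt1.
Qed.

(** * Periodic sums and the Chinese remainder theorem *)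

Section Periodic.
Local Open Scope nat_scope.

Lemma sum_period_shift (F : nat -> nat) c : (forall j, F (j + c) = F j) ->
  forall a, \sum_(a <= j < a + c) F j = \sum_(0 <= j < c) F j.
Proof.
move=> Fc; elim=> [|a IH]; first by [].
have [c0|c0] := posnP c; first by rewrite c0 addn0 !big_geq.
apply/eqP; rewrite -(eqn_add2l (F a)) -{1}IH addSn -big_ltn; last by lia.
by rewrite big_nat_recr /=; [rewrite Fc addnC|lia].
Qed.

Lemma sum_period_blocks (F : nat -> nat) c : (forall j, F (j + c) = F j) ->
  forall k, \sum_(0 <= j < k * c) F j = k * \sum_(0 <= j < c) F j.
Proof.
move=> Fc; elim=> [|k IH]; first by rewrite big_geq.
rewrite mulSn addnC (@big_cat_nat _ _ _ (k * c)) ?leq_addr//= IH.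
by rewrite sum_period_shift// mulSn addnC.
Qed.

Lemma leq_sum_nat (F : nat -> nat) a b : a <= b ->
  \sum_(0 <= j < a) F j <= \sum_(0 <= j < b) F j.
Proof. by move=> ab; rewrite (@big_cat_nat _ _ _ a 0 b)//= leq_addr. Qed.

Lemma sum_period_bounds (F : nat -> nat) c N : 0 < c ->
  (forall j, F (j + c) = F j) ->
  (N %/ c) * \sum_(0 <= j < c) F j <= \sum_(0 <= j < N) F j
    <= (N %/ c).+1 * \sum_(0 <= j < c) F j.
Proof.
move=> c0 Fc; rewrite -!sum_period_blocks//; apply/andP; split.
  by apply: leq_sum_nat; rewrite leq_divM.
by apply: leq_sum_nat; rewrite ltnW// ltn_ceil.
Qed.

Lemma periodE (F : nat -> nat) c : (forall j, F (j + c) = F j) ->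
  forall j, F (j %% c) = F j.
Proof.
move=> Fc j; rewrite {2}(divn_eq j c) addnC.
by elim: (j %/ c) => [|k IH]; rewrite ?mul0n ?addn0// mulSn addnCA addnC Fc.
Qed.

(** The Chinese remainder bijection between residues mod [a * b] and pairs of residues turns the sum
    into a product. *)
Lemma sum_period_coprime (F G : nat -> nat) a b : 0 < a -> 0 < b ->
  coprime a b -> (forall j, F (j + a) = F j) -> (forall j, G (j + b) = G j) ->
  \sum_(0 <= j < a * b) F j * G j =
  (\sum_(0 <= j < a) F j) * (\sum_(0 <= j < b) G j).
Proof.
move=> a0 b0 cab Fa Gb; have ab0 : 0 < a * b by rewrite muln_gt0 a0.
rewrite !big_mkord big_distrlr /= pair_bigA /=.
pose h (u : 'I_a * 'I_b) : 'I_(a * b) :=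
  Ordinal (ltn_pmod (chinese a b u.1 u.2) ab0).
pose h' (j : 'I_(a * b)) : 'I_a * 'I_b :=
  (Ordinal (ltn_pmod j a0), Ordinal (ltn_pmod j b0)).
have h'K : cancel h' h.
  move=> j; apply: val_inj => /=.
  by rewrite -(chinese_mod cab) modn_small.
have hK : cancel h h'.
  move=> [x y]; congr (_, _); apply: val_inj => /=.
    by rewrite modn_dvdm ?dvdn_mulr// chinese_modl// modn_small.
  by rewrite modn_dvdm ?dvdn_mull// chinese_modr// modn_small.
rewrite (reindex h') /=; last by exists h => j _; [exact: h'K|exact: hK].
by apply: eq_bigr => j _; rewrite !periodE.
Qed.

Lemma sum_period_sqfree (Q : nat -> nat -> bool) c :
  (forall p j, Q p (j + p) = Q p j) -> sqfree c ->
  \sum_(0 <= j < c) all (fun p => Q p j) (primes c) =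
  \prod_(p <- primes c) \sum_(0 <= j < p) Q p j.
Proof.
move=> Qp; elim/sqfree_ind: c / => [|p c pp pc sc IH].
  by rewrite big_nat1 big_nil.
have c0 := sqfree_gt0 sc.
rewrite (perm_big _ (perm_primes_prime_mul pp c0 pc)) big_cons /= -IH.
rewrite -sum_period_coprime ?(prime_gt0 pp)//; last 3 first.
- by rewrite prime_coprime.
- by move=> j; rewrite Qp.
- move=> j; congr (nat_of_bool _); apply: eq_in_all => q; rewrite mem_primes.
  case/and3P => _ _ /dvdnP[k ->].
  elim: k => [|k IHk]; first by rewrite mul0n addn0.
  by rewrite mulSn addnCA addnC Qp.
apply: eq_bigr => j _; rewrite mulnb; congr nat_of_bool.
by rewrite (perm_all _ (perm_primes_prime_mul pp c0 pc)).
Qed.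
End Periodic.

(** * Squares modulo a prime *)

Definition sqmod (p : nat) (b : int) : bool :=
  has (fun r : nat => (p %| r%:Z ^+ 2 - b)%Z) (iota 0 p).

Definition unit_sqmod (p : nat) (b : int) : bool :=
  sqmod p b && ~~ (p %| b)%Z.

Lemma sqmodP p (b : int) : (0 < p)%N ->
  reflect (exists r : int, (p %| r ^+ 2 - b)%Z) (sqmod p b).
Proof.
move=> p0; apply: (iffP hasP) => [[r _ h]|[r h]]; first by exists r%:Z.
have pn0 : p%:Z != 0 by lia.
have := modz_ge0 r pn0; have := ltz_mod r pn0.
case E: (r %% p)%Z => [s|s]; last by rewrite NegzE; lia.
move=> sp _; exists s; first by rewrite mem_iota /=; lia.
rewrite -E -eqz_mod_dvd modzXm eqz_mod_dvd//.
Qed.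

Lemma sqmodDr p (b : int) : sqmod p (b + p%:Z) = sqmod p b.
Proof.
apply: eq_has => r /=; rewrite opprD addrA.
by rewrite rpredBr// dvdzz.
Qed.

Lemma unit_sqmodDr p (b : int) : unit_sqmod p (b + p%:Z) = unit_sqmod p b.
Proof. by rewrite /unit_sqmod sqmodDr rpredDr// dvdzz. Qed.

Lemma sum_sqmod_shift (F : int -> bool) (p X : nat) :
  (forall b, F (b + p%:Z) = F b) ->
  (\sum_(0 <= j < p) F (j%:Z - X%:Z)%R = count (fun j : nat => F j%:Z) (iota 0 p))%N.
Proof.
move=> Fp.
rewrite -(@sum_period_shift (fun j : nat => F (j%:Z - X%:Z)) p _ X); last first.
  by move=> j; rewrite PoszD addrAC Fp.
rewrite -{1}[X in (\sum_(X <= _ < _) _)%N]add0n [X in (\sum_(_ <= _ < X) _)%N]addnC.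
rewrite big_addn addnK -sum1_count [RHS]big_mkcond /= /index_iota subn0.
by apply: eq_bigr => j _; rewrite PoszD addrK; case: (F j).
Qed.

(** Since [r] and [p - r] have the same square, the roots [0, ..., p./2] give all squares. At
    [p = 2] the bound is [2], that is, no restriction. *)
Lemma count_sqmod_le p : prime p ->
  (count (fun j : nat => sqmod p j%:Z) (iota 0 p) <= p./2.+1)%N.
Proof.
move=> pp; have p0 := prime_gt0 pp.
rewrite -size_filter -[leqRHS](size_iota 0).
rewrite -[leqRHS](size_map (fun r => r ^ 2 %% p)%N).
apply: uniq_leq_size; first by rewrite filter_uniq// iota_uniq.
move=> j; rewrite mem_filter mem_iota /= add0n => /andP[/hasP[r] + h jp].
rewrite mem_iota add0n /= => rp.
have jE (s : nat) : (p %| s%:Z ^+ 2 - j%:Z)%Z -> (j = s ^ 2 %% p)%N.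
  rewrite -eqz_mod_dvd => /eqP; rewrite -[s%:Z ^+ 2]/((s * s)%N%:Z) !modz_nat.
  by move=> [->]; rewrite modn_small.
suff [s sp ->] : exists2 s, s \in iota 0 p./2.+1 & j = (s ^ 2 %% p)%N.
  exact: (map_f (fun r => (r ^ 2 %% p)%N) sp).
have [rh|rh] := leqP r p./2.
  by exists r; [rewrite mem_iota /=; lia|exact: jE].
exists (p - r)%N; first by rewrite mem_iota /=; lia.
apply: jE; have -> : ((p - r)%N%:Z) ^+ 2 - j%:Z =
    p%:Z * (p%:Z - 2 * r%:Z) + (r%:Z ^+ 2 - j%:Z).
  by rewrite -subzn; [ring|lia].
by rewrite rpredD// dvdz_mulr.
Qed.

(** The squares of [1, ..., (p-1)/2] are distinct mod [p]: otherwise [p] would divide [s - r] or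
    [s + r], both positive and smaller than [p]. At [p = 2] the list is empty. *)
Lemma count_unit_sqmod_ge p : prime p ->
  ((p.-1)./2 <= count (fun j : nat => unit_sqmod p j%:Z) (iota 0 p))%N.
Proof.
move=> pp; have p0 := prime_gt0 pp.
rewrite -size_filter -[leqLHS](size_iota 1).
rewrite -[leqLHS](size_map (fun r => r ^ 2 %% p)%N).
apply: uniq_leq_size.
  rewrite map_inj_in_uniq ?iota_uniq// => r s.
  rewrite !mem_iota => /andP[r0 rp] /andP[s0 sp].
  wlog rs : r s r0 rp s0 sp / (r <= s)%N => [hw|].
    have [/hw|/ltnW/hw h /esym e] := leqP r s; first exact.
    by apply/esym/h.
  move=> /esym/eqP; rewrite eqn_mod_dvd ?leq_exp2r// subn_sqr Euclid_dvdM//.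
  case/orP => /dvdn_leq; last lia.
  by case: (ltngtP r s) rs => // rs _ h; move: h; rewrite subn_gt0 => /(_ rs); lia.
move=> j /mapP[r]; rewrite mem_iota => /andP[r0 rp] ->.
have rE : (p %| r%:Z ^+ 2 - (r ^ 2 %% p)%N%:Z)%Z.
  by rewrite -eqz_mod_dvd -modz_nat modz_mod.
rewrite mem_filter mem_iota add0n ltn_pmod// leq0n !andbT /unit_sqmod.
apply/andP; split; first by apply/sqmodP => //; exists r%:Z.
apply/negP => h; have h2 : (p %| (r * r)%N%:Z)%Z.
  have := rpredD rE h; rewrite subrK PoszM -expr2; exact.
move: h2; rewrite dvdzE /= Euclid_dvdM// orbb.
by move/dvdn_leq => /(_ r0); lia.
Qed.

(* The index [j] stands for [B = X - j], so that [j - X = -B]. *)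
Definition count_classes (Q : nat -> int -> bool) (X c : nat) : nat :=
  count (fun j : nat => all (fun p => Q p (j%:Z - X%:Z)) (primes c))
    (iota 0 (2 * X).+1).

(** Each full period of length [c] contains exactly [W] admissible indices, by multiplicativity over
    the primes of [c]. The last, incomplete period is dropped below and completed above. *)
Lemma count_classes_bounds Q X c : sqfree c ->
  (forall p b, Q p (b + p%:Z) = Q p b) ->
  forall W,
  W = (\prod_(p <- primes c) count (fun j : nat => Q p j%:Z) (iota 0 p))%N ->
  ((2 * X).+1 %/ c * W <= count_classes Q X c <= ((2 * X).+1 %/ c).+1 * W)%N.
Proof.
move=> sc Qp W ->; have c0 := sqfree_gt0 sc.

pose F j : nat := all (fun p => Q p (j%:Z - X%:Z)) (primes c).
have -> : (\prod_(p <- primes c) count (fun j : nat => Q p j%:Z) (iota 0 p))%N = (\sum_(0 <= j < c) F j)%N.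
  rewrite (@sum_period_sqfree (fun p j => Q p (j%:Z - X%:Z)))//; last first.
    by move=> p j; rewrite PoszD addrAC Qp.
  by apply: eq_bigr => p _; rewrite sum_sqmod_shift.
have -> : count_classes Q X c = (\sum_(0 <= j < (2 * X).+1) F j)%N.
  rewrite /count_classes -sum1_count big_mkcond /index_iota subn0.
  by apply: eq_bigr => j _; rewrite /F; case: all.
apply: sum_period_bounds => // j; congr (nat_of_bool _).
apply: eq_in_all => q; rewrite mem_primes => /and3P[_ _ /dvdnP[k ->]].
elim: k => [|k IHk]; first by rewrite mul0n addn0.
by rewrite mulSn addnCA addnC PoszD addrAC Qp.
Qed.

Lemma count_sqmod_bound X c : sqfree c ->
  (c * count_classes sqmod X c <=
   ((2 * X).+1 + c) * \prod_(p <- primes c) p./2.+1)%N.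
Proof.
move=> sc; have c0 := sqfree_gt0 sc.
have /andP[_ h] := count_classes_bounds X sc sqmodDr erefl.
apply: (@leq_trans (c * (((2 * X).+1 %/ c).+1 *
   \prod_(p <- primes c) count (fun j : nat => sqmod p j%:Z) (iota 0 p)))%N).
  by rewrite leq_mul2l h orbT.
rewrite mulnA leq_mul//.
  by rewrite mulnS addnC leq_add2r mulnC leq_divM.
rewrite big_seq_cond [leqRHS]big_seq_cond; apply: leq_prod => p.
by rewrite andbT mem_primes => /and3P[pp _ _]; exact: count_sqmod_le.
Qed.

Lemma count_unit_sqmod_bound X c : sqfree c ->
  ((2 * X).+1 %/ c * \prod_(p <- primes c) (p.-1)./2 <=
   count_classes unit_sqmod X c)%N.
Proof.
move=> sc; have /andP[h _] := count_classes_bounds X sc unit_sqmodDr erefl.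
apply: leq_trans h; rewrite leq_mul2l; apply/orP; right.
rewrite big_seq_cond [leqRHS]big_seq_cond; apply: leq_prod => p.
by rewrite andbT mem_primes => /and3P[pp _ _]; exact: count_unit_sqmod_ge.
Qed.

(** * Reduction to sums over squarefree numbers *)

Lemma sqfree_decomposition n : (0 < n)%N ->
  exists m c, [/\ n = (m ^ 2 * c)%N, (0 < m)%N & sqfree c].
Proof.
elim/ltn_ind: n => n IH n0.
have [sn|] := boolP (sqfree n); first by exists 1%N, n; rewrite exp1n mul1n.
rewrite /sqfree n0 /= => /allPn[p pn lp].
have pp : prime p by move: pn; rewrite mem_primes => /and3P[].
have l2 : (2 <= logn p n)%N.
  by move: pn lp; rewrite -logn_gt0; case: logn => [|[|]].
have /dvdnP[k kE] : (p ^ 2 %| n)%N by rewrite pfactor_dvdn.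
have k0 : (0 < k)%N by move: n0; rewrite kE muln_gt0 => /andP[].
have [|m [c [mcE m0 sc]]] := IH k _ k0.
  by rewrite kE ltn_Pmulr// -(exp1n 2) ltn_exp2r ?prime_gt1.
exists (p * m)%N, c; split => //; first by rewrite kE mcE expnMn; lia.
by rewrite muln_gt0 prime_gt0.
Qed.

Lemma logn_sqr_sqfree p m c : (0 < m)%N -> sqfree c ->
  logn p (m ^ 2 * c) = ((logn p m).*2 + (p \in primes c))%N.
Proof.
move=> m0 sc; rewrite lognM ?(sqfree_gt0 sc) ?expn_gt0 ?m0//.
by rewrite lognX mul2n (sqfree_logn p sc).
Qed.

(** At each prime, the parity of the exponent in [m^2 c] determines [c], and half of what remains
    determines [m]. *)
Lemma sqfree_decomposition_inj m c m' c' : (0 < m)%N -> (0 < m')%N ->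
  sqfree c -> sqfree c' -> (m ^ 2 * c = m' ^ 2 * c')%N -> m = m' /\ c = c'.
Proof.
move=> m0 m'0 sc sc' E.
have lE p : logn p m = logn p m' /\ logn p c = logn p c'.
  have := congr1 (logn p) E; rewrite !logn_sqr_sqfree// (sqfree_logn p sc) (sqfree_logn p sc').
  by case: (p \in _); case: (p \in _); lia.
have [c0 c'0] := (sqfree_gt0 sc, sqfree_gt0 sc').
by split; apply: eqn_from_log => // p; case: (lE p).
Qed.

Definition signed_pair (X : nat) (s : bool) (m c j : nat) : int * int :=
  (X%:Z - j%:Z, (-1) ^+ s * (m ^ 2 * c)%N%:Z).

Lemma locally_soluble_decomposition (R : realType) n X (T : R) (B C : int) :
  (0 < n)%N -> T <= X.+1%:R -> locally_soluble_pairs n T (B, C) ->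
  exists s m c j, [/\ (B, C) = signed_pair X s m c j, (0 < m)%N, sqfree c,
    (m ^ 2 * c <= X)%N & (j < (2 * X).+1)%N /\
    all (fun p => sqmod p (j%:Z - X%:Z)) (primes c)].
Proof.
move=> n0 TX [/= B0 C0 BT CT sol].
have le_X (b : int) : `|b|%:~R < T -> (`|b| <= X)%N.
  move=> bT; rewrite -ltnS -(@ltr_nat R); apply: lt_le_trans TX.
  by move: bT; rewrite -abszE.
have [m [c [mcE m0 sc]]] := @sqfree_decomposition `|C| ltac:(by rewrite absz_gt0).
exists (C < 0), m, c, `|X%:Z - B|%N; have := le_X _ BT => BX.
have jE : `|X%:Z - B|%N%:Z = X%:Z - B by lia.
split=> //.
- by rewrite /signed_pair -mcE jE -intEsign; congr (_, _); lia.
- by rewrite -mcE le_X.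
split; first by lia.
apply/allP => p pc; have pp : prime p by move: pc; rewrite mem_primes => /and3P[].
rewrite jE; apply/sqmodP; first exact: prime_gt0.
have [|r h] := Zp_point_sqr pp n0 C0 _ (sol p pp).
  by rewrite mcE logn_sqr_sqfree// pc oddD odd_double.
by exists r; rewrite addrAC subrr add0r opprK.
Qed.

(** The condition [1 < c] supplies a prime not dividing [B], whence [B] is nonzero. The condition
    [odd c] gives [C] even valuation at [2], where the Hensel argument for odd primes would not
    apply. *)
Lemma signed_pair_soluble (R : realType) n X (T : R) s m c j :
  odd n -> X%:R < T -> (0 < m)%N -> sqfree c -> odd c -> (1 < c)%N ->
  (m ^ 2 * c <= X)%N -> (j < (2 * X).+1)%N ->
  all (fun p => unit_sqmod p (j%:Z - X%:Z)) (primes c) ->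
  locally_soluble_pairs n T (signed_pair X s m c j).
Proof.
move=> on XT m0 sc oc c1 mcX jX /allP hall.
have c0 : (0 < c)%N by exact: ltnW.
have n0 : (0 < n)%N by case: n on.
have lt_T (b : int) : (`|b| <= X)%N -> `|b|%:~R < T.
  by move=> bX; rewrite -abszE; apply: le_lt_trans XT; rewrite ler_nat.
have absC : `|((-1) ^+ s * (m ^ 2 * c)%N%:Z)%R|%N = (m ^ 2 * c)%N.
  by rewrite abszM abszX /= exp1n mul1n.
split=> /=.
- apply: contraTneq (pdiv_prime c1) => e; apply/negP => pp.
  have := hall (pdiv c); rewrite mem_primes pp c0 pdiv_dvd => /(_ isT).
  by rewrite -opprB e oppr0 /unit_sqmod dvdz0 andbF.
- by rewrite -absz_gt0 absC muln_gt0 c0 expn_gt0 m0.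
- by apply: lt_T; lia.
- by apply: lt_T; rewrite absC.
move=> p pp; have [pc|npc] := boolP (p \in primes c).
  have /andP[/(sqmodP _ (prime_gt0 pp))[r h] nb] := hall p pc.
  have op : odd p.
    by move: pc; rewrite mem_primes => /and3P[_ _ /dvdn_odd]; apply.
  have h' : (p %| r ^+ 2 + (X%:Z - j%:Z))%Z by move: h; rewrite opprB.
  apply: (has_Zp_point_sqr _ pp op n0 _ h').
  apply: contra nb => pr; rewrite -opprB rpredN.
  by rewrite -(rpredDr _ (x := r ^+ 2)) ?[_ + r ^+ 2]addrC// expr2 dvdz_mull.
(* For [p] not dividing [c], the whole [p]-part of [C] is the square of the [p]-part of [m]; [k] is
   the part of [m] prime to [p]. *)
have [k npk mE] := pfactor_coprime pp m0.
have -> : (-1) ^+ s * (m ^ 2 * c)%N%:Z =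
    (p ^ logn p m)%N%:Z ^+ 2 * ((-1) ^+ s * (k ^ 2 * c)%N%:Z).
  by rewrite {1}mE expnMn !PoszM -!mulrA; ring.
apply: has_Zp_point_even => //.
rewrite dvdzE /= abszM abszX /= exp1n mul1n Euclid_dvdM// Euclid_dvdX// andbT.
rewrite negb_or -prime_coprime// npk /=.
by apply: contra npc => pc; rewrite mem_primes pp c0.
Qed.

Lemma signed_pair_inj X s m c j s' m' c' j' : (0 < m)%N -> (0 < m')%N ->
  sqfree c -> sqfree c' -> signed_pair X s m c j = signed_pair X s' m' c' j' ->
  (s, m, c, j) = (s', m', c', j').
Proof.
move=> m0 m'0 sc sc' [jE CE].
have mc0 : (0 < m ^ 2 * c)%N by rewrite muln_gt0 expn_gt0 m0 (sqfree_gt0 sc).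
have : (m ^ 2 * c = m' ^ 2 * c')%N.
  have := congr1 absz CE; rewrite !abszM !abszX /= !exp1n !mul1n; exact.
move=> E; have [-> ->] := sqfree_decomposition_inj m0 m'0 sc sc' E.
have -> : j = j' by lia.
suff -> : s = s' by [].
by move: CE; rewrite -E; case: s; case: s'; rewrite ?expr0 ?expr1; lia.
Qed.

Lemma card_index4 N M K (P : nat -> nat -> bool) (Q : nat -> nat -> bool) :
  (#|[pred u : bool * 'I_N * 'I_M * 'I_K | P u.1.1.2 u.1.2 && Q u.1.2 u.2]| =
   2 * \sum_(m < N) \sum_(c < M | P m c) count (Q c) (iota 0 K))%N.
Proof.
rewrite -sum1_card.
have -> : (2 * \sum_(m < N) \sum_(c < M | P m c) count (Q c) (iota 0 K) =
  \sum_(s : bool) \sum_(m < N) \sum_(c < M | P m c) \sum_(j < K | Q c j) 1)%N.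
  rewrite big_bool mul2n -addnn.
  have E : (\sum_(m < N) \sum_(c < M | P m c) count (Q c) (iota 0 K) =
    \sum_(m < N) \sum_(c < M | P m c) \sum_(j < K | Q c j) 1)%N.
    apply: eq_bigr => m _; apply: eq_bigr => c _.
    by rewrite -sum1_count -[in LHS](subn0 K) -/(index_iota 0 K) big_mkord.
  by rewrite E.
by rewrite pair_bigA /= pair_big_dep /= pair_big_dep /=; apply: eq_bigl.
Qed.

Lemma locally_soluble_seq (R : realType) n X (T : R) :
  (0 < n)%N -> T <= X.+1%:R -> locally_soluble_pairs n T `<=`
  [set` [seq signed_pair X u.1.1.1 u.1.1.2 u.1.2 u.2 |
         u : bool * 'I_X.+1 * 'I_X.+1 * 'I_(2 * X).+1 <- enum [pred u : bool * 'I_X.+1 * 'I_X.+1 * 'I_(2 * X).+1 |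
          [&& (0 < u.1.1.2)%N, sqfree u.1.2 & (u.1.1.2 ^ 2 * u.1.2 <= X)%N] &&
          all (fun p => sqmod p (u.2%:Z - X%:Z)) (primes u.1.2)]]].
Proof.
move=> n0 TX [B C] /(locally_soluble_decomposition n0 TX).
case=> s [m [c [j [E m0 sc mcX [jX hall]]]]] /=.
have c0 := sqfree_gt0 sc.
have m2 : (0 < m ^ 2)%N by rewrite expn_gt0 m0.
have mX : (m < X.+1)%N.
  rewrite ltnS; apply: leq_trans mcX; rewrite -mulnn -mulnA.
  by rewrite leq_pmulr// muln_gt0 m0.
have cX : (c < X.+1)%N by rewrite ltnS; apply: leq_trans mcX; rewrite leq_pmull.
apply/mapP; exists (s, Ordinal mX, Ordinal cX, Ordinal jX) => //.
by rewrite mem_enum inE /= m0 sc mcX hall.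
Qed.

Lemma Nloc_le (R : realType) n X (T : R) : (0 < n)%N -> T <= X.+1%:R ->
  (Nloc n T <= 2 * \sum_(m < X.+1) \sum_(c < X.+1 |
     [&& 0 < m, sqfree c & m ^ 2 * c <= X]) count_classes sqmod X c)%N.
Proof.
move=> n0 TX; have sub := locally_soluble_seq n0 TX.
rewrite -(card_index4 _ _ _ (fun m c => [&& 0 < m, sqfree c & m ^ 2 * c <= X])%N
  (fun c j => all (fun p => sqmod p (j%:Z - X%:Z)) (primes c))).
rewrite cardE -(size_map (fun u : bool * 'I_X.+1 * 'I_X.+1 * 'I_(2 * X).+1 =>
  signed_pair X u.1.1.1 u.1.1.2 u.1.2 u.2)).
have fin : finite_set (locally_soluble_pairs n T).
  by apply: sub_finite_set sub _; exact: finite_seq.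
apply: uniq_leq_size; first exact: finmap.fset_uniq.
by move=> x; rewrite in_fset_set// inE => /sub.
Qed.

(** Truncating at [m <= M] keeps finitely many values of [m], so that the lower bounds for the inner
    sums, valid only for large [X], can hold simultaneously. *)
Lemma Nloc_ge (R : realType) n X M (T : R) : odd n -> X%:R < T ->
  T <= X.+1%:R ->
  (2 * \sum_(m < M.+1) \sum_(c < X.+1 |
     [&& 0 < m, [&& sqfree c, odd c & 1 < c] & m ^ 2 * c <= X])
       count_classes unit_sqmod X c <= Nloc n T)%N.
Proof.
move=> on XT TX.
have n0 : (0 < n)%N by case: n on.
have sub := locally_soluble_seq n0 TX.
rewrite -(card_index4 _ _ _
  (fun m c => [&& 0 < m, [&& sqfree c, odd c & 1 < c] & m ^ 2 * c <= X])%N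
  (fun c j => all (fun p => unit_sqmod p (j%:Z - X%:Z)) (primes c))).
rewrite cardE -(size_map (fun u : bool * 'I_M.+1 * 'I_X.+1 * 'I_(2 * X).+1 =>
  signed_pair X u.1.1.1 u.1.1.2 u.1.2 u.2)).
have fin : finite_set (locally_soluble_pairs n T).
  by apply: sub_finite_set sub _; exact: finite_seq.
apply: uniq_leq_size.
  rewrite map_inj_in_uniq ?enum_uniq// => -[[[s m] c] j] [[[s' m'] c'] j'].
  rewrite !mem_enum !inE /= => /andP[/and3P[m0 /and3P[sc _ _] _] _].
  move=> /andP[/and3P[m'0 /and3P[sc' _ _] _] _].
  move=> /(signed_pair_inj m0 m'0 sc sc')[-> mE cE jE].
  by congr (_, _, _, _); apply: val_inj.
move=> x /mapP[[[[s m] c] j]]; rewrite mem_enum inE /=.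
case/andP => /and3P[m0 /and3P[sc oc c1] mcX] hall ->.
rewrite in_fset_set// inE.
by apply: signed_pair_soluble => //; rewrite ltn_ord.
Qed.

(** * Logarithmic sums of multiplicative functions *)

(* The weighted sum of [mulf f n / n] over the [n <= x] all of whose prime
   factors are [< z] and have exponent [< K], see [smooth_sumE]; the recursion
   is on the largest prime factor. *)
Fixpoint smooth_sum (R : realType) (K : nat) (f : nat -> nat -> R) (z x : nat) : R :=
  if z is p.+1 then
    if prime p then \sum_(k < K) f p k / (p ^ k)%:R * smooth_sum K f p (x %/ p ^ k)
    else smooth_sum K f p x
  else (0 < x)%N%:R.

(** The value at [p^k] of the Dirichlet convolution of two multiplicative functions given by their
    values at prime powers. *)
Definition local_conv (R : realType) (f h : nat -> nat -> R) (p k : nat) : R :=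
  \sum_(i < k.+1) f p i * h p (k - i)%N.

(** When [f p 0 = 1], this is the multiplicative function with value [f p k] at [p^k]. *)
Definition mulf (R : realType) (f : nat -> nat -> R) (n : nat) : R :=
  \prod_(p <- primes n) f p (logn p n).

Lemma smooth_sum_ge0 (R : realType) K (f : nat -> nat -> R) z x :
  (forall p k, 0 <= f p k) -> 0 <= smooth_sum K f z x.
Proof.
move=> f0; elim: z x => [|p IH] x //=; case: ifP => // _.
by apply: sumr_ge0 => k _; rewrite mulr_ge0// divr_ge0.
Qed.

Lemma le_smooth_sum (R : realType) K (f : nat -> nat -> R) z x y :
  (forall p k, 0 <= f p k) -> (x <= y)%N ->
  smooth_sum K f z x <= smooth_sum K f z y.
Proof.
move=> f0; elim: z x y => [|p IH] x y xy /=.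
  by rewrite ler_nat; case: posnP; case: posnP => //; lia.
case: ifP => [_|_]; last exact: IH.
by apply: ler_sum => k _; rewrite ler_wpM2l ?divr_ge0// IH// leq_div2r.
Qed.

Lemma le_smooth_sum_fun (R : realType) K (f h : nat -> nat -> R) z x :
  (forall p k, 0 <= f p k) ->
  (forall p k, prime p -> f p k <= h p k) ->
  smooth_sum K f z x <= smooth_sum K h z x.
Proof.
move=> f0 fh; elim: z x => [|p IH] x //=; case: ifP => // pp.
apply: ler_sum => k _; apply: ler_pM => //.
- by rewrite divr_ge0.
- exact: smooth_sum_ge0.
- by rewrite ler_wpM2r ?invr_ge0// fh.
Qed.

Lemma smooth_sum_le_prod (R : realType) K (f : nat -> nat -> R) z x :
  (forall p k, 0 <= f p k) ->
  smooth_sum K f z x <=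
  \prod_(0 <= p < z | prime p) \sum_(k < K) f p k / (p ^ k)%:R.
Proof.
move=> f0; elim: z x => [|p IH] x.
  by rewrite big_geq//= lern1 leq_b1.
rewrite big_mkcond big_nat_recr//= -big_mkcond; case: ifP => [_|_]; last by rewrite mulr1.
rewrite mulrC mulr_suml; apply: ler_sum => k _.
by rewrite ler_wpM2l ?divr_ge0.
Qed.

Lemma triangle_sum_le (R : realType) K (G : nat -> nat -> R) :
  (forall i j, 0 <= G i j) ->
  \sum_(k < K) \sum_(i < k.+1) G i (k - i)%N <= \sum_(i < K) \sum_(j < K) G i j.
Proof.
move=> G0.
have -> : \sum_(k < K) \sum_(i < k.+1) G i (k - i)%N =
    \sum_(i < K) \sum_(j < K | (j + i < K)%N) G i j.
  transitivity (\sum_(k < K) \sum_(i < K | (i <= k)%N) G i (k - i)%N).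
    apply: eq_bigr => k _.
    by rewrite (big_ord_widen_cond K (fun _ => true) (fun i => G i (k - i)%N)).
  rewrite (exchange_big_dep (fun _ => true))//=; apply: eq_bigr => i _.
  rewrite -(big_geq_mkord i K predT (fun k => G i (k - i)%N)) /=.
  rewrite -{1}[i : nat]add0n big_addn big_mkord.
  rewrite [RHS](eq_bigl (fun j : 'I_K => (j < K - i)%N)); last first.
    by move=> j; rewrite ltn_subRL addnC.
  rewrite -(big_ord_widen K (fun j => G i j)) ?leq_subr//.
  by apply: eq_bigr => j _; rewrite addnK.
apply: ler_sum => i _; rewrite [leLHS]big_mkcond; apply: ler_sum => j _.
by case: ifP.
Qed.

Lemma triangle_sum_ge (R : realType) K (G : nat -> nat -> R) :
  (forall i j, 0 <= G i j) ->
  \sum_(i < K) \sum_(j < K) G i j <=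
  \sum_(k < 2 * K) \sum_(i < k.+1) G i (k - i)%N.
Proof.
move=> G0.
have -> : \sum_(k < 2 * K) \sum_(i < k.+1) G i (k - i)%N =
    \sum_(i < 2 * K) \sum_(j < 2 * K - i) G i j.
  transitivity (\sum_(k < 2 * K) \sum_(i < 2 * K | (i <= k)%N) G i (k - i)%N).
    apply: eq_bigr => k _.
    by rewrite (big_ord_widen_cond (2 * K) (fun _ => true) (fun i => G i (k - i)%N)).
  rewrite (exchange_big_dep (fun _ => true))//=; apply: eq_bigr => i _.
  rewrite -(big_geq_mkord i (2 * K) predT (fun k => G i (k - i)%N)) /=.
  rewrite -{1}[i : nat]add0n big_addn big_mkord.
  by apply: eq_bigr => j _; rewrite addnK.
have KK : (K <= 2 * K)%N by lia.
rewrite (big_ord_widen _ (fun i => \sum_(j < K) G i j) KK) big_mkcond.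
apply: ler_sum => i _; case: ifP => [iK|_]; last exact: sumr_ge0.
have Ki : (K <= 2 * K - i)%N by lia.
by rewrite (big_ord_widen _ (G i) Ki) big_mkcond; apply: ler_sum => j _; case: ifP.
Qed.

Lemma local_conv_ge0 (R : realType) (f h : nat -> nat -> R) p k :
  (forall p k, 0 <= f p k) -> (forall p k, 0 <= h p k) ->
  0 <= local_conv f h p k.
Proof. by move=> f0 h0; apply: sumr_ge0 => i _; rewrite mulr_ge0. Qed.

(** The pairs with [a b <= x] lie among those with [a <= x] and [b <= x]. The recursion on primes
    reduces this to exponents, where the triangle [i + j < K] lies in a square. *)
Lemma smooth_sum_conv_le (R : realType) K (f h : nat -> nat -> R) z x :
  (forall p k, 0 <= f p k) -> (forall p k, 0 <= h p k) ->
  smooth_sum K (local_conv f h) z x <= smooth_sum K f z x * smooth_sum K h z x.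
Proof.
move=> f0 h0; elim: z x => [|p IH] x /=.
  by case: posnP => _; rewrite ?mulr1 ?mulr0.
case: ifP => [pp|_]; last exact: IH.
pose G i j := f p i / (p ^ i)%:R * smooth_sum K f p (x %/ p ^ i) *
  (h p j / (p ^ j)%:R * smooth_sum K h p (x %/ p ^ j)).
have G0 i j : 0 <= G i j by rewrite /G !mulr_ge0 ?invr_ge0 ?smooth_sum_ge0.
have -> : (\sum_(k < K) f p k / (p ^ k)%:R * smooth_sum K f p (x %/ p ^ k)) *
  (\sum_(k < K) h p k / (p ^ k)%:R * smooth_sum K h p (x %/ p ^ k)) =
  \sum_(i < K) \sum_(j < K) G i j by rewrite big_distrlr.
apply: le_trans (triangle_sum_le K G0).
apply: ler_sum => k _; rewrite /local_conv 2!mulr_suml.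
apply: ler_sum => -[i ik] _ /=; rewrite ltnS in ik.
have pk0 : 0 < (p ^ k)%:R :> R by rewrite ltr0n expn_gt0 prime_gt0.
have pE : ((p ^ k)%:R : R) = (p ^ i)%:R * (p ^ (k - i))%:R.
  by rewrite -natrM -expnD subnKC.
rewrite /G pE invfM.
have -> : f p i / (p ^ i)%:R * smooth_sum K f p (x %/ p ^ i) *
   (h p (k - i)%N / (p ^ (k - i))%:R * smooth_sum K h p (x %/ p ^ (k - i))) =
   f p i * h p (k - i)%N * ((p ^ i)%:R^-1 / (p ^ (k - i))%:R) *
   (smooth_sum K f p (x %/ p ^ i) * smooth_sum K h p (x %/ p ^ (k - i))) by ring.
apply: ler_wpM2l; first by rewrite !mulr_ge0 ?invr_ge0.
apply: le_trans (IH _) _; apply: ler_pM; rewrite ?smooth_sum_ge0//.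
  by apply: le_smooth_sum => //; rewrite leq_div2l ?expn_gt0 ?prime_gt0// leq_pexp2l ?prime_gt0.
by apply: le_smooth_sum => //; rewrite leq_div2l ?expn_gt0 ?prime_gt0// leq_pexp2l ?prime_gt0// leq_subr.
Qed.

(** Conversely [a <= x] and [b <= y] give [a b <= x y]. Exponents add up to less than [2 * K], hence
    the larger cutoff. *)
Lemma smooth_sum_conv_ge (R : realType) K (f h : nat -> nat -> R) z x y :
  (forall p k, 0 <= f p k) -> (forall p k, 0 <= h p k) ->
  smooth_sum K f z x * smooth_sum K h z y <=
  smooth_sum (2 * K) (local_conv f h) z (x * y).
Proof.
move=> f0 h0; elim: z x y => [|p IH] x y /=.
  by rewrite -natrM mulnb muln_gt0.
case: ifP => [pp|_]; last exact: IH.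
pose G i j := f p i / (p ^ i)%:R * (h p j / (p ^ j)%:R) *
   smooth_sum (2 * K) (local_conv f h) p ((x * y) %/ p ^ (i + j)).
have c0 := local_conv_ge0 _ _ f0 h0.
have G0 i j : 0 <= G i j by rewrite /G !mulr_ge0 ?invr_ge0 ?smooth_sum_ge0.
have -> : \sum_(k < 2 * K) local_conv f h p k / (p ^ k)%:R *
    smooth_sum (2 * K) (local_conv f h) p (x * y %/ p ^ k) =
    \sum_(k < 2 * K) \sum_(i < k.+1) G i (k - i)%N.
  apply: eq_bigr => k _; rewrite /local_conv 2!mulr_suml.
  apply: eq_bigr => -[i ik] _ /=; rewrite ltnS in ik.
  have pE : ((p ^ k)%:R : R) = (p ^ i)%:R * (p ^ (k - i))%:R.
    by rewrite -natrM -expnD subnKC.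
  by rewrite /G subnKC// pE invfM; ring.
apply: le_trans (triangle_sum_ge K G0).
rewrite big_distrlr /=; apply: ler_sum => i _; apply: ler_sum => j _.
rewrite /G mulrACA; apply: ler_wpM2l; first by rewrite !mulr_ge0 ?invr_ge0.
apply: le_trans (IH _ _) _; apply: le_smooth_sum => //.
rewrite leq_divRL ?expn_gt0 ?prime_gt0// expnD mulnACA.
by rewrite leq_mul// leq_divM.
Qed.

Lemma perm_primes_pfactor_mul p k m : prime p -> (0 < m)%N -> ~~ (p %| m)%N ->
  perm_eq (primes (p ^ k.+1 * m)) (p :: primes m).
Proof.
move=> pp m0 pm; have p0 : (0 < p ^ k.+1)%N by rewrite expn_gt0 prime_gt0.
apply: uniq_perm; first exact: primes_uniq.
  by rewrite /= primes_uniq andbT mem_primes pp m0 (negbTE pm).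
by move=> q; rewrite primesM// primesX// primes_prime// !inE.
Qed.

Lemma mulf_pfactor_mul (R : realType) (f : nat -> nat -> R) p k m :
  (forall p, f p 0%N = 1) -> prime p -> (0 < m)%N -> ~~ (p %| m)%N ->
  mulf f (p ^ k * m) = f p k * mulf f m.
Proof.
move=> f1 pp m0 pm; have p0 n : (0 < p ^ n)%N by rewrite expn_gt0 prime_gt0.
case: k => [|k]; first by rewrite expn0 mul1n f1 mul1r.
have lpm : logn p m = 0%N by apply/eqP; rewrite -leqn0 leqNgt logn_gt0 mem_primes pp m0.
rewrite /mulf (perm_big _ (perm_primes_pfactor_mul k pp m0 pm)) big_cons /=.
congr (_ * _); first by rewrite lognM// pfactorK// lpm addn0.
apply: eq_big_seq => q qm; rewrite lognM// lognX logn_prime//.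
have -> : (q == p) = false.
  by apply: contraNF pm => /eqP <-; move: qm; rewrite mem_primes => /and3P[].
by rewrite muln0.
Qed.

Definition smooth (z n : nat) : bool := all (fun p => (p < z)%N) (primes n).

(** The recursion groups the integers as [n = p^k m], where all primes of [m] are below [p]. The
    bound [x < 2^K] makes the exponent cutoff invisible. *)
Lemma smooth_sumE (R : realType) K (f : nat -> nat -> R) z x :
  (forall p, f p 0%N = 1) -> (x < 2 ^ K)%N ->
  smooth_sum K f z x = \sum_(1 <= n < x.+1 | smooth z n) mulf f n / n%:R.
Proof.
move=> f1; elim: z x => [|p IH] x xK /=.
  case: x xK => [|x] _; first by rewrite big_geq.
  rewrite big_mkcond big_ltn// {1}/smooth /= {1}/mulf big_nil divr1.
  rewrite big_nat_cond big1 ?addr0// => n /andP[/andP[n1 _] _].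
  rewrite /smooth; case: primes (pdiv_prime n1) (mem_primes (pdiv n) n) => //=.
  by move=> -> /esym; rewrite pdiv_dvd (ltnW n1).
case: ifPn => pp; last first.
  rewrite IH//; apply: eq_bigl => n; apply: eq_in_all => q qn.
  rewrite [RHS]ltnS [RHS]leq_eqVlt; have -> // : (q == p) = false.
  by apply: contraNF pp => /eqP <-; move: qn; rewrite mem_primes => /and3P[].
have p0 n : (0 < p ^ n)%N by rewrite expn_gt0 prime_gt0.
have logK n : (0 < n)%N -> (n < x.+1)%N -> (logn p n < K)%N.
  move=> n0 nx; rewrite -(ltn_exp2l _ _ (isT : 1 < 2)%N).
  apply: leq_ltn_trans xK; rewrite -ltnS; apply: leq_ltn_trans nx.
  apply: leq_trans (dvdn_leq n0 (pfactor_dvdnn p n)).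
  by case: logn => // e; rewrite leq_exp2r ?prime_gt1.
have -> : \sum_(1 <= n < x.+1 | smooth p.+1 n) mulf f n / n%:R =
   \sum_(k < K) \sum_(1 <= n < x.+1 | smooth p.+1 n && (logn p n == k))
      mulf f n / n%:R.
  rewrite [RHS](exchange_big_dep (fun n => smooth p.+1 n))/=; last first.
    by move=> k n _ /andP[].
  rewrite big_nat_cond [RHS]big_nat_cond; apply: eq_bigr => n.
  move=> /andP[/andP[n1 nx] sn].
  by rewrite (big_pred1 (Ordinal (logK n n1 nx)))// => k; rewrite sn /= eq_sym.
apply: eq_bigr => k _; rewrite IH; last first.
  exact: leq_ltn_trans (leq_div _ _) xK.
rewrite mulr_sumr -[RHS]big_filter.
rewrite [RHS](perm_big [seq (p ^ k * m)%N | m <- index_iota 1 (x %/ p ^ k).+1 & smooth p m]).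
  rewrite [RHS]big_map [RHS]big_filter [LHS]big_nat_cond [RHS]big_nat_cond.
  apply: eq_bigr => m /andP[/andP[m1 _] sm].
  have pm : ~~ (p %| m)%N.
    apply/negP => pm; move/allP: sm => /(_ p); rewrite mem_primes pp m1 pm ltnn.
    by move=> /(_ isT).
  by rewrite mulf_pfactor_mul// natrM invfM; ring.
apply: uniq_perm; first by rewrite filter_uniq// iota_uniq.
  rewrite map_inj_uniq ?filter_uniq ?iota_uniq// => m m' /eqP.
  by rewrite eqn_pmul2l// => /eqP.
move=> n; rewrite mem_filter mem_index_iota; apply/idP/mapP.
  case/andP => /andP[/allP sn /eqP lk] /andP[n1 nx].
  have [m pm nE] := pfactor_coprime pp n1.
  rewrite lk mulnC in nE.
  have m0 : (0 < m)%N by move: n1; rewrite nE muln_gt0 p0.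
  exists m => //; rewrite mem_filter mem_index_iota m0 ltnS leq_divRL// mulnC.
  rewrite -nE -ltnS nx !andbT; apply/allP => q; rewrite mem_primes => /and3P[qp _ qm].
  have := sn q; rewrite mem_primes qp n1 nE dvdn_mull//= ltnS leq_eqVlt.
  move=> /(_ isT)/orP[/eqP qE|//]; move: pm; rewrite prime_coprime//.
  by rewrite -qE qm.
case=> m; rewrite mem_filter mem_index_iota => /andP[/allP sm /andP[m1 mx]] ->.
have pm : ~~ (p %| m)%N.
  by apply/negP => pm; have := sm p; rewrite mem_primes pp m1 pm ltnn => /(_ isT).
have lpm : logn p m = 0%N by apply/eqP; rewrite -leqn0 leqNgt logn_gt0 mem_primes pp m1.
rewrite lognM// pfactorK// lpm addn0 eqxx andbT muln_gt0 p0 m1 /= ltnS.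
rewrite mulnC -leq_divRL// -ltnS mx andbT; apply/allP => q.
rewrite primesM// => /orP[/sm qp|]; first exact: ltnW.
by rewrite mem_primes => /and3P[qp _]; rewrite Euclid_dvdX// dvdn_prime2// => /andP[/eqP ->].
Qed.

Lemma smooth_ltn z n : (n < z)%N -> smooth z n.
Proof.
move=> nz; apply/allP => p; rewrite mem_primes => /and3P[_ n0 /(dvdn_leq n0) pn].
exact: leq_ltn_trans nz.
Qed.

Lemma smooth_sum_full (R : realType) K (f : nat -> nat -> R) z x :
  (forall p, f p 0%N = 1) -> (x < 2 ^ K)%N -> (x < z)%N ->
  smooth_sum K f z x = \sum_(1 <= n < x.+1) mulf f n / n%:R.
Proof.
move=> f1 xK xz; rewrite smooth_sumE// big_nat_cond [RHS]big_nat_cond.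
apply: eq_bigl => n; case: (leqP 1 n) => //= n1; case: ltnP => //= nx.
by rewrite smooth_ltn//; lia.
Qed.

Lemma mulf1 (R : realType) n : mulf (fun _ _ => 1 : R) n = 1.
Proof. by rewrite /mulf big1. Qed.

(** From [1 <= g * g * r] on prime powers, the harmonic sum is at most the product of three
    logarithmic sums; the one of [r] is bounded by its Euler product. *)
Lemma harmonic_le_sqr (R : realType) (g r : nat -> nat -> R) x (K : nat) :
  (forall p k, 0 <= g p k) -> (forall p, g p 0%N = 1) ->
  (forall p k, 0 <= r p k) ->
  (forall p k, prime p -> 1 <= local_conv (local_conv g g) r p k) ->
  (x < 2 ^ K)%N ->
  \sum_(1 <= n < x.+1) (n%:R : R)^-1 <=
  (\sum_(1 <= n < x.+1) mulf g n / n%:R) ^+ 2 *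
  \prod_(0 <= p < x.+1 | prime p) \sum_(k < K) r p k / (p ^ k)%:R.
Proof.
move=> g0 g1 r0 hr xK.
have -> : \sum_(1 <= n < x.+1) (n%:R : R)^-1 =
    smooth_sum K (fun _ _ => 1 : R) x.+1 x.
  by rewrite smooth_sum_full//; apply: eq_bigr => n _; rewrite mulf1 mul1r.
rewrite -(smooth_sum_full g1 xK (ltnSn x)).
have gg0 p k : 0 <= local_conv g g p k by exact: local_conv_ge0.
apply: (le_trans (le_smooth_sum_fun _ _ _ _ hr)) => //.
apply: le_trans (smooth_sum_conv_le _ _ _ gg0 r0) _.
apply: ler_pM; rewrite ?smooth_sum_ge0//; last exact: smooth_sum_le_prod.
by rewrite expr2; exact: smooth_sum_conv_le.
Qed.

(** The square of the sum over [n <= x] is a convolution sum over integers up to [x^2]; with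
    [g * g <= 1 * k] this leaves the harmonic sum up to [x^2] times the Euler product of [k]. *)
Lemma sqr_le_harmonic (R : realType) (g k : nat -> nat -> R) x (K : nat) :
  (forall p i, 0 <= g p i) -> (forall p, g p 0%N = 1) ->
  (forall p i, 0 <= k p i) ->
  (forall p i, prime p ->
    local_conv g g p i <= local_conv (fun _ _ => 1) k p i) ->
  (x ^ 2 < 2 ^ K)%N ->
  (\sum_(1 <= n < x.+1) mulf g n / n%:R) ^+ 2 <=
  (\sum_(1 <= n < (x ^ 2).+1) (n%:R : R)^-1) *
  \prod_(0 <= p < x.+1 | prime p) \sum_(i < 2 * K) k p i / (p ^ i)%:R.
Proof.
move=> g0 g1 k0 hk xK.
have xK' : (x < 2 ^ K)%N.
  by apply: leq_ltn_trans xK; case: x => // x; rewrite -mulnn leq_pmulr.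
have xK2 : (x ^ 2 < 2 ^ (2 * K))%N.
  by apply: leq_trans xK _; rewrite leq_exp2l//; lia.
rewrite -(smooth_sum_full g1 xK' (ltnSn x)) expr2.
apply: le_trans (smooth_sum_conv_ge _ _ _ _ g0 g0) _.
have gg0 p i : 0 <= local_conv g g p i by exact: local_conv_ge0.
apply: (le_trans (le_smooth_sum_fun _ _ _ _ hk)) => //.
apply: le_trans (smooth_sum_conv_le _ _ _ _ k0) _ => //.
apply: ler_pM; rewrite ?smooth_sum_ge0//; last exact: smooth_sum_le_prod.
rewrite mulnn smooth_sumE// big_mkcond; apply: ler_sum => n _.
by rewrite mulf1 mul1r; case: ifP => // _; rewrite invr_ge0.
Qed.

(** * Chebyshev's bounds *)

Lemma prime_dvdn_fact p n : prime p -> (p %| n`!)%N = (p <= n)%N.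
Proof.
move=> pp; apply/idP/idP => [|pn]; last by rewrite dvdn_fact// prime_gt0.
elim: n => [|n IH]; first by rewrite dvdn1 => /eqP p1; move: pp; rewrite p1.
rewrite factS Euclid_dvdM// => /orP[|/IH /leqW//].
exact: dvdn_leq.
Qed.

Lemma prod_primes_dvdn (s : seq nat) N : uniq s ->
  (forall p, p \in s -> prime p /\ (p %| N)%N) -> ((\prod_(p <- s) p)%N %| N)%N.
Proof.
elim: s => [|p s IH] /=; first by rewrite big_nil dvd1n.
move=> /andP[ps us] h; have [pp pN] := h p (mem_head _ _).
rewrite big_cons Gauss_dvd ?pN /=; first apply: IH => // q qs.
  by apply: h; rewrite inE qs orbT.
rewrite big_seq_cond; elim/big_ind: _ => [|a b|q]; rewrite ?coprimen1//.
  by rewrite coprimeMr => -> ->.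
rewrite andbT => qs; rewrite prime_coprime// dvdn_prime2//.
  by apply: contraNneq ps => ->.
by have [] := h q; rewrite ?inE ?qs ?orbT.
Qed.

(** Erdos' argument: the primes in [[m+2, 2m+1]] divide the binomial coefficient of [2m+1] over [m],
    which is at most [4^m] because it occurs twice in a row of total [2^(2m+1)]. Even arguments
    above [2] add no prime. *)
Lemma primorial_le4 n : (\prod_(0 <= p < n.+1 | prime p) p <= 4 ^ n)%N.
Proof.
elim/ltn_ind: n => -[|[|[|n]]] IH.
- by rewrite !big_mkcond big_nat1.
- by rewrite big_mkcond !big_nat_recr ?big_geq.
- by rewrite big_mkcond !big_nat_recr ?big_geq.
have [on|en] := boolP (odd n); last first.
  pose m := n./2.+1; have nE : n.+3 = (m.*2.+1)%N.
    by rewrite /m doubleS; have := odd_double_half n; rewrite (negbTE en); lia.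
  rewrite nE (@big_cat_nat _ _ _ m.+2) ?leq_addl//=; last by lia.
  have lem : (\prod_(0 <= p < m.+2 | prime p) p <= 4 ^ m.+1)%N by apply: IH; lia.
  have hC : (\prod_(m.+2 <= p < m.*2.+2 | prime p) p <= 'C(m.*2.+1, m))%N.
    rewrite -big_filter; apply: dvdn_leq; first by rewrite bin_gt0; lia.
    apply: prod_primes_dvdn; first by rewrite filter_uniq// iota_uniq.
    move=> p; rewrite mem_filter mem_index_iota => /and3P[pp mp pm]; split=> //.
    have := bin_fact (n := m.*2.+1) (m := m) ltac:(lia).
    have -> : (m.*2.+1 - m = m.+1)%N by lia.
    move=> E; have : (p %| (m.*2.+1)`!)%N by rewrite prime_dvdn_fact.
    rewrite -E Euclid_dvdM// => /orP[//|].
    rewrite Euclid_dvdM// !prime_dvdn_fact//; lia.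
  have hB : ('C(m.*2.+1, m) <= 4 ^ m)%N.
    have : (\sum_(i < m.*2.+2) 'C(m.*2.+1, i) = 2 ^ m.*2.+1)%N.
      by rewrite -[2%N]/(1 + 1)%N expnDn; apply: eq_bigr => i _; rewrite !exp1n !muln1.
    rewrite (bigD1 (inord m))//= (bigD1 (inord m.+1))/=; last first.
      by apply/eqP => /(congr1 val); rewrite /= !inordK//; lia.
    rewrite !inordK; try lia.
    rewrite -(bin_sub (n := m.*2.+1) (m := m.+1)); last by lia.
    have -> : (m.*2.+1 - m.+1 = m)%N by lia.
    rewrite expnS -mul2n expnM (_ : 2 ^ 2 = 4)%N//; lia.
  rewrite -[X in (_ <= 4 ^ X)%N](_ : m.+1 + m = _)%N; last by lia.
  by rewrite expnD leq_mul// (leq_trans hC).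
rewrite big_mkcond big_nat_recr//= -big_mkcond.
have -> : prime n.+3 = false.
  by apply/negP => /even_prime[//|]; rewrite /= on.
rewrite muln1; apply: leq_trans (IH n.+2 _) _; first by [].
by rewrite leq_exp2l.
Qed.

Lemma central_bin_ge n : (0 < n)%N -> (4 ^ n <= n.*2 * 'C(n.*2, n))%N.
Proof.
case: n => // n _; elim: n => [|n IH] //.
set k := n.+1 in IH *.
have h1 := mul_bin_diag k.*2.+2 k.
have h2 := mul_bin_diag k.*2.+1 k.
have h3 : ('C(k.*2.+1, k) = 'C(k.*2.+1, k.+1))%N.
  rewrite -bin_sub; last by lia.
  by congr binomial; lia.
rewrite /= in h1 h2; rewrite doubleS expnS.
set c := 'C(k.*2, k) in IH h1 h2 h3 *.
set d := 'C(k.*2.+2, k.+1) in h1 *.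
set b := 'C(k.*2.+1, k) in h1 h3.
rewrite -h3 in h2.
have h4 : (d = 2 * b)%N by nia.
rewrite h4; nia.
Qed.

(** By Legendre's formula the exponent is a sum of terms [floor(2n/p^k) - 2 floor(n/p^k)], each at
    most [1]. If [p^e > 2n], only the [e - 1] terms with [k < e] could be nonzero, a
    contradiction. *)
Lemma logn_central_bin p n : prime p -> (0 < n)%N ->
  (p ^ logn p 'C(n.*2, n) <= n.*2)%N.
Proof.
move=> pp n0; have C0 : (0 < 'C(n.*2, n))%N by rewrite bin_gt0; lia.
set e := logn p _; have p1 := prime_gt1 pp.
have q0 k : (0 < p ^ k)%N by rewrite expn_gt0 prime_gt0.
have eE : (e + (logn p n`!).*2 = logn p (n.*2)`!)%N.
  rewrite -(bin_fact (n := n.*2) (m := n)); last by lia.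
  have -> : (n.*2 - n = n)%N by lia.
  by rewrite !lognM ?muln_gt0 ?fact_gt0//= addnn.
have nE : logn p n`! = (\sum_(1 <= k < n.*2.+1) n %/ p ^ k)%N.
  rewrite logn_fact// (@big_cat_nat _ _ _ n.+1 1 n.*2.+1)//=; last by lia.
  rewrite [X in (_ + X)%N]big_nat_cond [X in (_ + X)%N]big1 ?addn0// => k.
  rewrite andbT => /andP[nk _]; rewrite divn_small//.
  exact: leq_trans nk (ltnW (ltn_expl _ p1)).
rewrite leqNgt; apply/negP => le.
have e0 : (0 < e)%N by rewrite lt0n; apply: contraTneq le => ->; rewrite expn0; lia.
have : (\sum_(1 <= k < n.*2.+1) n.*2 %/ p ^ k <=
   \sum_(1 <= k < n.*2.+1) ((n %/ p ^ k).*2 + (k < e)))%N.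
  apply: leq_sum => k _; case: ltnP => ke.
    rewrite -ltnS ltn_divLR//.
    by have := ltn_ceil n (q0 k); nia.
  by rewrite divn_small//; apply: leq_trans le _; rewrite leq_exp2l.
rewrite -logn_fact// -eE nE big_split /=.
have -> : (\sum_(1 <= k < n.*2.+1) (n %/ p ^ k).*2 =
    (\sum_(1 <= k < n.*2.+1) n %/ p ^ k).*2)%N.
  by rewrite -[RHS]mul2n [RHS]big_distrr; apply: eq_bigr => k _; rewrite /= mul2n.
have : (\sum_(1 <= k < n.*2.+1) (k < e) <= e.-1)%N.
  rewrite -big_mkcond /=.
  rewrite sum1_count -size_filter -[leqRHS](size_iota 1).
  apply: uniq_leq_size; first by rewrite filter_uniq// iota_uniq.
  by move=> k; rewrite mem_filter mem_index_iota mem_iota; lia.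
lia.
Qed.

Definition theta (R : realType) (n : nat) : R :=
  \sum_(0 <= p < n.+1 | prime p) ln p%:R.

Lemma ln_natX (R : realType) m n : (0 < m)%N ->
  ln ((m ^ n)%N%:R : R) = n%:R * ln m%:R.
Proof. by move=> m0; rewrite natrX lnXn ?ltr0n// mulr_natl. Qed.

Lemma ln_prodn (R : realType) (s : seq nat) (P : pred nat) (F : nat -> nat) :
  (forall i, P i -> (0 < F i)%N) ->
  ln ((\prod_(i <- s | P i) F i)%N%:R : R) = \sum_(i <- s | P i) ln (F i)%:R.
Proof.
move=> F0; suff [] : (0 < \prod_(i <- s | P i) F i)%N /\
  ln ((\prod_(i <- s | P i) F i)%N%:R : R) = \sum_(i <- s | P i) ln (F i)%:R by [].
elim/big_ind2: _ => [|a b c d [c0 cE] [d0 dE]|i Pi].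
- by rewrite ln1.
- by rewrite muln_gt0 c0 d0 natrM lnM ?posrE ?ltr0n// cE dE.
- by split; first exact: F0.
Qed.

Lemma theta_le (R : realType) n : theta R n <= n%:R * ln 4%:R.
Proof.
rewrite /theta -ln_prodn; last by move=> p /prime_gt0.
rewrite -ln_natX// ler_ln ?posrE ?ltr0n ?expn_gt0//.
  by rewrite ler_nat primorial_le4.
by rewrite prodn_cond_gt0// => p /prime_gt0.
Qed.

Lemma theta_ge0 (R : realType) n : 0 <= theta R n.
Proof.
by apply: sumr_ge0 => p /prime_gt0 p0; rewrite ln_ge0// ler1n.
Qed.

Lemma le_theta (R : realType) m n : (m <= n)%N -> theta R m <= theta R n.
Proof.
move=> mn; rewrite /theta (@big_cat_nat _ _ _ m.+1 0 n.+1)//= lerDl.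
by apply: sumr_ge0 => p /prime_gt0 p0; rewrite ln_ge0// ler1n.
Qed.

(** Take logarithms in [4^n <= 2n C(2n,n)] and factor the binomial coefficient. Primes above
    [sqrt(2n)] occur at most once and are paid by [theta]; each of the at most [sqrt(2n)] smaller
    ones contributes at most [ln(2n)]. *)
Lemma theta_double_ge (R : realType) n : (0 < n)%N ->
  n%:R * ln 4%:R <= theta R n.*2 + (1 + Num.sqrt n.*2%:R) * ln n.*2%:R.
Proof.
move=> n0; have C0 : (0 < 'C(n.*2, n))%N by rewrite bin_gt0; lia.
have n20 : (0 < n.*2)%N by lia.
have l0 : 0 <= ln (n.*2%:R : R) by rewrite ln_ge0// ler1n.
have h1 : n%:R * ln 4%:R <= ln (n.*2%:R : R) + ln ('C(n.*2, n)%:R).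
  rewrite -lnM ?posrE ?ltr0n// -natrM -ln_natX//.
  by rewrite ler_ln ?posrE ?ltr0n ?muln_gt0 ?expn_gt0 ?n20// ler_nat central_bin_ge.
apply: (le_trans h1); rewrite mulrDl mul1r addrCA lerD2l.
set C := 'C(n.*2, n) in C0 *.
have CE : C = (\prod_(0 <= p < n.*2.+1 | prime p) p ^ logn p C)%N.
  rewrite {1}(prod_prime_decomp C0) prime_decompE big_map /=.
  rewrite -[RHS]big_filter [RHS](bigID (mem (primes C)))/=.
  rewrite [X in _ = (_ * X)%N]big1 ?muln1; last first.
    by move=> p; rewrite -logn_gt0 -leqNgt leqn0 => /eqP ->.
  rewrite -[RHS]big_filter; apply: perm_big; apply: uniq_perm.
  - exact: primes_uniq.
  - by rewrite !filter_uniq// iota_uniq.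
  move=> p; rewrite !mem_filter mem_iota; apply/idP/idP => [pC|/andP[]//].
  have pp : prime p by move: pC; rewrite mem_primes => /andP[].
  rewrite pC pp (prime_gt0 pp) /= add1n ltnS; apply: leq_trans (logn_central_bin pp n0).
  rewrite -[leqLHS]expn1 leq_exp2l ?(prime_gt1 pp)//.
  by rewrite logn_gt0.
rewrite [in leLHS]CE ln_prodn; last by move=> p /prime_gt0 p0; rewrite expn_gt0 p0.
pose s := Num.truncn (Num.sqrt (n.*2%:R : R)).
have sP : (s%:R : R) <= Num.sqrt n.*2%:R by rewrite truncn_le ?sqrtr_ge0.
apply: (@le_trans _ _ (theta R n.*2 +
   \sum_(0 <= p < n.*2.+1 | prime p) (if (p <= s)%N then ln n.*2%:R else 0))).
  rewrite -big_split /=; apply: ler_sum => p pp.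
  have p0 : 0 <= ln (p%:R : R) by rewrite ln_ge0// ler1n prime_gt0.
  have pk0 : (0 < p ^ logn p C)%N by rewrite expn_gt0 prime_gt0.
  have lec := logn_central_bin pp n0.
  case: leqP => ps.
    by rewrite ler_wpDl// ler_ln ?posrE ?ltr0n// ler_nat.
  rewrite addr0 ler_ln ?posrE ?ltr0n ?(prime_gt0 pp)// ler_nat.
  rewrite -[leqRHS]expn1 leq_exp2l ?(prime_gt1 pp)// leqNgt; apply/negP => l2.
  have : (p ^ 2 <= n.*2)%N.
    by apply: leq_trans lec; rewrite leq_exp2l ?(prime_gt1 pp).
  rewrite leqNgt => /negP; apply.
  rewrite -(@ltr_nat R) natrX -[ltLHS]sqr_sqrtr ?ler0n//.
  rewrite ltr_pXn2r ?nnegrE ?sqrtr_ge0 ?ler0n//.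
  by apply: (@lt_le_trans _ _ (s.+1%:R)); rewrite ?ler_nat// truncnS_gt.
rewrite lerD2l -big_mkcondr /= big_const_seq iter_addr_0 -[leLHS]mulr_natl.
apply: ler_wpM2r => //; apply: le_trans sP; rewrite ler_nat.
rewrite -size_filter -[leqRHS](size_iota 1).
apply: uniq_leq_size; first by rewrite filter_uniq// iota_uniq.
move=> p; rewrite mem_filter mem_iota => /andP[/andP[/prime_gt0 p0 ps] _].
by rewrite p0 add1n ltnS.
Qed.

Lemma ln_le_eps (R : realType) (e : R) : 0 < e ->
  exists2 K : R, 0 <= K & forall y, 0 < y -> ln y <= e * y + K.
Proof.
move=> e0; exists (Num.max 0 (- ln e)); first by rewrite le_max lexx.
move=> y y0; have ey0 : 0 < e * y by rewrite mulr_gt0.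
have := le_ln1Dx (x := e * y - 1).
have -> : 1 + (e * y - 1) = e * y by ring.
rewrite lnM ?posrE//; have : - ln e <= Num.max 0 (- ln e) by rewrite le_max lexx orbT.
move: (Num.max _ _) => K hK h; have := h ltac:(lra); lra.
Qed.

Lemma sqrt_ln_le_eps (R : realType) (e : R) : 0 < e ->
  exists2 K : R, 0 <= K &
    forall y, 1 <= y -> (1 + Num.sqrt y) * ln y <= e * y + K.
Proof.
(* With [t = sqrt y], expanding costs [4 d t^2], and completing the square in the linear term
   [4 K0 t] costs one more [d t^2]. *)
move=> e0; pose d := e / 5; have d0 : 0 < d by rewrite /d; lra.
have [K0 K00 hK] := ln_le_eps d0.
exists (4 * K0 ^+ 2 / d); first by rewrite divr_ge0 ?(ltW d0)// mulr_ge0// sqr_ge0.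
move=> y y1; set t := Num.sqrt y.
have yE : y = t ^+ 2 by rewrite sqr_sqrtr//; lra.
have t1 : 1 <= t by rewrite -sqrtr1 ler_wsqrtr.
have -> : ln y = 2 * ln t by rewrite yE lnXn ?mulr_natl//; lra.
have lt := hK t ltac:(lra).
have h1 : (1 + t) * (2 * ln t) <= 2 * t * (2 * (d * t + K0)).
  apply: ler_pM; rewrite ?mulr_ge0 ?ln_ge0//; lra.
apply: (le_trans h1).
have h2 : 4 * K0 * t <= d * t ^+ 2 + 4 * K0 ^+ 2 / d.
  rewrite -subr_ge0.
  have -> : d * t ^+ 2 + 4 * K0 ^+ 2 / d - 4 * K0 * t = (d * t - 2 * K0) ^+ 2 / d.
    by field; rewrite gt_eqF.
  by rewrite divr_ge0 ?sqr_ge0// ltW.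
have -> : e = 5 * d by rewrite /d; field.
by rewrite yE; nra.
Qed.

Lemma theta_ge (R : realType) (e : R) : 0 < e ->
  exists2 K : R, 0 <= K & forall n, (ln 2 - e) * n%:R - K <= theta R n.
Proof.
move=> e0; have [K K0 hK] := sqrt_ln_le_eps e0.
have l2 : 0 < ln (2 : R) by rewrite ln_gt0//; lra.
exists (K + ln 2); first lra.
move=> n; have [n2|n2] := ltnP n 2.
  have := theta_ge0 R n; have : (n%:R : R) <= 1 by rewrite lern1.
  have : (0 : R) <= n%:R by []. nra.
pose m := n./2; have m0 : (0 < m)%N by rewrite /m; lia.
have mn : (m.*2 <= n)%N by rewrite /m; lia.
have nm : (n <= m.*2.+1)%N by rewrite /m; lia.
have h1 := le_theta R mn; have h2 := theta_double_ge R m0.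
have m1 : (1 : R) <= m.*2%:R by rewrite ler1n; lia.
have h3 := hK _ m1.
have l4 : ln (4 : R) = 2 * ln 2.
  by rewrite (_ : 4 = 2 ^+ 2 :> R) ?lnXn ?mulr_natl//; lra.
rewrite l4 in h2.
have h4 : (m.*2%:R : R) = 2 * m%:R by rewrite -mul2n natrM.
have h5 : (n%:R : R) <= m.*2%:R + 1 by rewrite natr1 ler_nat.
have h6 : (m.*2%:R : R) <= n%:R by rewrite ler_nat.
rewrite h4 in h1 h2 h3 h5 h6.
nra.
Qed.

Lemma expR_half_ge (R : realType) (a b x : R) : 0 <= a -> b <= a ^+ 2 ->
  a <= expR (x / 2) -> b <= expR x.
Proof.
move=> a0 ba h; apply: (le_trans ba).
have -> : expR x = expR (x / 2) ^+ 2.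
  by rewrite -expRM_natr divfK.
by rewrite ler_pXn2r ?nnegrE// (le_trans a0).
Qed.

(** The argument of [expR] is halved seven (resp. six) times, until [1 + x <= expR x] is accurate
    enough. The decimals, read upwards from the last, are successive squares of that value rounded
    down. *)
Lemma ln2_bounds (R : realType) : 
  (69 / 100 : R) <= ln (2 : R) <= 7 / 10.
Proof.
apply/andP; split.
  rewrite -ler_expR lnK ?posrE//.
  suff h : 2^-1 <= expR (- (69 / 100)) :> R.
    rewrite expRN lef_pV2 ?posrE ?expR_gt0// in h.
  apply: (@expR_half_ge _ (70724%:R / 100000%:R)); [lra|lra|].
  apply: (@expR_half_ge _ (84098%:R / 100000%:R)); [lra|lra|].
  apply: (@expR_half_ge _ (91705%:R / 100000%:R)); [lra|lra|].
  apply: (@expR_half_ge _ (95763%:R / 100000%:R)); [lra|lra|].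
  apply: (@expR_half_ge _ (97859%:R / 100000%:R)); [lra|lra|].
  apply: (@expR_half_ge _ (98924%:R / 100000%:R)); [lra|lra|].
  apply: (@expR_half_ge _ (994609%:R / 1000000%:R)); [lra|lra|].
  apply: le_trans (expR_ge1Dx _); lra.
rewrite -ler_expR lnK ?posrE//.
apply: (@expR_half_ge _ (141619%:R / 100000%:R)); [lra|lra|].
apply: (@expR_half_ge _ (119004%:R / 100000%:R)); [lra|lra|].
apply: (@expR_half_ge _ (109089%:R / 100000%:R)); [lra|lra|].
apply: (@expR_half_ge _ (104446%:R / 100000%:R)); [lra|lra|].
apply: (@expR_half_ge _ (102199%:R / 100000%:R)); [lra|lra|].
apply: (@expR_half_ge _ (10109375%:R / 10000000%:R)); [lra|lra|].
apply: le_trans (expR_ge1Dx _); lra.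
Qed.

(** * Logarithmic sums of the two densities *)

Lemma harmonic_ge (R : realType) x :
  ln (x.+1%:R : R) <= \sum_(1 <= n < x.+1) (n%:R : R)^-1.
Proof.
elim: x => [|x IH]; first by rewrite big_geq// ln1.
rewrite big_nat_recr//=; apply: le_trans (lerD IH (lexx _)).
have x0 : (0 : R) < x.+1%:R by rewrite ltr0n.
have -> : (x.+2%:R : R) = x.+1%:R * (1 + x.+1%:R^-1).
  by rewrite mulrDr mulr1 divff ?gt_eqF// natr1.
have i0 : (0 : R) < x.+1%:R^-1 by rewrite invr_gt0.
have j0 : (0 : R) < 1 + x.+1%:R^-1 by rewrite addr_gt0.
rewrite lnM ?posrE//.
by rewrite lerD2l le_ln1Dx// (lt_trans _ i0)// ltrN10.
Qed.

Lemma harmonic_le (R : realType) x : (0 < x)%N ->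
  \sum_(1 <= n < x.+1) (n%:R : R)^-1 <= 1 + ln x%:R.
Proof.
case: x => // x _; elim: x => [|x IH].
  by rewrite big_nat1 ln1 invr1 addr0.
rewrite big_nat_recr//=; apply: le_trans (lerD IH (lexx _)) _.
have x0 : (0 : R) < x.+2%:R by rewrite ltr0n.
have i0 : (0 : R) < x.+2%:R^-1 by rewrite invr_gt0.
have i1 : (x.+2%:R : R)^-1 < 1 by rewrite invf_lt1// ltr1n.
have -> : (x.+1%:R : R) = x.+2%:R * (1 - x.+2%:R^-1).
  by rewrite mulrBr mulr1 divff ?gt_eqF// -[x.+2]addn1 natrD addrK.
have j0 : (0 : R) < 1 - x.+2%:R^-1 by rewrite subr_gt0.
rewrite lnM ?posrE//.
set u := x.+2%:R^-1 in i0 i1 j0 *; set v := ln _.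
by have := @le_ln1Dx R (- u); rewrite ltrN2 => /(_ i1); lra.
Qed.

Lemma sum_expr_le (R : realType) (u : R) n : 0 <= u < 1 ->
  \sum_(i < n) u ^+ i <= (1 - u)^-1.
Proof.
move=> /andP[u0 u1]; have u1' : 0 < 1 - u by lra.
rewrite -[leRHS]mul1r ler_pdivlMr// mulrC.
have := subrX1 u n; have := exprn_ge0 n u0.
set S := \sum_(i < n) _ => h1 h2.
by rewrite -opprB mulNr -h2; lra.
Qed.

(** Through [mulf] this is the density [g] supported on squarefree numbers, with [g(p) = s p / p]
    when [s p] residue classes are counted mod [p]. *)
Definition sqfree_weight (R : realType) (s : nat -> nat) (p k : nat) : R :=
  match k with 0%N => 1 | 1%N => (s p)%:R / p%:R | _ => 0 end.

Lemma sqfree_weight_ge0 (R : realType) s p k : 0 <= sqfree_weight R s p k.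
Proof. by case: k => [|[|k]] //=; rewrite divr_ge0. Qed.

Lemma mulf_sqfree (R : realType) s c : sqfree c ->
  c%:R * mulf (sqfree_weight R s) c = (\prod_(p <- primes c) s p)%N%:R.
Proof.
elim/sqfree_ind: c / => [|p c pp pc sc IH]; first by rewrite /mulf !big_nil mul1r.
have c0 := sqfree_gt0 sc.
have -> : mulf (sqfree_weight R s) (p * c) = (s p)%:R / p%:R * mulf (sqfree_weight R s) c.
  by rewrite -[p in LHS]expn1 mulf_pfactor_mul.
rewrite (perm_big _ (perm_primes_prime_mul pp c0 pc)) big_cons !natrM -IH.
have p0 : (p%:R : R) != 0 by rewrite pnatr_eq0 -lt0n prime_gt0.
by field.
Qed.

Lemma mulf_nsqfree (R : realType) s c : (0 < c)%N -> ~~ sqfree c ->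
  mulf (sqfree_weight R s) c = 0.
Proof.
move=> c0; rewrite /sqfree c0 /= => /allPn[p pc lp].
rewrite /mulf (bigD1_seq p)//= ?primes_uniq//.
move: pc lp; rewrite -logn_gt0; case: logn => [|[|k]] //= _ _.
by rewrite mul0r.
Qed.

Lemma mulf_ge0 (R : realType) (f : nat -> nat -> R) n :
  (forall p k, 0 <= f p k) -> 0 <= mulf f n.
Proof. by move=> f0; apply: prodr_ge0. Qed.

Lemma mulf_le1 (R : realType) s n : (forall p, prime p -> (s p <= p)%N) ->
  mulf (sqfree_weight R s) n <= 1.
Proof.
move=> hs; rewrite /mulf big_seq; apply: prodr_ile1 => p.
rewrite mem_primes => /andP[pp _]; rewrite sqfree_weight_ge0 /=.
case: logn => [|[|k]] //=.
by rewrite ler_pdivrMr ?mul1r ?ler_nat ?hs// ltr0n prime_gt0.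
Qed.

Lemma sqfree_weight_conv0 (R : realType) s p :
  local_conv (sqfree_weight R s) (sqfree_weight R s) p 0 = 1.
Proof. by rewrite /local_conv big_ord_recl big_ord0 /= mulr1 addr0. Qed.

Lemma sqfree_weight_conv1 (R : realType) s p :
  local_conv (sqfree_weight R s) (sqfree_weight R s) p 1 = 2 * ((s p)%:R / p%:R).
Proof. by rewrite /local_conv !big_ord_recl big_ord0 /=; ring. Qed.

Lemma sqfree_weight_conv2 (R : realType) s p :
  local_conv (sqfree_weight R s) (sqfree_weight R s) p 2 = ((s p)%:R / p%:R) ^+ 2.
Proof. by rewrite /local_conv !big_ord_recl big_ord0 /=; ring. Qed.

Lemma sqfree_weight_conv3 (R : realType) s p k :
  local_conv (sqfree_weight R s) (sqfree_weight R s) p k.+3 = 0.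
Proof.
rewrite /local_conv big1// => -[[|[|[|i]]] ik] _ /=; rewrite ?mulr0 ?mul0r//.
Qed.

(* Half of the integers [n] in the product are skipped, as odd primes are odd:
   [t] telescopes over [n./2]. *)
Lemma prod_primes_telescope (R : realType) (F t : nat -> R) z0 z :
  (2 < z0)%N -> (z0 <= z)%N -> (forall p, 0 <= F p) ->
  (forall k, (z0./2 <= k)%N -> t k <= t k.+1) ->
  (forall p, prime p -> odd p -> (z0 <= p)%N -> F p * t p./2 <= t (p./2).+1) ->
  (\prod_(0 <= p < z | prime p) F p) * t (z0./2) <=
  (\prod_(0 <= p < z0 | prime p) F p) * t (z./2).
Proof.
move=> z2 + F0 tmono h; elim: z => [|z IH]; first by lia.
rewrite leq_eqVlt => /orP[/eqP <- //|]; rewrite ltnS => zz.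
have {}IH := IH zz.
have P0 a : 0 <= \prod_(0 <= p < a | prime p) F p by rewrite prodr_ge0.
rewrite big_mkcond big_nat_recr//= -big_mkcond.
have [pz|npz] := boolP (prime z).
  have oz : odd z by have := even_prime pz; lia.
  rewrite mulrAC; apply: le_trans (ler_wpM2r (F0 z) IH) _.
  rewrite -mulrA; apply: ler_wpM2l => //.
  have zE : uphalf z = (z./2).+1 by rewrite uphalf_half oz.
  by rewrite zE mulrC h.
have zE : odd z -> t (uphalf z) = t (z./2).+1 by rewrite uphalf_half => ->.
rewrite mulr1; have [oz|ez] := boolP (odd z); last first.
  by rewrite uphalf_half (negbTE ez).
apply: (le_trans IH); apply: ler_wpM2l => //; rewrite zE//; apply: tmono; exact: half_leq.
Qed.

(* The number of nonzero squares mod an odd prime [p]; the value [0] at [2]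
   discards even [c]. *)
Definition lower_classes (p : nat) : nat := (p.-1)./2.
(* The number of all squares mod [p], including [p = 2]. *)
Definition upper_classes (p : nat) : nat := (p./2).+1.

Lemma odd_prime_inv (R : realType) p : prime p -> odd p ->
  [/\ (0 : R) < p%:R^-1, (p%:R^-1 : R) <= 3^-1,
      (lower_classes p)%:R / p%:R = (1 - p%:R^-1) / 2 :> R &
      (upper_classes p)%:R / p%:R = (1 + p%:R^-1) / 2 :> R].
Proof.
move=> pp op; have p3 := odd_prime_gt2 op pp.
have p0 : (0 : R) < p%:R by rewrite ltr0n; lia.
split; first by rewrite invr_gt0.
- by rewrite lef_pV2 ?posrE// ler_nat.
- have h : (p.-1)./2.*2 = p.-1 by have := odd_double_half p; lia.
  have : (((p.-1)./2.*2)%:R : R) = p%:R - 1 by rewrite h -subn1 natrB//; lia.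
  move=> E; rewrite /lower_classes.
  have -> : ((p.-1)./2%:R : R) = (p%:R - 1) / 2 by rewrite -E -mul2n natrM; field.
  by field; rewrite gt_eqF.
have h : ((p./2).+1.*2 = p.+1)%N by have := odd_double_half p; lia.
have E : (((p./2).+1.*2)%:R : R) = p%:R + 1 by rewrite h -natr1.
rewrite /upper_classes.
have -> : ((p./2).+1%:R : R) = (p%:R + 1) / 2 by rewrite -E -mul2n natrM; field.
by field; rewrite gt_eqF.
Qed.

(* A simple nonnegative [r] with [1 <= g * g * r], where [g(p) = (1 - 1/p)/2]
   for odd [p] and [g(2) = 0]. *)
Definition lower_correction (R : realType) (p k : nat) : R :=
  if p == 2%N then 1 else
  match k with 0%N => 1 | 1%N => p%:R^-1 | _ => 3 / 4 end.

Lemma lower_correction_ge0 (R : realType) p k : 0 <= lower_correction R p k.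
Proof.
rewrite /lower_correction; case: ifP => // _; case: k => [|[|k]]//; by rewrite ?invr_ge0.
Qed.

(** For odd [p], the exponent [1] is an equality: [(1 - 1/p) + 1/p = 1]. For the exponent [2], the
    value [3/4] completes [g(p)^2], which is near [1/4]; beyond it the first two terms suffice. *)
Lemma lower_correctionP (R : realType) p k : prime p ->
  1 <= local_conv (local_conv (sqfree_weight R lower_classes)
        (sqfree_weight R lower_classes)) (lower_correction R) p k.
Proof.
move=> pp; set g := sqfree_weight R lower_classes.
have c0 i : 0 <= local_conv g g p i by apply: local_conv_ge0 => *; exact: sqfree_weight_ge0.
have r0 i := lower_correction_ge0 R p i.
rewrite {1}/local_conv big_ord_recl /= subn0 sqfree_weight_conv0 mul1r.
have [->|p2] := eqVneq p 2%N.
  rewrite {1}/lower_correction eqxx lerDl sumr_ge0// => i _.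
  by rewrite mulr_ge0 ?lower_correction_ge0//; apply: local_conv_ge0 => *; exact: sqfree_weight_ge0.
have op : odd p by case: (even_prime pp) => // e; rewrite e in p2.
have [u0 u3 gE _] := odd_prime_inv R pp op.
set u := p%:R^-1 in u0 u3 gE.
case: k => [|k]; first by rewrite big_ord0 /lower_correction (negbTE p2) addr0.
rewrite big_ord_recl /= /bump /= addn0 subSS subn0 sqfree_weight_conv1 gE.
case: k => [|k].
  by rewrite big_ord0 /lower_correction (negbTE p2) -/u; lra.
rewrite big_ord_recl /= /bump /= addn0 !subSS subn0 sqfree_weight_conv2 gE.
have S0 n (F : 'I_n -> nat) (G : 'I_n -> nat) :
  0 <= \sum_(i < n) local_conv g g p (F i) * lower_correction R p (G i).
  by apply: sumr_ge0 => i _; rewrite mulr_ge0.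
case: k => [|k].
  by rewrite big_ord0 /lower_correction (negbTE p2) -/u; nra.
have := S0 _ (fun i : 'I_k.+1 => (1 + (1 + (1 + i)))%N)
  (fun i : 'I_k.+1 => (k.+3 - (1 + (1 + (1 + i))))%N).
have h : 0 <= ((1 - u) / 2) ^+ 2 * lower_correction R p k.+1.
  by rewrite mulr_ge0 ?sqr_ge0.
have lc i : lower_correction R p i.+2 = 3 / 4.
  by rewrite /lower_correction (negbTE p2).
by rewrite /= !lc; lra.
Qed.

Lemma lower_euler_factor (R : realType) p K : prime p ->
  \sum_(k < K) lower_correction R p k / (p ^ k)%:R <=
  if p == 2%N then 2 else 1 + p%:R ^- 2 + 3 / 4 / (p%:R * (p%:R - 1)).
Proof.
move=> pp; have p0 : (0 : R) < p%:R by rewrite ltr0n prime_gt0.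
have p1 : (1 : R) < p%:R by rewrite ltr1n prime_gt1.
have u0 : 0 < (p%:R^-1 : R) by rewrite invr_gt0.
have u1 : (p%:R^-1 : R) < 1 by rewrite invf_lt1.
have geo n := sum_expr_le n (u := (p%:R^-1 : R)) ltac:(by rewrite ltW).
case: eqVneq => p2.
  have -> : 2 = (1 - p%:R^-1)^-1 :> R by rewrite p2; field.
  apply: le_trans (geo K); apply: ler_sum => i _.
  by rewrite /lower_correction p2 eqxx mul1r natrX exprVn.
rewrite /lower_correction (negbTE p2).
have T0 : 0 <= p%:R ^- 2 + 3 / 4 / (p%:R * (p%:R - 1)) :> R.
  rewrite addr_ge0 ?invr_ge0 ?exprn_ge0 ?ltW//; apply: divr_gt0; first lra.
  by rewrite mulr_gt0//; lra.
case: K => [|[|K]].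
- by rewrite big_ord0; lra.
- by rewrite big_ord_recl big_ord0 /= expn0 divr1 addr0; lra.
rewrite !big_ord_recl /= expn0 expn1 divr1.
have -> : \sum_(i < K) 3 / 4 / (p ^ bump 0 (bump 0 i))%:R =
   3 / 4 * p%:R ^- 2 * \sum_(i < K) p%:R^-1 ^+ i :> R.
  rewrite mulr_sumr; apply: eq_bigr => i _; rewrite /bump /= !add1n natrX.
  by rewrite exprS exprS !invfM exprVn; ring.
have g2 := geo K.
have -> : p%:R ^- 2 = p%:R^-1 * p%:R^-1 :> R by rewrite -exprVn expr2.
have -> : 3 / 4 / (p%:R * (p%:R - 1)) =
   3 / 4 * (p%:R^-1 * p%:R^-1) * (1 - p%:R^-1)^-1 :> R.
  by field; rewrite ?gt_eqF//; lra.
rewrite addrA lerD2l; exact: ler_wpM2l.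
Qed.

(** The factors at [2, 3, 5, 7] are exact, and the tail from [11] on telescopes, costing at most
    [1 / t 5 = 1000/908]. *)
Lemma lower_euler_product (R : realType) z K : (11 <= z)%N ->
  \prod_(0 <= p < z | prime p)
    (\sum_(k < K) lower_correction R p k / (p ^ k)%:R) <= 305 / 100.
Proof.
move=> z11.
pose F p : R := if p == 2%N then 2 else
   Num.max 0 (1 + p%:R ^- 2 + 3 / 4 / (p%:R * (p%:R - 1))).
(* With [k = p./2] the factor at [p] is about [1 + (7/4) / (2k)^2], so the telescoping coefficient
   must slightly exceed [7/16]. *)
pose t k : R := 1 - 46 / 100 / k%:R.
have F0 p : 0 <= F p by rewrite /F; case: ifP => // _; rewrite le_max lexx.
apply: (@le_trans _ _ (\prod_(0 <= p < z | prime p) F p)).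
  apply: ler_prod => p pp; rewrite sumr_ge0 /=; last first.
    by move=> k _; rewrite divr_ge0 ?lower_correction_ge0.
  apply: le_trans (lower_euler_factor R K pp) _; rewrite /F; case: ifP => // _.
  by rewrite le_max lexx orbT.
have tmono k : (11./2 <= k)%N -> t k <= t k.+1.
  move=> k5; rewrite /t lerD2l lerN2 ler_wpM2l//.
  by rewrite lef_pV2 ?posrE ?ltr0n// ?ler_nat//; lia.
have step p : prime p -> odd p -> (11 <= p)%N -> F p * t p./2 <= t (p./2).+1.
  move=> pp op p11; rewrite /F ifF; last by apply/eqP; lia.
  set k := p./2; have pE : p = (k.*2.+1)%N.
    by rewrite /k; have := odd_double_half p; lia.
  have k5 : (5 : R) <= k%:R by rewrite ler_nat /k; lia.
  have pR : (p%:R : R) = 2 * k%:R + 1 by rewrite pE -natr1 -mul2n natrM.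
  rewrite /t -[k.+1%:R]natr1 pR.
  set x := k%:R in k5 *.
  rewrite max_r; last first.
    rewrite !addr_ge0 ?divr_ge0 ?mulr_ge0 ?invr_ge0 ?exprn_ge0//; lra.
  rewrite -subr_ge0.
  have -> : 1 - 46 / 100 / (x + 1) - (1 + (2 * x + 1) ^- 2 +
     3 / 4 / ((2 * x + 1) * (2 * x + 1 - 1))) * (1 - 46 / 100 / x) =
     (46 / 100 / (x * (x + 1)) - ((2 * x + 1) ^- 2 +
     3 / 4 / ((2 * x + 1) * (2 * x))) * (1 - 46 / 100 / x)).
    by field; rewrite ?gt_eqF//=; lra.
  have -> : 46 / 100 / (x * (x + 1)) - ((2 * x + 1) ^- 2 +
     3 / 4 / ((2 * x + 1) * (2 * x))) * (1 - 46 / 100 / x) =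
     (46 / 100 * 8 * x * (2 * x + 1) ^+ 2 - (8 * x + 3 * (2 * x + 1)) * (x - 46 / 100) * (x + 1))
       / (8 * x ^+ 2 * (x + 1) * (2 * x + 1) ^+ 2).
    by field; rewrite ?gt_eqF//=; lra.
  apply: divr_ge0; last by rewrite !mulr_ge0 ?exprn_ge0//; lra.
  nra.
have := prod_primes_telescope (z0 := 11) isT z11 F0 tmono step.
have -> : \prod_(0 <= p < 11 | prime p) F p = F 2%N * F 3%N * F 5%N * F 7%N.
  by rewrite big_mkcond !big_nat_recr//= big_geq// !mul1r !mulr1.
have -> : F 2%N = 2 by rewrite /F.
have -> : F 3%N = 89 / 72.
  rewrite /F /=; have -> : 1 + 3 ^- 2 + 3 / 4 / (3 * (3 - 1)) = 89 / 72 :> R by field.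
  by apply: max_r; rewrite divr_ge0 ?ler0n.
have -> : F 5%N = 431 / 400.
  rewrite /F /=; have -> : 1 + 5 ^- 2 + 3 / 4 / (5 * (5 - 1)) = 431 / 400 :> R by field.
  by apply: max_r; rewrite divr_ge0 ?ler0n.
have -> : F 7%N = 407 / 392.
  rewrite /F /=; have -> : 1 + 7 ^- 2 + 3 / 4 / (7 * (7 - 1)) = 407 / 392 :> R by field.
  by apply: max_r; rewrite divr_ge0 ?ler0n.
have -> : t 11./2 = 908 / 1000 by rewrite /t /=; field.
have tz : t z./2 <= 1 by rewrite /t gerBl divr_ge0//; lra.
by move: tz; set y := t z./2; set P := bigop.body _ _ _ => tz h; lra.
Qed.

Lemma lower_log_sum (R : realType) x : (10 <= x)%N ->
  ln (x.+1%:R : R) <= 305 / 100 *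
   (\sum_(1 <= n < x.+1) mulf (sqfree_weight R lower_classes) n / n%:R) ^+ 2.
Proof.
move=> x10; apply: le_trans (harmonic_ge R x) _.
apply: le_trans (harmonic_le_sqr _ _ _ (@lower_correctionP R) (ltn_expl x (ltnSn 1))) _ => //.
- exact: sqfree_weight_ge0.
- exact: lower_correction_ge0.
rewrite mulrC; apply: ler_wpM2r; first exact: sqr_ge0.
exact: lower_euler_product.
Qed.

(* The function [k] with [g * g <= 1 * k], where [g(p) = (1 + 1/p)/2] for odd
   [p] and [g(2) = 1]. *)
Definition upper_correction (R : realType) (p k : nat) : R :=
  match k with 0%N => 1 | 1%N => if p == 2%N then 1 else p%:R^-1 | _ => 0 end.

Lemma upper_correction_ge0 (R : realType) p k : 0 <= upper_correction R p k.
Proof. by case: k => [|[|k]] //=; case: ifP => // _; rewrite invr_ge0. Qed.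

Lemma upper_classes_le p : prime p -> (upper_classes p <= p)%N.
Proof. by move=> /prime_gt1; rewrite /upper_classes; lia. Qed.

(** At exponent [1] both sides agree: [2 g(p) = 1 + 1/p] for odd [p], and [2 = 1 + 1] at [p = 2]. At
    exponent [2], [g(p)^2 <= 1], and the left side vanishes afterwards. *)
Lemma upper_correctionP (R : realType) p k : prime p ->
  local_conv (sqfree_weight R upper_classes) (sqfree_weight R upper_classes) p k
  <= local_conv (fun _ _ => 1) (upper_correction R) p k.
Proof.
move=> pp; have p0 : (0 : R) < p%:R by rewrite ltr0n prime_gt0.
case: k => [|[|[|k]]].
- by rewrite sqfree_weight_conv0 /local_conv big_ord_recl big_ord0 /= mulr1 addr0.
- rewrite sqfree_weight_conv1 /local_conv !big_ord_recl big_ord0 /= mul1r mulr1 addr0.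
  case: eqVneq => p2; first by rewrite p2 /upper_classes /=; lra.
  have op : odd p by case: (even_prime pp) => // e; rewrite e in p2.
  have [_ _ _ ->] := odd_prime_inv R pp op.
  by set u := p%:R^-1; lra.
- rewrite sqfree_weight_conv2 /local_conv !big_ord_recl big_ord0 /= !mul1r add0r addr0.
  apply: (@le_trans _ _ 1); last by rewrite lerDr; case: ifP => // _; rewrite invr_ge0 ltW.
  rewrite expr_le1// ?divr_ge0// ler_pdivrMr// mul1r ler_nat.
  exact: upper_classes_le.
rewrite sqfree_weight_conv3; apply: local_conv_ge0 => // *.
exact: upper_correction_ge0.
Qed.

Lemma upper_euler_factor (R : realType) p K : prime p ->
  \sum_(k < K) upper_correction R p k / (p ^ k)%:R <=
  if p == 2%N then 3 / 2 else 1 + p%:R ^- 2.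
Proof.
move=> pp; have p0 : (0 : R) < p%:R by rewrite ltr0n prime_gt0.
have T0 : 1 <= (if p == 2%N then 3 / 2 else 1 + p%:R ^- 2) :> R.
  by case: ifP => _; [lra|rewrite lerDl invr_ge0 exprn_ge0// ltW].
case: K => [|[|K]].
- by rewrite big_ord0; apply: le_trans T0.
- by rewrite big_ord_recl big_ord0 /= expn0 divr1 addr0.
rewrite !big_ord_recl big1 /=; last by move=> i _; rewrite /bump /= mul0r.
rewrite expn0 expn1 divr1 addr0; case: ifP => [/eqP ->|_]; first lra.
by rewrite lerD2l -invfM -expr2.
Qed.

Lemma upper_euler_product (R : realType) z K : (3 <= z)%N ->
  \prod_(0 <= p < z | prime p)
    (\sum_(k < K) upper_correction R p k / (p ^ k)%:R) <= 2.
Proof.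
move=> z3.
pose F p : R := if p == 2%N then 3 / 2 else 1 + p%:R ^- 2.
(* Since [p^2] is about [4 k^2] for [k = p./2], the coefficient is [1/4]. The result is
   [(3/2) / t 1 = 2], using the exact factor only at [2]. *)
pose t k : R := 1 - 1 / 4 / k%:R.
have F0 p : 0 <= F p.
  by rewrite /F; case: ifP => _; [lra|rewrite addr_ge0// invr_ge0 exprn_ge0].
apply: (@le_trans _ _ (\prod_(0 <= p < z | prime p) F p)).
  apply: ler_prod => p pp; rewrite sumr_ge0 /=; last first.
    by move=> k _; rewrite divr_ge0 ?upper_correction_ge0.
  exact: upper_euler_factor.
have tmono k : (3./2 <= k)%N -> t k <= t k.+1.
  move=> k5; rewrite /t lerD2l lerN2 ler_wpM2l//.
  by rewrite lef_pV2 ?posrE ?ltr0n// ?ler_nat//; lia.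
have step p : prime p -> odd p -> (3 <= p)%N -> F p * t p./2 <= t (p./2).+1.
  move=> pp op p3; rewrite /F ifF; last by apply/eqP; lia.
  set k := p./2; have pE : p = (k.*2.+1)%N.
    by rewrite /k; have := odd_double_half p; lia.
  have k1 : (1 : R) <= k%:R by rewrite ler1n /k; lia.
  have pR : (p%:R : R) = 2 * k%:R + 1 by rewrite pE -natr1 -mul2n natrM.
  rewrite /t -[k.+1%:R]natr1 pR.
  set x := k%:R in k1 *; rewrite -subr_ge0.
  have -> : 1 - 1 / 4 / (x + 1) - (1 + (2 * x + 1) ^- 2) * (1 - 1 / 4 / x) =
     ((2 * x + 1) ^+ 2 - (4 * x - 1) * (x + 1)) / (4 * x * (x + 1) * (2 * x + 1) ^+ 2).
    by field; rewrite ?gt_eqF//=; lra.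
  apply: divr_ge0; last by rewrite !mulr_ge0 ?exprn_ge0//; lra.
  nra.
have := prod_primes_telescope (z0 := 3) isT z3 F0 tmono step.
have -> : \prod_(0 <= p < 3 | prime p) F p = F 2%N.
  by rewrite big_mkcond !big_nat_recr//= big_geq// !mul1r.
have -> : F 2%N = 3 / 2 by rewrite /F.
have -> : t 3./2 = 3 / 4 by rewrite /t /=; field.
have tz : t z./2 <= 1 by rewrite /t gerBl divr_ge0//; lra.
by move: tz; set y := t z./2; set P := bigop.body _ _ _ => tz h; lra.
Qed.

Lemma upper_log_sum (R : realType) x : (2 <= x)%N ->
  (\sum_(1 <= n < x.+1) mulf (sqfree_weight R upper_classes) n / n%:R) ^+ 2
  <= 2 * (1 + 2 * ln x%:R).
Proof.
move=> x2.
apply: le_trans (sqr_le_harmonic _ _ _ (@upper_correctionP R)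
  (ltn_expl (x ^ 2) (ltnSn 1))) _ => //.
- exact: sqfree_weight_ge0.
- exact: upper_correction_ge0.
rewrite mulrC; apply: ler_pM.
- by apply: prodr_ge0 => p _; apply: sumr_ge0 => k _; rewrite divr_ge0 ?upper_correction_ge0.
- by apply: sumr_ge0 => k _; rewrite invr_ge0.
- exact: upper_euler_product.
apply: le_trans (harmonic_le R _) _; first by rewrite expn_gt0; lia.
by rewrite ln_natX//; lia.
Qed.

(** * The constants [kappa_1] and [pi] *)

Lemma sum_dvd_nat (R : realType) (F : nat -> R) d x : (0 < d)%N ->
  \sum_(1 <= n < x.+1 | (d %| n)%N) F n =
  \sum_(1 <= m < (x %/ d).+1) F (d * m)%N.
Proof.
move=> d0; rewrite -big_filter.
rewrite (perm_big [seq (d * m)%N | m <- index_iota 1 (x %/ d).+1]).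
  by rewrite big_map.
apply: uniq_perm; first by rewrite filter_uniq// iota_uniq.
  by rewrite map_inj_uniq ?iota_uniq// => m m' /eqP; rewrite eqn_pmul2l// => /eqP.
move=> n; rewrite mem_filter mem_index_iota; apply/idP/mapP => [/andP[/dvdnP[m ->]]|].
  rewrite ltnS muln_gt0 d0 andbT => /andP[m0 mx].
  by exists m; rewrite 1?mulnC// mem_index_iota m0 ltnS leq_divRL.
move=> [m]; rewrite mem_index_iota ltnS leq_divRL// mulnC => /andP[m0 mx] ->.
by rewrite dvdn_mulr// muln_gt0 d0 m0 ltnS.
Qed.

Lemma sum_inv_sqr_le (R : realType) a b : (1 < a)%N -> (a <= b)%N ->
  \sum_(a <= n < b) (n%:R ^+ 2)^-1 <= (a.-1%:R)^-1 - (b.-1%:R)^-1 :> R.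
Proof.
move=> a1; elim: b => [|b IH]; first by lia.
rewrite leq_eqVlt => /orP[/eqP <-|]; first by rewrite big_geq// subrr.
rewrite ltnS => ab; rewrite big_nat_recr//=.
apply: le_trans (lerD (IH ab) (lexx _)) _; rewrite -addrA lerD2l.
have b1 : (1 : R) < b%:R by rewrite ltr1n; lia.
have -> : (b.-1%:R : R) = b%:R - 1 by rewrite -subn1 natrB//; lia.
set x := b%:R in b1 *; rewrite -subr_ge0.
have -> : - x^-1 - (- (x - 1)^-1 + (x ^+ 2)^-1) = (x ^+ 2 * (x - 1))^-1.
  by field; rewrite ?gt_eqF//; lra.
by rewrite invr_ge0 mulr_ge0 ?sqr_ge0//; lra.
Qed.

Section Kappa1.
Local Notation factor R p := ((1 + (2 * p%:R)^-1) * Num.sqrt (1 - p%:R^-1) : R).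
Local Notation partial R N := (\prod_(0 <= p < N | prime p) factor R p).

Lemma kappa1_factor_sqr (R : realType) p : prime p ->
  factor R p ^+ 2 = 1 - 3 / 4 / p%:R ^+ 2 - 1 / 4 / p%:R ^+ 3.
Proof.
move=> pp; have p1 : (1 : R) < p%:R by rewrite ltr1n prime_gt1.
rewrite exprMn sqr_sqrtr; first by field; rewrite gt_eqF//; lra.
by rewrite subr_ge0 invf_le1//; lra.
Qed.

Lemma kappa1_factor_itv (R : realType) p : prime p -> 0 <= factor R p <= 1.
Proof.
move=> pp; have p1 : (1 : R) < p%:R by rewrite ltr1n prime_gt1.
have f0 : 0 <= factor R p.
  by rewrite mulr_ge0 ?sqrtr_ge0// addr_ge0// invr_ge0 mulr_ge0//; lra.
rewrite f0 -(@expr_le1 _ 2)// kappa1_factor_sqr//.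
have : 0 <= 3 / 4 / p%:R ^+ 2 :> R by rewrite divr_ge0 ?sqr_ge0//; lra.
have : 0 <= 1 / 4 / p%:R ^+ 3 :> R by rewrite divr_ge0 ?exprn_ge0//; lra.
lra.
Qed.

Lemma kappa1_partial_ge0 (R : realType) N : 0 <= partial R N.
Proof. by apply: prodr_ge0 => p /(kappa1_factor_itv R)/andP[]. Qed.

Lemma kappa1_partial_noninc (R : realType) :
  nonincreasing_seq (fun N => partial R N).
Proof.
apply/nonincreasing_seqP => N; rewrite /= big_mkcond big_nat_recr//= -big_mkcond.
case: ifP => [pN|_]; last by rewrite mulr1.
by rewrite ler_piMr ?kappa1_partial_ge0//; case/andP: (kappa1_factor_itv R pN).
Qed.

(** The left side is the product of [1 - 1/n^2] over [2 <= n <= N+1], extended from primes to all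
    integers to make it telescope. The squared factor at [p] is at least [1 - 1/p^2]. *)
Lemma kappa1_partial_sqr_ge (R : realType) N :
  N.+2%:R / (2 * N.+1%:R) <= partial R N.+2 ^+ 2.
Proof.
elim: N => [|N IH].
  by rewrite big_mkcond !big_nat_recr//= big_geq// !mulr1 expr1n; lra.
rewrite big_mkcond big_nat_recr//= -big_mkcond.
have n0 : (0 : R) <= N%:R by [].
have E1 : (N.+1%:R : R) = N%:R + 1 by rewrite -natr1.
have E2 : (N.+2%:R : R) = N%:R + 2 by rewrite -natr1 E1; ring.
have E3 : (N.+3%:R : R) = N%:R + 3 by rewrite -natr1 E2; ring.
rewrite E1 E2 in IH; rewrite E2 E3; set x := N%:R in n0 IH *.
case: ifP => [pN|_]; last first.
  rewrite mulr1; apply: le_trans IH; rewrite -subr_ge0.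
  have -> : (x + 2) / (2 * (x + 1)) - (x + 3) / (2 * (x + 2)) =
     1 / (2 * (x + 1) * (x + 2)) by field; rewrite ?gt_eqF//; lra.
  by rewrite divr_ge0 ?mulr_ge0//; lra.
have f := kappa1_factor_sqr R pN; rewrite E2 -/x in f.
rewrite exprMn f; apply: (@le_trans _ _ ((x + 2) / (2 * (x + 1)) *
    (1 - 3 / 4 / (x + 2) ^+ 2 - 1 / 4 / (x + 2) ^+ 3))); last first.
  apply: ler_wpM2r IH; rewrite -f sqr_ge0//.
rewrite -subr_ge0.
have -> : (x + 2) / (2 * (x + 1)) * (1 - 3 / 4 / (x + 2) ^+ 2 - 1 / 4 / (x + 2) ^+ 3)
  - (x + 3) / (2 * (x + 2)) = (x + 1) / (8 * (x + 1) * (x + 2) ^+ 2).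
  by field; rewrite ?gt_eqF//; lra.
by rewrite divr_ge0 ?mulr_ge0 ?exprn_ge0//; lra.
Qed.

Lemma kappa1_partial_ge (R : realType) N : Num.sqrt 2^-1 <= partial R N.
Proof.
have h M : Num.sqrt 2^-1 <= partial R M.+2.
  rewrite -(ger0_norm (kappa1_partial_ge0 R M.+2)) -sqrtr_sqr ler_wsqrtr//.
  apply: le_trans (kappa1_partial_sqr_ge R M).
  have n0 : (0 : R) < M.+1%:R by rewrite ltr0n.
  rewrite -[M.+2%:R]natr1; set x := M.+1%:R in n0 *.
  rewrite -subr_ge0; have -> : (x + 1) / (2 * x) - 2^-1 = 1 / (2 * x).
    by field; rewrite gt_eqF.
  by rewrite divr_ge0//; lra.
by apply: le_trans (h N) _; apply: kappa1_partial_noninc; lia.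
Qed.

(** Partial products decrease, so the upper bound is read off the primes [2, 3, 5, 7], and the lower
    bound passes to the limit. *)
Lemma kappa1_limit (R : realType) : exists P : R,
  [/\ kappa1 R = P / Num.sqrt pi, Num.sqrt 2^-1 <= P & P <= 37 / 45].
Proof.
have cv : cvgn (fun N => partial R N).
  apply: nonincreasing_is_cvgn; first exact: kappa1_partial_noninc.
  by exists 0 => _ [N _ <-]; exact: kappa1_partial_ge0.
exists (limn (fun N => partial R N)); split.
- by rewrite /kappa1 mulrC.
- by apply: limr_ge => //; near=> N; exact: kappa1_partial_ge.
apply: (le_trans (nonincreasing_cvgn_ge (@kappa1_partial_noninc R) cv 8)).
rewrite -(@ler_pXn2r _ 2)// ?nnegrE ?kappa1_partial_ge0 ?divr_ge0//.
have -> : partial R 8 = factor R 2%N * factor R 3%N * factor R 5%N * factor R 7%N.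
  by rewrite big_mkcond !big_nat_recr//= big_geq// !mul1r !mulr1.
rewrite 3!exprMn !kappa1_factor_sqr//.
have -> : (1 - 3 / 4 / 2 ^+ 2 - 1 / 4 / 2 ^+ 3 : R) = 25 / 32 by field.
have -> : (1 - 3 / 4 / 3 ^+ 2 - 1 / 4 / 3 ^+ 3 : R) = 49 / 54 by field.
have -> : (1 - 3 / 4 / 5 ^+ 2 - 1 / 4 / 5 ^+ 3 : R) = 121 / 125 by field.
have -> : (1 - 3 / 4 / 7 ^+ 2 - 1 / 4 / 7 ^+ 3 : R) = 675 / 686 by field.
lra.
Unshelve. all: by end_near. Qed.
End Kappa1.

Lemma sin_le_id (R : realType) (x : R) : 0 <= x -> sin x <= x.
Proof.
move=> x0.
have [|c _] := @MVT_segment R (@sin R) (@cos R) 0 x x0 (fun y _ => is_derive_sin y).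
  by apply: continuous_subspaceT; exact: continuous_sin.
rewrite sin0 !subr0 => ->; by rewrite -[leRHS]mul1r; apply: ler_wpM2r => //; exact: cos_le1.
Qed.

(** The triple-angle formula at [t = pi/6] reads [(sin t + 1) (2 sin t - 1)^2 = 0], so
    [sin t = 1/2]; then [sin t <= t]. *)
Lemma pi_ge3 (R : realType) : 3 <= pi :> R.
Proof.
set t : R := pi / 6; have p0 := pi_gt0 R.
have t0 : 0 < t by rewrite /t; lra.
have s0 : 0 < sin t by apply: sin_gt0_pihalf; rewrite t0 /t; lra.
have h : sin (t + (t + t)) = 3 * sin t - 4 * sin t ^+ 3.
  rewrite sinD (sinD t t) (cosD t t); have := cos2Dsin2 t.
  set s := sin t; set c := cos t => e.
  have -> : s * (c * c - s * s) + c * (s * c + c * s) = 3 * s * c ^+ 2 - s ^+ 3 by ring.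
  have -> : c ^+ 2 = 1 - s ^+ 2 by lra.
  ring.
have e : t + (t + t) = pi / 2 by rewrite /t; field.
rewrite e sin_pihalf in h.
have : (sin t + 1) * (2 * sin t - 1) ^+ 2 = 0.
  have -> : (sin t + 1) * (2 * sin t - 1) ^+ 2 = 1 - (3 * sin t - 4 * sin t ^+ 3) by ring.
  by rewrite -h subrr.
move/eqP; rewrite mulf_eq0 expf_eq0 /= => /orP[/eqP|/eqP]; first lra.
by have := sin_le_id (ltW t0); rewrite /t; lra.
Qed.

(** * The constant [kappa_2] *)

Definition kappa2_weight (R : realType) (p k : nat) : R :=
  match k with 0%N => 1 | 1%N => (1 + (2 * p%:R)^-1)^-1 | _ => 0 end.

(** The summand defining [kappa_2], restricted to primes below [z]. For fixed [z] it is periodic in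
    [n], so its mean value is an elementary finite product. *)
Definition kappa2_sieve (R : realType) (z n : nat) : R :=
  \prod_(0 <= p < z | prime p) kappa2_weight R p (logn p n).

(** The factor is the mean of the local weight: [1 - 1/p + (1/p - 1/p^2) w] with [w = 2p/(2p+1)]. *)
Definition kappa2_density (R : realType) (z : nat) : R :=
  \prod_(0 <= p < z | prime p) (1 - 3 / (p%:R * (2 * p%:R + 1))).

Lemma kappa2_weight_itv (R : realType) p k : 0 <= kappa2_weight R p k <= 1.
Proof.
case: k => [|[|k]] /=; rewrite ?lexx ?ler01//.
have h : (0 : R) <= (2 * p%:R)^-1 by rewrite invr_ge0 mulr_ge0.
by rewrite invr_ge0 addr_ge0//= invf_le1 ?lerDl//; lra.
Qed.

Lemma kappa2_sieve_itv (R : realType) z n : 0 <= kappa2_sieve R z n <= 1.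
Proof.
rewrite prodr_ge0 => [|p _]; last by case/andP: (kappa2_weight_itv R p (logn p n)).
by apply: prodr_ile1 => p _; exact: kappa2_weight_itv.
Qed.

(** The local weight is [1 - (1 - w) [p | n] - w [p^2 | n]], where [1 - w = 1/(2p+1)]. *)
Lemma kappa2_sieveS (R : realType) p n : prime p -> (0 < n)%N ->
  kappa2_sieve R p.+1 n = kappa2_sieve R p n
    - (2 * p%:R + 1)^-1 * (if (p %| n)%N then kappa2_sieve R p n else 0)
    - (1 - (2 * p%:R + 1)^-1) * (if (p ^ 2 %| n)%N then kappa2_sieve R p n else 0).
Proof.
move=> pp n0; rewrite /kappa2_sieve big_mkcond big_nat_recr//= -big_mkcond pp.
set S := bigop.body _ _ _.
have p0 : (0 : R) < p%:R by rewrite ltr0n prime_gt0.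
rewrite -[X in (X %| n)%N]expn1 !pfactor_dvdn//.
case: (logn p n) => [|[|k]] /=; [ring| |].
  by field; rewrite ?gt_eqF//; lra.
by ring.
Qed.

Lemma kappa2_sieve_mul (R : realType) z d n : (0 < d)%N -> (0 < n)%N ->
  (forall p, prime p -> (p < z)%N -> ~~ (p %| d)%N) ->
  kappa2_sieve R z (d * n) = kappa2_sieve R z n.
Proof.
move=> d0 n0 h; rewrite /kappa2_sieve big_nat_cond [RHS]big_nat_cond.
apply: eq_bigr => p /andP[/andP[_ pz] pp]; rewrite lognM//.
by have := h p pp pz; rewrite -[p in (p %| _)%N]expn1 pfactor_dvdn// lt0n negbK => /eqP ->.
Qed.

Definition kappa2_count (R : realType) (z x : nat) : R :=
  \sum_(1 <= n < x.+1) kappa2_sieve R z n.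

Lemma kappa2_count_itv (R : realType) z x : 0 <= kappa2_count R z x <= x%:R.
Proof.
apply/andP; split.
  by apply: sumr_ge0 => n _; case/andP: (kappa2_sieve_itv R z n).
have -> : (x%:R : R) = \sum_(1 <= n < x.+1) 1.
  by rewrite big_const_nat subn1 iter_addr_0.
by apply: ler_sum => n _; case/andP: (kappa2_sieve_itv R z n).
Qed.

Lemma kappa2_countS (R : realType) p x : prime p ->
  kappa2_count R p.+1 x = kappa2_count R p x
    - (2 * p%:R + 1)^-1 * kappa2_count R p (x %/ p)
    - (1 - (2 * p%:R + 1)^-1) * kappa2_count R p (x %/ p ^ 2).
Proof.
move=> pp; rewrite /kappa2_count.
have hd e : (0 < e)%N -> \sum_(1 <= n < x.+1)
    (if (p ^ e %| n)%N then kappa2_sieve R p n else 0) =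
    \sum_(1 <= n < (x %/ p ^ e).+1) kappa2_sieve R p n.
  move=> e0; rewrite -big_mkcond sum_dvd_nat ?expn_gt0 ?prime_gt0//.
  rewrite big_nat_cond [RHS]big_nat_cond; apply: eq_bigr => n /andP[/andP[n0 _] _].
  rewrite kappa2_sieve_mul ?expn_gt0 ?(prime_gt0 pp)// => q pq qp.
  by rewrite Euclid_dvdX// e0 andbT dvdn_prime2// neq_ltn qp.
rewrite -(hd 2%N)// -[p in (x %/ p)%N]expn1 -(hd 1%N)// !mulr_sumr -!sumrB expn1.
rewrite big_nat_cond [RHS]big_nat_cond; apply: eq_bigr => n /andP[/andP[n0 _] _].
exact: kappa2_sieveS.
Qed.

Lemma kappa2_count_nprime (R : realType) z x : ~~ prime z ->
  kappa2_count R z.+1 x = kappa2_count R z x.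
Proof.
move=> npz; apply: eq_bigr => n _; rewrite /kappa2_sieve [LHS]big_mkcond.
by rewrite big_nat_recr//= (negbTE npz) mulr1 -big_mkcond.
Qed.

Lemma kappa2_densityS (R : realType) z : kappa2_density R z.+1 =
  kappa2_density R z *
  (if prime z then 1 - 3 / (z%:R * (2 * z%:R + 1)) else 1).
Proof. by rewrite /kappa2_density big_mkcond big_nat_recr//= -big_mkcond. Qed.

Lemma divn_approx (R : realType) x d : (0 < d)%N ->
  (x %/ d)%:R <= x%:R / d%:R :> R /\ x%:R / d%:R <= (x %/ d)%:R + 1 :> R.
Proof.
move=> d0; have dR : (0 : R) < d%:R by rewrite ltr0n.
split; first by rewrite ler_pdivlMr// -natrM ler_nat leq_divM.
by rewrite ler_pdivrMr// natr1 -natrM ler_nat ltnW// ltn_ceil.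
Qed.

Lemma kappa2_density_factor (R : realType) p : prime p ->
  0 <= 1 - (3 / (p%:R * (2 * p%:R + 1)) : R) <= 1.
Proof.
move=> pp; have p2 : (2 : R) <= p%:R by rewrite ler_nat prime_gt1.
have h : (0 : R) < p%:R * (2 * p%:R + 1) by rewrite mulr_gt0//; lra.
rewrite subr_ge0 ler_pdivrMr// mul1r gerBl divr_ge0 ?(ltW h)//.
by nra.
Qed.

Lemma kappa2_density_itv (R : realType) z : 0 <= kappa2_density R z <= 1.
Proof.
rewrite prodr_ge0 => [|p pp]; last by case/andP: (kappa2_density_factor R pp).
by apply: prodr_ile1 => p; exact: kappa2_density_factor.
Qed.

Lemma kappa2_count_asymp (R : realType) z : exists C : R, forall x,
  `|kappa2_count R z x - kappa2_density R z * x%:R| <= C.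
Proof.
elim: z => [|z [C IH]].
  exists 0 => x; rewrite /kappa2_density big_geq// mul1r /kappa2_count.
  under eq_bigr => n _ do rewrite /kappa2_sieve big_geq//.
  by rewrite big_const_nat subn1 iter_addr_0 subrr normr0.
have [pz|npz] := boolP (prime z); last first.
  by exists C => x; rewrite kappa2_densityS kappa2_count_nprime// (negbTE npz) mulr1.
have z2 : (2 : R) <= z%:R by rewrite ler_nat prime_gt1.
pose M := kappa2_density R z; have /andP[M0 M1] : 0 <= M <= 1 by exact: kappa2_density_itv.
exists (3 * C + 2) => x.
rewrite kappa2_densityS pz -/M.
rewrite kappa2_countS//.
have hq d : (0 < d)%N -> `|kappa2_count R z (x %/ d) - M * (x%:R / d%:R)| <= C + 1.
  move=> d0; have [h1 h2] := divn_approx R x d0.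
  have := IH (x %/ d)%N; rewrite -/M !ler_norml => /andP[a b].
  move: a b h1 h2; set y := x%:R / d%:R; set w := (x %/ d)%:R; set k := kappa2_count _ _ _.
  by move=> a b h1 h2; apply/andP; split; nra.
have h0 := IH x; have hz := hq z (prime_gt0 pz).
have hz2 := hq (z ^ 2)%N ltac:(by rewrite expn_gt0 prime_gt0).
rewrite -/M in h0.
set A := kappa2_count R z x in h0 *.
set B := kappa2_count R z (x %/ z) in hz *.
set D := kappa2_count R z (x %/ z ^ 2) in hz2 *.
rewrite natrX in hz2.
pose v : R := (2 * z%:R + 1)^-1.
have v0 : 0 <= v by rewrite invr_ge0; lra.
have v1 : v <= 1 by rewrite invf_le1; lra.
have -> : A - v * B - (1 - v) * D - M * (1 - 3 / (z%:R * (2 * z%:R + 1))) * x%:R =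
  (A - M * x%:R) - v * (B - M * (x%:R / z%:R)) - (1 - v) * (D - M * (x%:R / z%:R ^+ 2)).
  by rewrite /v; field; rewrite ?gt_eqF//; lra.
apply: (le_trans (ler_normB _ _)); apply: (le_trans (lerD (ler_normB _ _) (lexx _))).
rewrite !normrM (ger0_norm v0) [`|1 - v|]ger0_norm ?subr_ge0//.
have C0 : 0 <= C by apply: le_trans h0.
move: h0 hz hz2; set a := `|_|; set b := `|_|; set c := `|_| => h0 hz hz2.
have b0 : 0 <= b by exact: normr_ge0.
have c0 : 0 <= c by exact: normr_ge0.
nra.
Qed.

(** Including one more prime [z] in the sieve removes at most [3x / (z (2z+1)) <= (3/2) x / z^2];
    these losses are summable uniformly in [x]. *)
Lemma kappa2_count_sieve_step (R : realType) z x : (0 < z)%N ->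
  0 <= kappa2_count R z x - kappa2_count R z.+1 x <=
  3 / 2 * x%:R * (z%:R ^+ 2)^-1.
Proof.
move=> z0; have zR : (1 : R) <= z%:R by rewrite ler1n.
have [pz|npz] := boolP (prime z); last first.
  by rewrite kappa2_count_nprime// subrr lexx !mulr_ge0 ?invr_ge0 ?sqr_ge0//; lra.
rewrite kappa2_countS//.
have [h1 _] := divn_approx R x z0.
have [h2 _] := divn_approx R x (d := z ^ 2) ltac:(by rewrite expn_gt0 z0).
have /andP[B0 B1] := kappa2_count_itv R z (x %/ z).
have /andP[D0 D1] := kappa2_count_itv R z (x %/ z ^ 2).
set A := kappa2_count R z x.
set B := kappa2_count R z (x %/ z) in B0 B1 *.
set D := kappa2_count R z (x %/ z ^ 2) in D0 D1 *.
have hB := le_trans B1 h1; have hD := le_trans D1 h2; rewrite natrX in hD.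
pose v : R := (2 * z%:R + 1)^-1.
have v0 : 0 <= v by rewrite invr_ge0; lra.
have v1 : v <= 1 by rewrite invf_le1; lra.
have -> : A - (A - (2 * z%:R + 1)^-1 * B - (1 - (2 * z%:R + 1)^-1) * D) =
   v * B + (1 - v) * D by rewrite /v; ring.
rewrite addr_ge0 ?mulr_ge0 ?subr_ge0//=.
apply: (@le_trans _ _ (v * (x%:R / z%:R) + 1 * (x%:R / z%:R ^+ 2))).
  apply: lerD; first exact: ler_wpM2l.
  by apply: ler_pM => //; rewrite ?subr_ge0//; lra.
rewrite mul1r -subr_ge0.
have -> : 3 / 2 * x%:R * (z%:R ^+ 2)^-1 - (v * (x%:R / z%:R) + x%:R / z%:R ^+ 2) =
   x%:R / (2 * z%:R ^+ 2 * (2 * z%:R + 1)).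
  by rewrite /v; field; rewrite ?gt_eqF//; lra.
by rewrite divr_ge0// !mulr_ge0 ?sqr_ge0//; lra.
Qed.

Lemma kappa2_count_sieve (R : realType) z w x : (1 < z)%N -> (z <= w)%N ->
  0 <= kappa2_count R z x - kappa2_count R w x <= 3 / 2 * x%:R / z.-1%:R.
Proof.
move=> z1 zw.
suff : 0 <= kappa2_count R z x - kappa2_count R w x <=
    3 / 2 * x%:R * \sum_(z <= n < w) (n%:R ^+ 2)^-1.
  case/andP => -> h; apply: (le_trans h); apply: ler_wpM2l.
    by rewrite mulr_ge0//; lra.
  by apply: le_trans (sum_inv_sqr_le R z1 zw) _; rewrite gerBl.
elim: w zw => [|w IH]; first by lia.
rewrite leq_eqVlt => /orP[/eqP <-|]; first by rewrite big_geq// mulr0 subrr lexx.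
rewrite ltnS => zw; have /andP[a b] := IH zw.
have /andP[c d] := kappa2_count_sieve_step R x (z := w) ltac:(lia).
rewrite big_nat_recr//= mulrDr.
by apply/andP; split; lra.
Qed.

Lemma kappa2_density_noninc (R : realType) : nonincreasing_seq (kappa2_density R).
Proof.
apply/nonincreasing_seqP => z; rewrite /kappa2_density big_mkcond big_nat_recr//= -big_mkcond.
case: ifP => [pz|_]; last by rewrite mulr1.
have /andP[M0 _] := kappa2_density_itv R z.
by rewrite ler_piMr//; case/andP: (kappa2_density_factor R pz).
Qed.

(** Comparison with the telescoping product of [(1 - 1/n^2)^2] over all [n >= 2], which tends to
    [1/4]. It shows that the limiting density is positive. *)
Lemma kappa2_density_ge (R : realType) z : 1 / 4 <= kappa2_density R z.
Proof.
have h N : (N.+2%:R / (2 * N.+1%:R)) ^+ 2 <= kappa2_density R N.+2.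
  elim: N => [|N IH].
    by rewrite /kappa2_density big_mkcond !big_nat_recr//= big_geq// !mulr1 expr2; lra.
  rewrite /kappa2_density big_mkcond big_nat_recr//= -big_mkcond.
  have n0 : (0 : R) <= N%:R by [].
  have E1 : (N.+1%:R : R) = N%:R + 1 by rewrite -natr1.
  have E2 : (N.+2%:R : R) = N%:R + 2 by rewrite -natr1 E1; ring.
  have E3 : (N.+3%:R : R) = N%:R + 3 by rewrite -natr1 E2; ring.
  rewrite -/(kappa2_density R N.+2).
  case: ifP => [pN|_].
    have /andP[f0 _] := kappa2_density_factor R pN.
    apply: le_trans (ler_wpM2r f0 IH).
    rewrite E1 E2 E3; set x := N%:R in n0 *; rewrite -subr_ge0.
    have -> : ((x + 2) / (2 * (x + 1))) ^+ 2 * (1 - 3 / ((x + 2) * (2 * (x + 2) + 1)))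
      - ((x + 3) / (2 * (x + 2))) ^+ 2 =
      ((x + 2) ^+ 3 * (2 * x ^+ 2 + 9 * x + 7) - (x + 3) ^+ 2 * (x + 1) ^+ 2 * (2 * x + 5))
      / (4 * (x + 1) ^+ 2 * (x + 2) ^+ 2 * (2 * x + 5)).
      by field; rewrite ?gt_eqF//; lra.
    rewrite divr_ge0 ?mulr_ge0 ?sqr_ge0//; try lra.
    have -> : (x + 2) ^+ 3 * (2 * x ^+ 2 + 9 * x + 7) - (x + 3) ^+ 2 * (x + 1) ^+ 2 * (2 * x + 5)
      = (x + 1) * ((x + 2) ^+ 3 * (2 * x + 7) - (x + 3) ^+ 2 * (x + 1) * (2 * x + 5)) by ring.
    apply: mulr_ge0; first lra.
    have -> : (x + 2) ^+ 3 * (2 * x + 7) - (x + 3) ^+ 2 * (x + 1) * (2 * x + 5) =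
       x ^+ 2 + 7 * x + 11 by ring.
    nra.
  rewrite mulr1; apply: le_trans IH; rewrite E1 E2 E3; set x := N%:R in n0 *.
  rewrite ler_pXn2r ?nnegrE ?divr_ge0//; try lra.
  rewrite -subr_ge0.
  have -> : (x + 2) / (2 * (x + 1)) - (x + 3) / (2 * (x + 2)) =
     1 / (2 * (x + 1) * (x + 2)) by field; rewrite ?gt_eqF//; lra.
  by rewrite divr_ge0 ?mulr_ge0//; lra.
apply: (@le_trans _ _ (kappa2_density R z.+2)); last by apply: kappa2_density_noninc; lia.
apply: le_trans (h z).
have n0 : (0 : R) < z.+1%:R by rewrite ltr0n.
rewrite -[z.+2%:R]natr1; set x := z.+1%:R in n0 *.
rewrite -subr_ge0; have -> : ((x + 1) / (2 * x)) ^+ 2 - 1 / 4 = (2 * x + 1) / (4 * x ^+ 2).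
  by field; rewrite gt_eqF.
by rewrite divr_ge0// ?mulr_ge0 ?sqr_ge0//; lra.
Qed.

Lemma moebius_sqr_mulf (R : realType) n : (0 < n)%N ->
  (moebius n)%:~R ^+ 2 * \prod_(p <- primes n) (1 + (2 * p%:R)^-1)^-1 =
  mulf (kappa2_weight R) n.
Proof.
move=> n0; rewrite /moebius; case: ifPn => [/allP h|/allPn[p pn lp]].
  rewrite -rmorphXn /= sqrr_sign mul1r; apply: eq_big_seq => p /h /eqP ->.
  by [].
rewrite expr0n mul0r /mulf (bigD1_seq p)//= ?primes_uniq//.
move: pn lp; rewrite -logn_gt0; case: logn => [|[|k]] //= _ _.
by rewrite mul0r.
Qed.

Lemma mulf_kappa2_sieve (R : realType) z n : (0 < n)%N -> (n < z)%N ->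
  mulf (kappa2_weight R) n = kappa2_sieve R z n.
Proof.
move=> n0 nz; rewrite /mulf /kappa2_sieve -[RHS]big_filter.
rewrite [RHS](bigID (mem (primes n)))/= [X in _ = _ * X]big1 ?mulr1; last first.
  by move=> p; rewrite -logn_gt0 -leqNgt leqn0 => /eqP ->.
rewrite -[RHS]big_filter; apply: perm_big; apply: uniq_perm.
- exact: primes_uniq.
- by rewrite !filter_uniq// iota_uniq.
move=> p; rewrite !mem_filter; apply/idP/idP => [pn|/andP[]//].
rewrite pn /=; move: pn; rewrite mem_primes => /and3P[-> _ /(dvdn_leq n0) pn].
by rewrite mem_index_iota (leq_ltn_trans pn).
Qed.

Lemma real_nat_pred (R : realType) (T : R) : 0 < T ->
  exists X : nat, X%:R < T <= X.+1%:R.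
Proof.
move=> T0; have /andP[h1 h2] := truncn_itv (ltW T0).
move: (Num.truncn T) h1 h2 => t h1 h2.
have [e|ne] := eqVneq t%:R T; last first.
  by exists t; rewrite lt_neqAle ne h1 ltW.
have t0 : (0 < t)%N by rewrite -(@ltr0n R) e.
by exists t.-1; rewrite prednK// -e lexx ltr_nat andbT; lia.
Qed.

Lemma kappa2_sum_count (R : realType) (T : R) X :
  X%:R < T -> T <= X.+1%:R -> kappa2_sum T = kappa2_count R X.+1 X.
Proof.
move=> XT TX; have T0 : 0 <= T by apply: le_trans (ltW XT).
rewrite /kappa2_sum /kappa2_count.
have XtT : (X <= Num.truncn T)%N by rewrite truncn_ge_nat// ltW.
rewrite (@big_cat_nat _ _ _ X.+1 1)//= [X in _ + X]big_nat_cond [X in _ + X]big1 ?addr0.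
  rewrite big_nat_cond [RHS]big_nat_cond; apply: eq_big => [n|n /andP[/andP[n0 nX] _]].
    rewrite andbT; apply: andb_idr => /andP[_ nX]; apply: le_lt_trans XT.
    by rewrite ler_nat.
  by rewrite moebius_sqr_mulf// (mulf_kappa2_sieve R n0 nX).
move=> n /andP[/andP[n0 _] nT]; suff : (n < X.+1)%N by lia.
by rewrite -(@ltr_nat R); apply: lt_le_trans TX.
Qed.

(** Sieving by [2, 3, 5] alone gives an upper bound with density
    [(7/10) (6/7) (52/55) = 156/275]. *)
Lemma kappa2_sum_le (R : realType) : exists C : R, forall T, 0 < T ->
  kappa2_sum T <= 156 / 275 * T + C.
Proof.
have [C hC] := kappa2_count_asymp R 6.
have C0 : 0 <= C by apply: le_trans (hC 0%N).
exists (C + 5) => T T0.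
have [X /andP[XT TX]] := real_nat_pred T0; rewrite (kappa2_sum_count XT TX).
have [X5|X5] := leqP 5 X; last first.
  have /andP[_ h] := kappa2_count_itv R X.+1 X.
  have X5R : (X%:R : R) <= 5 by rewrite ler_nat ltnW.
  by set k := kappa2_count _ _ _ in h *; lra.
have /andP[h1 _] := kappa2_count_sieve R X (z := 6) (w := X.+1) isT ltac:(lia).
have := hC X; have -> : kappa2_density R 6 = 156 / 275.
  by rewrite /kappa2_density big_mkcond !big_nat_recr//= big_geq// !mul1r !mulr1; field.
rewrite ler_norml => /andP[_]; move: h1 XT.
set k := kappa2_count _ _ _; set k' := kappa2_count _ _ _; set x := X%:R.
by move=> *; lra.
Qed.

(** Fix [z] so large that the sieve tail and the distance of its density from the limit [M] are both
    at most [e/2]; the sieve by primes below [z] then has a bounded error. *)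
Lemma kappa2_sum_asymp (R : realType) : exists2 M : R, 0 < M &
  forall e, 0 < e -> exists C, forall T, 0 < T ->
    `|kappa2_sum T - M * T| <= e * T + C.
Proof.
have cv : cvgn (kappa2_density R).
  apply: nonincreasing_is_cvgn; first exact: kappa2_density_noninc.
  by exists 0 => _ [N _ <-]; case/andP: (kappa2_density_itv R N).
pose M := limn (kappa2_density R).
have M14 : 1 / 4 <= M.
  by apply: limr_ge => //; near=> N; exact: kappa2_density_ge.
have Mle z : M <= kappa2_density R z.
  exact: nonincreasing_cvgn_ge (@kappa2_density_noninc R) cv z.
exists M; first lra.
move=> e e0.
have [z [z2 hz hM]] : exists z, [/\ (1 < z)%N, 3 / 2 / z.-1%:R <= e / 2 &
    kappa2_density R z <= M + e / 2].
  have [z1 _ hz1] : \forall z \near \oo, 3 / 2 / z.+1%:R <= e / 2 :> R.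
    exists (Num.truncn (3 / e)) => // n /= hn.
    rewrite ler_pdivrMr ?ltr0n//; have := truncnS_gt (3 / e).
    rewrite ltr_pdivrMr// => h.
    have : (Num.truncn (3 / e)).+1%:R <= n.+1%:R :> R by rewrite ler_nat.
    move: h; set a := _%:R; set b := _%:R; nra.
  have [z2 _ hz2] : \forall z \near \oo, `|M - kappa2_density R z| < e / 2.
    by move/cvgrPdist_lt : cv => /(_ (e / 2)); apply; lra.
  exists (maxn z1 z2).+2; split => //=.
    by apply: hz1; rewrite /= leq_maxl.
  have := hz2 (maxn z1 z2).+2; rewrite /= => /(_ _).
  rewrite ltr_norml => h; have /andP[+ _] := h ltac:(rewrite !leqW// leq_maxr//).
  by lra.
have [C hC] := kappa2_count_asymp R z.
have C0 : 0 <= C by apply: le_trans (hC 0%N).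
exists (C + z%:R + M) => T T0.
have [X /andP[XT TX]] := real_nat_pred T0; rewrite (kappa2_sum_count XT TX).
rewrite -natr1 in TX.
have x0 : (0 : R) <= X%:R by [].
have [Xz|Xz] := leqP z X.+1; last first.
  have /andP[k0 k1] := kappa2_count_itv R X.+1 X.
  have zR : (X%:R : R) + 1 <= z%:R by rewrite natr1 ler_nat ltnW.
  have M1 : M <= 1 by apply: le_trans (Mle 0%N) _; case/andP: (kappa2_density_itv R 0).
  rewrite ler_norml; move: k0 k1 x0 XT TX zR.
  set k := kappa2_count _ _ _; set x := X%:R; set w := z%:R => *.
  by apply/andP; split; nra.
have /andP[h1 h2] := kappa2_count_sieve R X z2 Xz.
have h3 := hC X; rewrite ler_norml in h3; move/andP: h3 => [h3 h4].
have h5 := Mle z.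
have h6 : 3 / 2 * X%:R / z.-1%:R <= e / 2 * X%:R.
  by rewrite mulrAC ler_wpM2r.
move: h1 h2 h3 h4 h5 h6 hM XT TX x0.
set k := kappa2_count _ _ _; set k' := kappa2_count _ _ _; set D := kappa2_density _ _.
set x := X%:R; set y := _ / _.-1%:R => h1 h2 h3 h4 h5 h6 hM XT TX x0.
have z0 : (0 : R) <= z%:R by [].
rewrite ler_norml; apply/andP; split; nra.
Unshelve. all: by end_near. Qed.

Lemma kappa2_prop (R : realType) : 0 < kappa2 R /\
  kappa2_sum ~_ (+oo%R) (fun T : R => kappa2 R * T).
Proof.
suff : exists k : R, 0 < k /\ kappa2_sum ~_ (+oo%R) (fun T : R => k * T).
  by move=> /getPex.
have [M M0 hM] := kappa2_sum_asymp R; exists M; split=> //.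
(* Half of the tolerance goes to the linear error, the other half absorbs the constant [C] for large
   [T]. *)
apply/eqaddoP => e e0; have [C hC] := hM (e * M / 2) ltac:(by rewrite divr_gt0 ?mulr_gt0).
have eM : 0 < e * M by rewrite mulr_gt0.
near=> T; have T0 : 0 < T by near: T; exact: nbhs_pinfty_gt.
apply: (le_trans (hC T T0)).
rewrite ger0_norm; last by rewrite mulr_ge0 ?ltW.
have : 2 * C / (e * M) <= T by near: T; apply: nbhs_pinfty_ge; rewrite num_real.
rewrite ler_pdivrMr// [e * (M * T)]mulrA; move: (e * M) eM => a a0; nra.
Unshelve. all: by end_near. Qed.

(** The value chosen by [get] is known only through its asymptotic property, so the bound is
    obtained by contradiction from the growth of the sum: a relative error of [d / (2 k)] consumes
    only half of a supposed excess [d]. *)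
Lemma kappa2_le (R : realType) : kappa2 R <= 156 / 275.
Proof.
have [k0 /eqaddoP h] := kappa2_prop R.
have [C hC] := kappa2_sum_le R.
rewrite leNgt; apply/negP => lt; set k := kappa2 R in k0 h lt.
pose d := k - 156 / 275; have d0 : 0 < d by rewrite /d; lra.
have e0 : 0 < d / (2 * k) by rewrite divr_gt0// mulr_gt0.
have := h _ e0 => /= hn.
suff : \forall T \near pinfty_nbhs R, False.
  by move=> /filter_ex [].
near=> T; have T0 : 0 < T by near: T; exact: nbhs_pinfty_gt.
have h1 : `|kappa2_sum T - k * T| <= d / (2 * k) * `|k * T|.
  by near: T; exact: hn.
have h2 := hC T T0.
rewrite (ger0_norm (mulr_ge0 (ltW k0) (ltW T0))) in h1.
have e1 : d / (2 * k) * (k * T) = d * T / 2 by field; rewrite gt_eqF.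
rewrite e1 ler_norml in h1; move/andP: h1 => [h1 _].
have : 2 * C / d < T by near: T; apply: nbhs_pinfty_gt; rewrite num_real.
rewrite ltr_pdivrMr// => h3.
have : k = d + 156 / 275 by rewrite /d; lra.
move: (kappa2_sum T) h1 h2 h3 => y h1 h2 h3 kE; rewrite kE in h1.
lra.
Unshelve. all: by end_near. Qed.

(** * Sums of the two densities *)

Definition weighted_theta (R : realType) (s : nat -> nat) (y : nat) : R :=
  \sum_(0 <= p < y.+1 | prime p) (s p)%:R / p%:R * ln p%:R.

Lemma ln_sqfree (R : realType) c : sqfree c ->
  ln (c%:R : R) = \sum_(p <- primes c) ln p%:R.
Proof.
elim/sqfree_ind: c / => [|p c pp pc sc IH]; first by rewrite big_nil ln1.
have c0 := sqfree_gt0 sc; have p0 := prime_gt0 pp.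
rewrite (perm_big _ (perm_primes_prime_mul pp c0 pc)) big_cons -IH natrM.
by rewrite lnM ?posrE ?ltr0n.
Qed.

Lemma sum_primes_nat (R : realType) (F : nat -> R) c x : (0 < c)%N -> (c <= x)%N ->
  \sum_(p <- primes c) F p =
  \sum_(0 <= p < x.+1 | prime p && (p %| c)%N) F p.
Proof.
move=> c0 cx; rewrite -[RHS]big_filter; apply: perm_big; apply: uniq_perm.
- exact: primes_uniq.
- by rewrite filter_uniq// iota_uniq.
move=> p; rewrite mem_filter mem_index_iota mem_primes c0 /= ltnS -andbA.
by case: (prime p) => //=; case: (boolP (p %| c)%N) => //= /(dvdn_leq c0) /leq_trans ->.
Qed.

Lemma mulf_prime_mul (R : realType) s p m : prime p -> (0 < m)%N ->
  mulf (sqfree_weight R s) (p * m) =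
  if (p %| m)%N then 0 else (s p)%:R / p%:R * mulf (sqfree_weight R s) m.
Proof.
move=> pp m0; case: ifPn => pm; last by rewrite -[p in LHS]expn1 mulf_pfactor_mul.
apply: mulf_nsqfree; first by rewrite muln_gt0 prime_gt0.
have pm0 : (0 < p * m)%N by rewrite muln_gt0 prime_gt0.
apply/negP => /sqfree_logn -/(_ p); apply/eqP; rewrite neq_ltn; apply/orP; right.
apply: (@leq_ltn_trans 1); first exact: leq_b1.
rewrite lognM ?(prime_gt0 pp)// logn_prime// eqxx add1n ltnS logn_gt0.
by rewrite mem_primes pp m0 pm.
Qed.

(* The identity [log = 1 * Lambda], restricted to squarefree integers. *)
Lemma sum_mulf_ln (R : realType) s x :
  \sum_(1 <= c < x.+1) mulf (sqfree_weight R s) c * ln c%:R =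
  \sum_(1 <= m < x.+1) mulf (sqfree_weight R s) m *
    \sum_(0 <= p < (x %/ m).+1 | prime p && ~~ (p %| m)%N)
      (s p)%:R / p%:R * ln p%:R.
Proof.
set g := mulf (sqfree_weight R s).
have -> : \sum_(1 <= c < x.+1) g c * ln c%:R =
    \sum_(1 <= c < x.+1) \sum_(0 <= p < x.+1 | prime p && (p %| c)%N) g c * ln p%:R.
  rewrite big_nat_cond [RHS]big_nat_cond; apply: eq_bigr => c /andP[/andP[c0 cx] _].
  have [sc|nsc] := boolP (sqfree c).
    by rewrite ln_sqfree// mulr_sumr (sum_primes_nat _ c0 (cx : (c <= x)%N)).
  by rewrite /g mulf_nsqfree// mul0r big1// => p _; rewrite mul0r.
rewrite (exchange_big_dep prime)/=; last by move=> c p _ /andP[].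
have -> : \sum_(0 <= p < x.+1 | prime p)
     \sum_(1 <= c < x.+1 | prime p && (p %| c)%N) g c * ln p%:R =
   \sum_(0 <= p < x.+1 | prime p) \sum_(1 <= m < x.+1 | (p * m <= x)%N && ~~ (p %| m)%N)
     (s p)%:R / p%:R * g m * ln p%:R.
  apply: eq_bigr => p pp; rewrite pp /= sum_dvd_nat ?prime_gt0//.
  have xp : ((x %/ p).+1 <= x.+1)%N by rewrite ltnS leq_div.
  rewrite (big_nat_widen _ _ _ _ _ xp) /= [LHS]big_mkcond [RHS]big_mkcond.
  rewrite big_nat_cond [RHS]big_nat_cond; apply: eq_bigr => m /andP[/andP[m0 mx] _].
  rewrite ltnS leq_divRL ?prime_gt0// [(m * p)%N]mulnC; case: leqP => //= _.
  by rewrite /g mulf_prime_mul//; case: ifP => //= _; rewrite mul0r.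
rewrite (exchange_big_dep predT)//= big_nat_cond [RHS]big_nat_cond.
apply: eq_bigr => m /andP[/andP[m0 mx] _].
have xm : ((x %/ m).+1 <= x.+1)%N by rewrite ltnS leq_div.
rewrite (big_nat_widen _ _ _ _ _ xm) mulr_sumr; apply: eq_big => [p|p _]; last by ring.
by rewrite ltnS leq_divRL// -andbA [(_ <= _)%N && _]andbC.
Qed.

Lemma mulf_sqfree_itv (R : realType) s n : (forall p, prime p -> (s p <= p)%N) ->
  0 <= mulf (sqfree_weight R s) n <= 1.
Proof.
move=> hs; rewrite mulf_le1// andbT; apply: mulf_ge0 => *.
exact: sqfree_weight_ge0.
Qed.

Lemma sum_mulf_le (R : realType) s x : (forall p, prime p -> (s p <= p)%N) ->
  0 <= \sum_(1 <= n < x.+1) mulf (sqfree_weight R s) n <= x%:R.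
Proof.
move=> hs; apply/andP; split.
  by apply: sumr_ge0 => n _; case/andP: (mulf_sqfree_itv R n hs).
have -> : (x%:R : R) = \sum_(1 <= n < x.+1) 1.
  by rewrite big_const_nat subn1 iter_addr_0.
by apply: ler_sum => n _; case/andP: (mulf_sqfree_itv R n hs).
Qed.

Lemma sum_ln_sqr_le (R : realType) x :
  \sum_(1 <= n < x.+1) ln (n%:R : R) / n%:R ^+ 2 <= 2.
Proof.
case: x => [|x]; first by rewrite big_geq.
(* The function [-(ln t + 1) / t] is a primitive of [ln t / t^2]; the additional [-1/t] pays for
   passing from the integral to the sum, and the constant [2] makes [n = 1] an equality. *)
suff h : \sum_(1 <= n < x.+2) ln (n%:R : R) / n%:R ^+ 2 <=
    2 - (ln x.+1%:R + 2) / x.+1%:R.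
  apply: (le_trans h); rewrite gerBl divr_ge0// addr_ge0// ln_ge0// ler1n//.
elim: x => [|x IH]; first by rewrite big_nat1 ln1 mul0r add0r divr1 subrr.
rewrite big_nat_recr//=; apply: le_trans (lerD IH (lexx _)) _.
have x0 : (1 : R) <= x.+1%:R by rewrite ler1n.
have l0 : 0 <= ln (x.+1%:R : R) by rewrite ln_ge0.
rewrite -[x.+2%:R]natr1; set y := x.+1%:R in x0 l0 *.
have h : ln (y + 1) <= ln y + y^-1.
  have -> : y + 1 = y * (1 + y^-1) by field; rewrite gt_eqF//; lra.
  have i0 : 0 < y^-1 by rewrite invr_gt0; lra.
  have j0 : 0 < 1 + y^-1 by rewrite addr_gt0.
  have y0 : 0 < y by lra.
  by rewrite lnM ?posrE// lerD2l le_ln1Dx// (lt_trans _ i0)// ltrN10.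
move: (ln y) (ln (y + 1)) l0 h => l l' l0 h.
rewrite -subr_ge0.
have -> : 2 - (l' + 2) / (y + 1) - (2 - (l + 2) / y + l' / (y + 1) ^+ 2) =
  ((l + 2) * (y + 1) ^+ 2 - l' * y * (y + 2) - 2 * y * (y + 1)) / (y * (y + 1) ^+ 2).
  by field; rewrite ?gt_eqF//; lra.
apply: divr_ge0; last by rewrite mulr_ge0 ?sqr_ge0//; lra.
have h2 : l' * y * (y + 2) <= (l + y^-1) * y * (y + 2).
  by rewrite -!mulrA ler_wpM2r// mulr_ge0//; lra.
have e : (l + y^-1) * y * (y + 2) = l * y * (y + 2) + y + 2.
  by field; rewrite gt_eqF//; lra.
rewrite e in h2; clear e h; nra.
Qed.

(** For [p >= 11] the density is at most [6/11], and [(6/11) ln 4 <= (6/11) (14/10) = 84/110].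
    Smaller primes go into the constant. *)
Lemma weighted_theta_upper (R : realType) : exists2 K : R, 0 <= K &
  forall y, weighted_theta R upper_classes y <= 84 / 110 * y%:R + K.
Proof.
exists (theta R 10); first exact: theta_ge0.
move=> y; apply: (@le_trans _ _ (6 / 11 * theta R y + theta R 10)); last first.
  rewrite lerD2r; have := theta_le R y; have /andP[_] := ln2_bounds R.
  have -> : ln (4 : R) = 2 * ln 2.
    by rewrite (_ : 4 = 2 ^+ 2 :> R) ?lnXn ?mulr_natl//; lra.
  have : (0 : R) <= y%:R by []. 
  by move: (theta R y) (ln 2) y%:R => a b c *; nra.
have [y10|y10] := leqP y 10.
  apply: (@le_trans _ _ (theta R y)).
    apply: ler_sum => p pp; rewrite ler_piMl ?ln_ge0 ?ler1n ?prime_gt0//.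
    by rewrite ler_pdivrMr ?ltr0n ?prime_gt0// mul1r ler_nat upper_classes_le.
  have := le_theta R y10; have := theta_ge0 R y.
  by move: (theta R y) (theta R 10) => a b *; lra.
have h11 : (11 <= y.+1)%N by lia.
rewrite /weighted_theta (@big_cat_nat _ _ _ 11 0 y.+1)//= addrC; apply: lerD.
  apply: (@le_trans _ _ (6 / 11 * \sum_(11 <= p < y.+1 | prime p) ln p%:R)).
    rewrite mulr_sumr big_nat_cond [leRHS]big_nat_cond.
    apply: ler_sum => p /andP[/andP[p11 _] pp]; apply: ler_wpM2r.
      by rewrite ln_ge0// ler1n prime_gt0.
    have op : odd p by case: (even_prime pp) => // e; rewrite e in p11.
    have [_ _ _ ->] := odd_prime_inv R pp op.
    have : (p%:R^-1 : R) <= 11^-1 by rewrite lef_pV2 ?posrE ?ltr0n ?prime_gt0// ler_nat.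
    by move: p%:R^-1 => u; lra.
  apply: ler_wpM2l; first lra.
  rewrite /theta (@big_cat_nat _ _ _ 11 0 y.+1)//= lerDr; exact: theta_ge0.
apply: ler_sum => p pp; rewrite ler_piMl ?ln_ge0 ?ler1n ?prime_gt0//.
by rewrite ler_pdivrMr ?ltr0n ?prime_gt0// mul1r ler_nat upper_classes_le.
Qed.

Lemma lower_classes_le p : prime p -> (lower_classes p <= p)%N.
Proof. by rewrite /lower_classes; lia. Qed.

Lemma weighted_theta_ge0 (R : realType) s y : 0 <= weighted_theta R s y.
Proof.
apply: sumr_ge0 => p pp; rewrite mulr_ge0 ?divr_ge0//.
by rewrite ln_ge0// ler1n prime_gt0.
Qed.

(** For [p >= 43] the density is at least [21/43], and [(21/43) (69/100 - 1/200)] just exceeds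
    [1/3]; with the exact limit values it would be about [0.347]. *)
Lemma weighted_theta_lower (R : realType) : exists2 K : R, 0 <= K &
  forall y, 1 / 3 * y%:R - K <= weighted_theta R lower_classes y.
Proof.
have [K K0 hK] := @theta_ge R (1 / 200) ltac:(lra).
have t0 := theta_ge0 R 42.
exists (K + theta R 42); first by rewrite addr_ge0.
move=> y; apply: (@le_trans _ _ (21 / 43 * (theta R y - theta R 42))).
  have := hK y; have /andP[] := ln2_bounds R; have : (0 : R) <= y%:R by [].
  move: (theta R y) (theta R 42) t0 (ln 2) y%:R => a b t0 c d *; nra.
have [y42|y42] := leqP y 42.
  apply: le_trans (weighted_theta_ge0 _ _ _).
  have := le_theta R y42.
  by move: (theta R y) (theta R 42) => a b *; lra.
have h43 : (43 <= y.+1)%N by lia.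
rewrite /weighted_theta (@big_cat_nat _ _ _ 43 0 y.+1)//=.
rewrite {1}/theta (@big_cat_nat _ _ _ 43 0 y.+1)//= -/(theta R 42) addrAC subrr add0r.
apply: ler_wpDl.
  apply: sumr_ge0 => p pp; rewrite mulr_ge0 ?divr_ge0//.
  by rewrite ln_ge0// ler1n prime_gt0.
rewrite mulr_sumr [leLHS]big_nat_cond [leRHS]big_nat_cond.
apply: ler_sum => p /andP[/andP[p43 _] pp]; apply: ler_wpM2r.
  by rewrite ln_ge0// ler1n prime_gt0.
have op : odd p by case: (even_prime pp) => // e; rewrite e in p43.
have [_ _ -> _] := odd_prime_inv R pp op.
have : (p%:R^-1 : R) <= 43^-1 by rewrite lef_pV2 ?posrE ?ltr0n ?prime_gt0// ler_nat.
by move: p%:R^-1 => u; lra.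
Qed.

Definition mulf_sum (R : realType) (s : nat -> nat) (x : nat) : R :=
  \sum_(1 <= n < x.+1) mulf (sqfree_weight R s) n.

Definition mulf_logsum (R : realType) (s : nat -> nat) (x : nat) : R :=
  \sum_(1 <= n < x.+1) mulf (sqfree_weight R s) n / n%:R.

Lemma mulf_logsum_ge0 (R : realType) s x : 0 <= mulf_logsum R s x.
Proof.
apply: sumr_ge0 => n _; rewrite divr_ge0//; apply: mulf_ge0 => *.
exact: sqfree_weight_ge0.
Qed.

Lemma le_mulf_logsum (R : realType) s x y : (x <= y)%N ->
  mulf_logsum R s x <= mulf_logsum R s y.
Proof.
move=> xy; rewrite /mulf_logsum (@big_cat_nat _ _ _ x.+1 1 y.+1)//= lerDl.
apply: sumr_ge0 => n _; rewrite divr_ge0//; apply: mulf_ge0 => *.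
exact: sqfree_weight_ge0.
Qed.

Lemma sum_mulf_ln_upper (R : realType) : exists2 K : R, 0 <= K & forall x,
  \sum_(1 <= c < x.+1) mulf (sqfree_weight R upper_classes) c * ln c%:R <=
  84 / 110 * x%:R * mulf_logsum R upper_classes x + K * x%:R.
Proof.
have [K K0 hK] := weighted_theta_upper R; exists K => // x.
rewrite sum_mulf_ln; set g := mulf _.
have g01 n : 0 <= g n <= 1 by apply: mulf_sqfree_itv; exact: upper_classes_le.
apply: (@le_trans _ _ (\sum_(1 <= m < x.+1)
    (84 / 110 * x%:R * (g m / m%:R) + K * g m))); last first.
  rewrite big_split /= -!mulr_sumr lerD2l ler_wpM2l//.
  by case/andP: (sum_mulf_le R x upper_classes_le).
rewrite big_nat_cond [leRHS]big_nat_cond; apply: ler_sum => m /andP[/andP[m0 mx] _].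
have /andP[g0 _] := g01 m.
have -> : 84 / 110 * x%:R * (g m / m%:R) + K * g m =
    g m * (84 / 110 * (x%:R / m%:R) + K) by ring.
apply: ler_wpM2l => //; apply: (@le_trans _ _ (weighted_theta R upper_classes (x %/ m))).
  rewrite /weighted_theta [leLHS]big_mkcond [leRHS]big_mkcond; apply: ler_sum => p _.
  case: ifP => [/andP[-> _]//|_]; case: ifP => // pp.
  by rewrite mulr_ge0 ?divr_ge0// ln_ge0// ler1n prime_gt0.
apply: le_trans (hK _) _; rewrite lerD2r; apply: ler_wpM2l; first by rewrite divr_ge0.
by have [] := divn_approx R x m0.
Qed.

(** In the identity for [log], the primes dividing [m] are missing. They cost at most the sum of
    [x ln p / p^2], hence [2 x]; rounding [x / m] down adds [1/3], and together [7/3]. *)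
Lemma mulf_sum_lower (R : realType) : exists2 K : R, 0 <= K & forall x,
  1 / 3 * x%:R * mulf_logsum R lower_classes x - K * x%:R <=
  mulf_sum R lower_classes x * ln x%:R.
Proof.
have [K K0 hK] := weighted_theta_lower R; exists (K + 7 / 3); first by rewrite addr_ge0.
move=> x; set s := lower_classes.
have g01 n : 0 <= mulf (sqfree_weight R s) n <= 1.
  by apply: mulf_sqfree_itv; exact: lower_classes_le.
apply: (@le_trans _ _ (\sum_(1 <= c < x.+1) mulf (sqfree_weight R s) c * ln c%:R));
  last first.
  rewrite mulr_suml big_nat_cond [leRHS]big_nat_cond.
  apply: ler_sum => c /andP[/andP[c0 cx] _]; apply: ler_wpM2l.
    by case/andP: (g01 c).
  by rewrite ler_ln ?posrE ?ltr0n ?ler_nat//; lia.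
rewrite sum_mulf_ln; set g := mulf _ in g01 *.
pose S m : R := \sum_(0 <= p < (x %/ m).+1 | prime p && (p %| m)%N) ln p%:R.
apply: (@le_trans _ _ (\sum_(1 <= m < x.+1)
    (1 / 3 * x%:R * (g m / m%:R) - (K + 1 / 3) * g m - S m))).
  rewrite !sumrB -!mulr_sumr -/(mulf_logsum R s x) -addrA lerD2l -opprD lerN2.
  have -> : (K + 7 / 3) * x%:R = (K + 1 / 3) * x%:R + 2 * x%:R by field.
  apply: lerD.
    apply: ler_wpM2l; first by rewrite addr_ge0.
    by case/andP: (sum_mulf_le R x lower_classes_le).
  have -> : \sum_(1 <= m < x.+1) S m = \sum_(0 <= p < x.+1 | prime p)
      \sum_(1 <= m < x.+1 | (p * m <= x)%N && (p %| m)%N) ln p%:R.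
    rewrite [RHS](exchange_big_dep predT)//= big_nat_cond [RHS]big_nat_cond.
    apply: eq_bigr => m /andP[/andP[m0 mx] _]; rewrite /S.
    have xm : ((x %/ m).+1 <= x.+1)%N by rewrite ltnS leq_div.
    rewrite (big_nat_widen _ _ _ _ _ xm); apply: eq_bigl => p.
    by rewrite ltnS leq_divRL// -andbA [(_ %| _)%N && _]andbC.
  apply: (@le_trans _ _ (\sum_(0 <= p < x.+1 | prime p) x%:R * (ln p%:R / p%:R ^+ 2))).
    apply: ler_sum => p pp; have p0 := prime_gt0 pp.
    have lp : 0 <= ln (p%:R : R) by rewrite ln_ge0// ler1n.
    apply: (@le_trans _ _ (\sum_(1 <= m < x.+1 | (p %| m)%N) if (p * m <= x)%N then ln p%:R else 0)).
      by rewrite [leLHS]big_mkcond [leRHS]big_mkcond; apply: ler_sum => m _; case: (p * m <= x)%N; case: (p %| m)%N.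
    rewrite sum_dvd_nat//.
    (* Writing the multiples of [p] as [p m'], the condition [p^2 m' <= x] leaves [x / p^2] of
       them. *)
    have xp : ((x %/ p ^ 2).+1 <= (x %/ p).+1)%N.
      by rewrite ltnS leq_div2l// -{1}[p]expn1 leq_pexp2l.
    rewrite (@big_cat_nat _ _ _ (x %/ p ^ 2).+1)//= [X in _ + X]big_nat_cond [X in _ + X]big1 ?addr0.
      apply: (@le_trans _ _ (\sum_(1 <= m < (x %/ p ^ 2).+1) ln p%:R)).
        by apply: ler_sum => m _; case: ifP.
      rewrite big_const_nat subn1 iter_addr_0 -[leLHS]mulr_natl /= mulrCA mulrC.
      apply: ler_wpM2l => //.
      have [h _] := divn_approx R x (d := p ^ 2) ltac:(by rewrite expn_gt0 p0).
      by rewrite natrX in h.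
    move=> m /andP[/andP[hm _] _]; rewrite ifF//; apply/negbTE; rewrite -ltnNge.
    by rewrite mulnA mulnn mulnC -ltn_divLR// expn_gt0 p0.
  rewrite -mulr_sumr mulrC; apply: ler_wpM2r => //.
  apply: le_trans (sum_ln_sqr_le R x).
  rewrite big_mkcond big_ltn//= add0r.
  rewrite [leLHS]big_nat_cond [leRHS]big_nat_cond.
  apply: ler_sum => p /andP[/andP[p0 _] _]; case: ifP => // _.
  by rewrite divr_ge0 ?sqr_ge0// ln_ge0// ler1n.
rewrite big_nat_cond [leRHS]big_nat_cond; apply: ler_sum => m /andP[/andP[m0 mx] _].
have /andP[g0 g1] := g01 m.
have S0 : 0 <= S m.
  by apply: sumr_ge0 => p /andP[pp _]; rewrite ln_ge0// ler1n prime_gt0.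
set W := \sum_(_ <= _ < _ | _) _.
have hW : weighted_theta R s (x %/ m) <= W + S m.
  rewrite /weighted_theta (bigID (fun p => (p %| m)%N))/= addrC lerD2l.
  apply: ler_sum => p /andP[pp _]; rewrite ler_piMl//.
    by rewrite ln_ge0// ler1n prime_gt0.
  by rewrite ler_pdivrMr ?ltr0n ?prime_gt0// mul1r ler_nat lower_classes_le.
have h := hK (x %/ m)%N; have [_ h2] := divn_approx R x m0.
have h3 : 1 / 3 * (x%:R / m%:R) - (K + 1 / 3) <= W + S m.
  by apply: le_trans hW; apply: le_trans h; lra.
have h4 : 1 / 3 * x%:R * (g m / m%:R) - (K + 1 / 3) * g m <= g m * (W + S m).
  have -> : 1 / 3 * x%:R * (g m / m%:R) - (K + 1 / 3) * g m =
    g m * (1 / 3 * (x%:R / m%:R) - (K + 1 / 3)) by ring.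
  exact: ler_wpM2l.
have h5 : g m * S m <= S m by rewrite ler_piMl.
by rewrite lerBlDr; apply: le_trans h4 _; rewrite mulrDr lerD2l.
Qed.

(** * The upper bound *)

Definition upper_sum (R : realType) (X : nat) : R :=
  \sum_(1 <= m < X.+1) mulf_sum R upper_classes (X %/ m ^ 2).

(** Completing the last period adds [c <= X] to the length [2X + 1]. *)
Lemma count_sqmod_le_mulf (R : realType) X c : sqfree c -> (c <= X)%N ->
  (count_classes sqmod X c)%:R <=
  (3 * X%:R + 1) * mulf (sqfree_weight R upper_classes) c.
Proof.
move=> sc cX; have c0 : (0 : R) < c%:R by rewrite ltr0n sqfree_gt0.
have := count_sqmod_bound X sc; rewrite -(@ler_nat R) !natrM -(mulf_sqfree R upper_classes sc).
rewrite mulrCA ler_pM2l// => h; apply: (le_trans h); apply: ler_wpM2r.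
  by apply: mulf_ge0 => *; exact: sqfree_weight_ge0.
have cXR : (c%:R : R) <= X%:R by rewrite ler_nat.
by rewrite natrD -natr1 natrM; lra.
Qed.

Lemma Nloc_upper (R : realType) n X (T : R) : (0 < n)%N -> T <= X.+1%:R ->
  (Nloc n T)%:R <= 2 * (3 * X%:R + 1) * upper_sum R X.
Proof.
move=> n0 TX; have := Nloc_le n0 TX; rewrite -(@ler_nat R) natrM => h.
apply: (le_trans h); rewrite -mulrA; apply: ler_wpM2l => //.
rewrite natr_sum /upper_sum mulr_sumr.
rewrite (big_geq_mkord 1 X.+1 predT (fun m => (3 * X%:R + 1) * mulf_sum R upper_classes (X %/ m ^ 2))).
rewrite [leRHS]big_mkcond; apply: ler_sum => m _ /=.
case: ifPn => [m0|]; last first.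
  by rewrite -leqNgt leqn0 => /eqP ->; rewrite big1.
have m2 : (0 < m ^ 2)%N by rewrite expn_gt0 m0.
have Xm : ((X %/ m ^ 2).+1 <= X.+1)%N by rewrite ltnS leq_div.
rewrite natr_sum /mulf_sum (big_nat_widen _ _ _ _ _ Xm) mulr_sumr big_geq_mkord.
rewrite [leLHS]big_mkcond [leRHS]big_mkcond; apply: ler_sum => c _.
have g0 : 0 <= mulf (sqfree_weight R upper_classes) c.
  by apply: mulf_ge0 => *; exact: sqfree_weight_ge0.
case: ifP => [/and3P[_ sc mc]|_]; last first.
  by case: ifP => // _; rewrite mulr_ge0// addr_ge0// mulr_ge0.
rewrite ltnS leq_divRL// mulnC mc (sqfree_gt0 sc) /=.
apply: count_sqmod_le_mulf => //; apply: leq_trans mc.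
by rewrite leq_pmull.
Qed.

Lemma sum_inv_sqr_le74 (R : realType) X :
  \sum_(1 <= m < X.+1) (m%:R ^+ 2)^-1 <= 7 / 4 :> R.
Proof.
have mono a b : (a <= b)%N -> \sum_(1 <= m < a.+1) (m%:R ^+ 2)^-1 <=
    \sum_(1 <= m < b.+1) (m%:R ^+ 2)^-1 :> R.
  move=> ab; rewrite [leRHS](@big_cat_nat _ _ _ a.+1)//= lerDl.
  by apply: sumr_ge0 => m _; rewrite invr_ge0 sqr_ge0.
apply: (le_trans (mono X X.+2 _)); first by rewrite -addn2 leq_addr.
rewrite (@big_cat_nat _ _ _ 3)//=.
have -> : \sum_(1 <= m < 3) (m%:R ^+ 2)^-1 = 5 / 4 :> R.
  by rewrite big_ltn// big_ltn// big_geq//; field.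
have h := @sum_inv_sqr_le R 3 X.+3 isT isT.
have : (0 : R) <= X.+2%:R^-1 by rewrite invr_ge0.
rewrite /= in h; move: h; set S := \sum_(_ <= _ < _) _; set a := X.+2%:R^-1 => h a0.
lra.
Qed.

(** The upper bound for the log sum carries the weight [ln c], whereas [ln X] is wanted. With
    [Y = X / m^2], [ln X = ln c + ln(Y/c) + 2 ln m]; the middle term is at most [(3/100) Y/c + K2],
    which sums to a small multiple of [Y L], and the last is harmless over [m^2]. Finally
    [(84/110 + 3/100) (7/4) <= 7/5], where [7/4] bounds the sum of [1/m^2]. *)
Lemma upper_sum_bound (R : realType) : exists2 K : R, 0 <= K &
  forall X, (0 < X)%N -> upper_sum R X * ln X%:R <=
    X%:R * (7 / 5 * mulf_logsum R upper_classes X + K).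
Proof.
have [K1 K10 h1] := sum_mulf_ln_upper R.
have [K2 K20 h2] := @ln_le_eps R (3 / 100) ltac:(lra).
exists (7 / 4 * (K1 + K2) + 4); first by rewrite addr_ge0// mulr_ge0//; lra.
move=> X X0; have X0R : (0 : R) < X%:R by rewrite ltr0n.
set L := mulf_logsum R upper_classes X.
have L0 : 0 <= L by exact: mulf_logsum_ge0.
pose g := mulf (sqfree_weight R upper_classes).
have g0 c : 0 <= g c by apply: mulf_ge0 => *; exact: sqfree_weight_ge0.
have step m : (1 <= m < X.+1)%N -> mulf_sum R upper_classes (X %/ m ^ 2) * ln X%:R <=
    X%:R * ((84 / 110 + 3 / 100) * L + K1 + K2) * (m%:R ^+ 2)^-1 +
    X%:R * 2 * (ln m%:R / m%:R ^+ 2).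
  case/andP => m0 mX; have m2 : (0 < m ^ 2)%N by rewrite expn_gt0 m0.
  have m0R : (0 : R) < m%:R by rewrite ltr0n.
  have lm0 : 0 <= ln (m%:R : R) by rewrite ln_ge0// ler1n.
  set y := (X %/ m ^ 2)%N; have [hy _] := divn_approx R X m2; rewrite -/y natrX in hy.
  have yX : (y <= X)%N by exact: leq_div.
  set Y := X%:R / m%:R ^+ 2 in hy; have Y0 : 0 <= Y by rewrite divr_ge0 ?sqr_ge0.
  have hL : mulf_logsum R upper_classes y <= L by exact: le_mulf_logsum.
  have Ly0 := mulf_logsum_ge0 R upper_classes y.
  have /andP[G0 G1] := sum_mulf_le R y upper_classes_le.
  have hG : mulf_sum R upper_classes y <= Y by apply: le_trans hy.
  have lX : ln (X%:R : R) = ln Y + 2 * ln m%:R.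
    have Y1 : 0 < Y by rewrite divr_gt0// exprn_gt0.
    rewrite mulr_natl -lnXn// -lnM ?posrE ?exprn_gt0//.
    by rewrite /Y divfK// gt_eqF// exprn_gt0.
  have E : mulf_sum R upper_classes y * ln X%:R <=
      \sum_(1 <= c < y.+1) g c * ln c%:R +
      3 / 100 * Y * mulf_logsum R upper_classes y +
      (K2 + 2 * ln m%:R) * mulf_sum R upper_classes y.
    rewrite /mulf_sum /mulf_logsum mulr_suml !mulr_sumr -!big_split /=.
    rewrite big_nat_cond [leRHS]big_nat_cond; apply: ler_sum => c /andP[/andP[c0 cy] _].
    have c0R : (0 : R) < c%:R by rewrite ltr0n.
    have q0 : 0 < Y / c%:R by rewrite !divr_gt0// exprn_gt0.
    have -> : ln (X%:R : R) = ln c%:R + ln (Y / c%:R) + 2 * ln m%:R.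
      by rewrite -(lnM (x := c%:R)) ?posrE// mulrC divfK ?gt_eqF//.
    have h3 := h2 _ q0; have gc := g0 c; rewrite -/(g c).
    have h4 : g c * ln (Y / c%:R) <= g c * (3 / 100 * (Y / c%:R) + K2) by exact: ler_wpM2l.
    have -> : 3 / 100 * Y * (g c / c%:R) = g c * (3 / 100 * (Y / c%:R)) by ring.
    rewrite !mulrDr in h4 *; lra.
  apply: (le_trans E); have h := h1 y.
  have h5 : 84 / 110 * y%:R * mulf_logsum R upper_classes y <= 84 / 110 * Y * L.
    by apply: ler_pM => //; apply: ler_wpM2l.
  have h6 : K1 * y%:R <= K1 * Y by exact: ler_wpM2l.
  have h7 : 3 / 100 * Y * mulf_logsum R upper_classes y <= 3 / 100 * Y * L.
    by apply: ler_wpM2l => //; rewrite mulr_ge0//; lra.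
  have h8 : (K2 + 2 * ln m%:R) * mulf_sum R upper_classes y <= (K2 + 2 * ln m%:R) * Y.
    by apply: ler_wpM2l => //; rewrite addr_ge0// mulr_ge0.
  have -> : X%:R * ((84 / 110 + 3 / 100) * L + K1 + K2) * (m%:R ^+ 2)^-1 +
    X%:R * 2 * (ln m%:R / m%:R ^+ 2) =
    84 / 110 * Y * L + K1 * Y + 3 / 100 * Y * L + (K2 + 2 * ln m%:R) * Y.
    by rewrite /Y; field; rewrite gt_eqF.
  by rewrite -/g in h; lra.
rewrite /upper_sum mulr_suml.
apply: (@le_trans _ _ (\sum_(1 <= m < X.+1)
  (X%:R * ((84 / 110 + 3 / 100) * L + K1 + K2) * (m%:R ^+ 2)^-1 +
    X%:R * 2 * (ln m%:R / m%:R ^+ 2)))).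
  rewrite big_nat_cond [leRHS]big_nat_cond; apply: ler_sum => m /andP[hm _].
  exact: step.
rewrite big_split /= -!mulr_sumr.
have s1 := sum_inv_sqr_le74 R X; have s2 := sum_ln_sqr_le R X.
have Q0 : 0 <= X%:R * ((84 / 110 + 3 / 100) * L + K1 + K2).
  have qL : 0 <= (84 / 110 + 3 / 100) * L by apply: mulr_ge0 => //; lra.
  by apply: mulr_ge0; [exact: ltW|lra].
have t1 := ler_wpM2l Q0 s1.
have t2 : X%:R * 2 * \sum_(1 <= m < X.+1) ln (m%:R : R) / m%:R ^+ 2 <= X%:R * 2 * 2.
  by apply: ler_wpM2l => //; rewrite mulr_ge0// ltW.
apply: (le_trans (lerD t1 t2)).
have XL : 0 <= X%:R * L by rewrite mulr_ge0// ltW.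
rewrite -subr_ge0.
have -> : X%:R * (7 / 5 * L + (7 / 4 * (K1 + K2) + 4)) -
  (X%:R * ((84 / 110 + 3 / 100) * L + K1 + K2) * (7 / 4) + X%:R * 2 * 2) =
  X%:R * L * (7 / 5 - (84 / 110 + 3 / 100) * (7 / 4)) by field.
by rewrite mulr_ge0//; lra.
Qed.

(** Replaces [T] by the largest integer [X] strictly below it, matching the strict bounds on [|B|]
    and [|C|]. As [ln T <= ln X + 1], one has [sqrt(ln T) <= u + 1], at most [(21/20) u] once
    [u >= 20]. *)
Lemma near_sqrt_ln (R : realType) (U : R) : \forall T \near +oo%R,
  exists X : nat, [/\ X%:R < T, T <= X.+1%:R, 20 <= Num.sqrt (ln (X%:R : R)),
    U <= Num.sqrt (ln (X%:R : R)) &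
    Num.sqrt (ln X%:R) <= Num.sqrt (ln T) <= 21 / 20 * Num.sqrt (ln (X%:R : R))].
Proof.
pose V := Num.max 20 U; have V20 : 20 <= V by rewrite le_max lexx.
have VU : U <= V by rewrite le_max lexx orbT.
near=> T.
have hT : expR (V ^+ 2) + 1 <= T by near: T; apply: nbhs_pinfty_ge; rewrite num_real.
have e0 := expR_gt0 (V ^+ 2).
have [X /andP[XT TX]] := @real_nat_pred R T ltac:(lra).
have eX : expR (V ^+ 2) <= X%:R by rewrite -natr1 in TX; lra.
have X0 : (0 : R) < X%:R by lra.
have lX : V ^+ 2 <= ln (X%:R : R) by rewrite -(expRK (V ^+ 2)) ler_ln ?posrE.
have uV : V <= Num.sqrt (ln (X%:R : R)).
  by rewrite -[V]ger0_norm; [rewrite -sqrtr_sqr ler_wsqrtr|lra].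
exists X; split => //; try lra.
have T0 : 0 < T by lra.
rewrite ler_wsqrtr ?ler_ln ?posrE//= ?(ltW XT)//.
set u := Num.sqrt (ln (X%:R : R)) in uV *.
have l0 : 0 <= ln (X%:R : R) by apply: le_trans lX; exact: sqr_ge0.
have X1 : (1 : R) <= X%:R by rewrite ler1n -(@ltr0n R).
have i1 : (X%:R : R)^-1 <= 1 by rewrite invf_le1.
have i0 : (0 : R) < X%:R^-1 by rewrite invr_gt0.
have h : ln T <= (u + 1) ^+ 2.
  apply: (@le_trans _ _ (ln (X%:R * (1 + X%:R^-1) : R))).
    rewrite ler_ln ?posrE ?mulr_gt0 ?addr_gt0//.
    by rewrite mulrDr mulr1 divff ?gt_eqF// natr1.
  have j0 : (0 : R) < 1 + X%:R^-1 by rewrite addr_gt0.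
  have hl : ln (1 + X%:R^-1 : R) <= X%:R^-1.
    by rewrite le_ln1Dx// (lt_trans _ i0)// ltrN10.
  rewrite lnM ?posrE//; have -> : ln (X%:R : R) = u ^+ 2 by rewrite sqr_sqrtr.
  by have := le_trans hl i1; set a := ln (1 + _) => ha; nra.
have u1 : 0 <= u + 1 by lra.
apply: (@le_trans _ _ (u + 1)); last by lra.
by rewrite -(ger0_norm u1) -sqrtr_sqr ler_wsqrtr.
Unshelve. all: by end_near. Qed.

Lemma sqrt_ln_le (R : realType) (x : R) : 1 <= x ->
  Num.sqrt (ln x) ^+ 2 = ln x /\ Num.sqrt (ln x) ^+ 2 <= x.
Proof.
move=> x1; have l0 : 0 <= ln x by rewrite ln_ge0.
rewrite sqr_sqrtr//; split=> //; apply/ltW/ln_sublinear; lra.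
Qed.

(** With [u = sqrt(ln X)] and [L <= 2u + 2], the main term [(7/5) 2u] is rounded up to [(31/10) u].
    The total is [2 * 3 * (31/10) * (21/20) = 19.53], and the rest of [20] absorbs [3X + 1] against
    [3X]. *)
Lemma Nloc_upper_growth (R : realType) n : (0 < n)%N ->
  \forall T \near +oo%R, (Nloc n T)%:R <= 20 * growth T :> R.
Proof.
move=> n0; have [K K0 hK] := upper_sum_bound R.
have := near_sqrt_ln (12 + 4 * K : R); apply: filterS => T.
case=> X [XT TX u20 uK /andP[_ vu]].
apply: (le_trans (Nloc_upper n0 TX)).
have X1 : (1 : R) <= X%:R.
  rewrite leNgt; apply/negP => /ltW h; move: u20; rewrite ler0_sqrtr ?ln_le0//; lra.
have [uE uX] := sqrt_ln_le X1.
have X0 : (0 < X)%N by rewrite -(@ltr0n R); lra.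
have h1 := hK X X0; rewrite -uE in h1.
have X2 : (2 <= X)%N.
  by rewrite -(@ler_nat R); apply: le_trans uX; nra.
have hL := upper_log_sum R X2; rewrite -/(mulf_logsum R upper_classes X) -uE in hL.
set L := mulf_logsum _ _ _ in h1 hL.
set u := Num.sqrt (ln X%:R) in u20 uK vu uE uX h1 hL.
set v := Num.sqrt (ln T) in vu.
have v0 : 0 < v.
  rewrite sqrtr_gt0 ln_gt0//; lra.
have L1 : L <= 2 * u + 2.
  rewrite -(@ler_pXn2r _ 2)// ?nnegrE ?mulf_logsum_ge0//; last by lra.
  by nra.
rewrite /growth -/v mulrA ler_pdivlMr//.
set x := X%:R in h1 uX XT X1 *; set E := upper_sum R X in h1 *.
have E0 : 0 <= E.
  apply: sumr_ge0 => m _; case/andP: (sum_mulf_le R (X %/ m ^ 2) upper_classes_le) => h _.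
  exact: h.
have x20 : 20 <= x by nra.
have h2 : E * u ^+ 2 <= x * (7 / 5 * (2 * u + 2) + K).
  by apply: (le_trans h1); apply: ler_wpM2l; lra.
have h3 : E * u ^+ 2 <= x * (u * (31 / 10)).
  apply: (le_trans h2); apply: ler_wpM2l; lra.
have h4 : E * u <= x * (31 / 10).
  have u0 : 0 < u by lra.
  by rewrite -(ler_pM2r u0) -[E * u * u]mulrA -expr2 -[x * _ * u]mulrA [31 / 10 * u]mulrC.
apply: (@le_trans _ _ (2 * (3 * x + 1) * E * (21 / 20 * u))).
  by apply: ler_wpM2l => //; rewrite !mulr_ge0//; lra.
have -> : 2 * (3 * x + 1) * E * (21 / 20 * u) = 21 / 10 * (3 * x + 1) * (E * u) by field.
apply: (@le_trans _ _ (21 / 10 * (3 * x + 1) * (x * (31 / 10)))).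
  by apply: ler_wpM2l => //; rewrite !mulr_ge0//; lra.
apply: (@le_trans _ _ (20 * x ^+ 2)); first by nra.
by rewrite ler_pM2l// ler_pXn2r ?nnegrE//; lra.
Qed.

(** * The lower bound and the theorem *)

(** Chebyshev's [1/3] times [L >= (4/7) sqrt(ln y)] gives [4/21], where [4/7] comes from
    [(305/100) (4/7)^2 <= 1]. The gap [D = 1/336] down to [3/16] absorbs all lower-order terms,
    including the [1] subtracted for [c = 1]. *)
Lemma mulf_sum_lower_growth (R : realType) d : (0 < d)%N -> exists U : R,
  forall X, U <= Num.sqrt (ln (X%:R : R)) ->
    3 / 16 * (X%:R / d%:R) / Num.sqrt (ln X%:R) <=
    mulf_sum R lower_classes (X %/ d) - 1.
Proof.
move=> d0; have [K K0 hK] := mulf_sum_lower R.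
have d1 : (1 : R) <= d%:R by rewrite ler1n.
have k0 : 0 <= ln (2 * d%:R : R) by rewrite ln_ge0//; lra.
have [D D0 DE] : exists2 D : R, 0 < D & 4 / 21 = 3 / 16 + D.
  by exists (1 / 336); lra.
pose K2 := K + 4 / 21.
pose U := 2 * K2 / D + 4 * d%:R / D + ln (2 * d%:R) + 20 * d%:R.
exists U => X; set u := Num.sqrt (ln (X%:R : R)) => uU.
have K20 : 0 <= K2 by rewrite /K2; lra.
have a0 : 0 <= 2 * K2 / D by apply: divr_ge0; [lra|exact: ltW].
have b0 : 0 <= 4 * d%:R / D by apply: divr_ge0; [lra|exact: ltW].
have u20 : 20 * d%:R <= u by apply: le_trans uU; rewrite /U; lra.
have uk : ln (2 * d%:R) <= u by apply: le_trans uU; rewrite /U; lra.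
have uK : 2 * K2 <= u * D.
  by rewrite -ler_pdivrMr//; apply: le_trans uU; rewrite /U; lra.
have ud : 4 * d%:R <= u * D.
  by rewrite -ler_pdivrMr//; apply: le_trans uU; rewrite /U; lra.
have X1 : (1 : R) <= X%:R.
  rewrite leNgt; apply/negP => /ltW h; move: u20; rewrite /u ler0_sqrtr ?ln_le0//; lra.
have [uE uX] := sqrt_ln_le X1; rewrite -/u in uE uX.
have [h1 h2] := divn_approx R X d0.
set y := (X %/ d)%N in h1 h2 *.
set z := X%:R / d%:R in h1 h2 *.
have dp : (0 : R) < d%:R by lra.
have zu : u ^+ 2 <= z * d%:R by rewrite divfK ?gt_eqF.
have z20 : 20 <= z.
  rewrite -(ler_pM2r dp); apply: le_trans zu; nra.
have y10 : (10 <= y)%N by rewrite -(@ler_nat R); lra.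
have y1 : (1 : R) <= y%:R by rewrite ler1n (leq_trans _ y10).
have [qE _] := sqrt_ln_le y1; set q := Num.sqrt (ln (y%:R : R)) in qE.
have q0 : 0 <= q by rewrite sqrtr_ge0.
(* Since [y >= X / (2 d)], passing from [X] to [y] shifts the logarithm by at most a constant. *)
have qk : u ^+ 2 - ln (2 * d%:R) <= q ^+ 2.
  rewrite uE qE lerBlDr -lnM ?posrE//; try lra.
  rewrite ler_ln ?posrE//; try lra.
    have : X%:R = z * d%:R by rewrite divfK ?gt_eqF.
    by move=> ->; nra.
  by rewrite mulr_gt0//; lra.
have qu : u - 1 <= q.
  by rewrite -(@ler_pXn2r _ 2)// ?nnegrE//; [nra|lra].
have qu2 : q ^+ 2 <= u ^+ 2.
  rewrite uE qE ler_ln ?posrE//; try lra.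
  by rewrite ler_nat leq_div.
have L0 := mulf_logsum_ge0 R lower_classes y.
have hL : 4 / 7 * q <= mulf_logsum R lower_classes y.
  have h := lower_log_sum R y10; rewrite -/(mulf_logsum R lower_classes y) in h.
  have ll : ln (y%:R : R) <= ln y.+1%:R.
    rewrite ler_ln ?posrE ?ltr0n ?ler_nat//; exact: leq_trans y10.
  rewrite -(@ler_pXn2r _ 2)// ?nnegrE ?mulr_ge0//.
  rewrite -qE in ll.
  move: (ln _) (mulf_logsum _ _ _) h ll => a b h ll.
  have : 305 / 100 * (4 / 7 * q) ^+ 2 <= q ^+ 2.
    have -> : 305 / 100 * (4 / 7 * q) ^+ 2 = (305 / 100 * 16 / 49) * q ^+ 2 by field.
    have c1 : 305 / 100 * 16 / 49 <= 1 :> R by lra.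
    by rewrite ler_piMl ?c1 ?sqr_ge0.
  by move: (_ ^+ 2) (q ^+ 2) (b ^+ 2) ll h => A B C *; lra.
have h := hK y; rewrite -qE in h.
have /andP[G0 _] := sum_mulf_le R y lower_classes_le.
rewrite -/(mulf_sum R lower_classes y) in G0.
set G := mulf_sum R lower_classes y in h G0 *.
set L := mulf_logsum R lower_classes y in h hL L0.
have g1 : y%:R * (4 / 21 * q - K) <= G * q ^+ 2.
  apply: le_trans h.
  have : 1 / 3 * y%:R * (4 / 7 * q) <= 1 / 3 * y%:R * L.
    by apply: ler_wpM2l => //; rewrite mulr_ge0//; lra.
  by move: (1 / 3 * y%:R * L) => W hW; lra.
have g2 : (z - 1) * (4 / 21 * u - K2) <= G * u ^+ 2.
  apply: (@le_trans _ _ (G * q ^+ 2)); last exact: ler_wpM2l.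
  apply: le_trans g1; apply: ler_pM; rewrite /K2; try lra.
  have : D <= 1 by lra.
  by rewrite /K2 in uK; nra.
have u1 : 20 <= u by nra.
have up : 0 < u by lra.
rewrite ler_pdivrMr// -(ler_pM2r up).
have -> : (G - 1) * u * u = G * u ^+ 2 - u ^+ 2 by ring.
rewrite lerBrDr; apply: le_trans g2.
have e1 : K2 * z <= z * u * D / 2.
  have : K2 * z <= (u * D / 2) * z by apply: ler_wpM2r; lra.
  by move=> hh; lra.
have e2 : u + u ^+ 2 <= z * u * D / 2.
  have zD : 2 * (1 + u) <= z * D.
    rewrite -(ler_pM2r dp).
    have : u ^+ 2 * D <= z * d%:R * D by apply: ler_wpM2r => //; exact: ltW.
    have : 4 * d%:R * u <= u * D * u by apply: ler_wpM2r => //; lra.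
    nra.
  have : 2 * (1 + u) * u <= z * D * u by apply: ler_wpM2r => //; lra.
  by move=> hh; lra.
rewrite DE; have : D <= 1 by lra.
nra.
Qed.

Lemma mulf_sum_lower_growth_sqr (R : realType) M : exists U : R,
  forall X, U <= Num.sqrt (ln (X%:R : R)) -> forall m, (1 <= m <= M)%N ->
    3 / 16 * (X%:R / m%:R ^+ 2) / Num.sqrt (ln X%:R) <=
    mulf_sum R lower_classes (X %/ m ^ 2) - 1.
Proof.
elim: M => [|M [U hU]]; first by exists 0 => X _ m; lia.
have [V hV] := @mulf_sum_lower_growth R (M.+1 ^ 2) ltac:(by rewrite expn_gt0).
exists (Num.max U V) => X; rewrite ge_max => /andP[XU XV] m /andP[m1].
rewrite leq_eqVlt => /orP[/eqP ->|mM]; first by rewrite -natrX; exact: hV.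
by apply: hU => //; rewrite m1.
Qed.

Lemma mulf_lower_even (R : realType) c : (0 < c)%N -> ~~ odd c ->
  mulf (sqfree_weight R lower_classes) c = 0.
Proof.
move=> c0 ec; have [sc|] := boolP (sqfree c); last exact: mulf_nsqfree.
have p2 : (2 \in primes c)%N by rewrite mem_primes c0 dvdn2 ec.
rewrite /mulf (bigD1_seq 2%N)//= ?primes_uniq// sqfree_logn// p2 /=.
by rewrite !mul0r.
Qed.

Lemma mulf_sum_lower_odd (R : realType) y :
  mulf_sum R lower_classes y - 1 <=
  \sum_(1 <= c < y.+1 | [&& sqfree c, odd c & (1 < c)%N])
     mulf (sqfree_weight R lower_classes) c.
Proof.
have g0 c : 0 <= mulf (sqfree_weight R lower_classes) c.
  by apply: mulf_ge0 => *; exact: sqfree_weight_ge0.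
rewrite lerBlDr /mulf_sum; case: y => [|y]; first by rewrite !big_geq// add0r.
rewrite big_ltn// [X in _ <= X + 1]big_mkcond [X in _ <= X + 1]big_ltn//=.
rewrite add0r [leLHS]addrC; apply: lerD; last by rewrite /mulf big_nil.
rewrite big_nat_cond [leRHS]big_nat_cond; apply: ler_sum => c /andP[/andP[c2 _] _].
have c0 : (0 < c)%N by exact: ltnW.
case: ifPn => //; rewrite c2 andbT negb_and => /orP[nsc|ec].
  by rewrite mulf_nsqfree.
by rewrite mulf_lower_even.
Qed.

(** The number [q] of full periods is at least [2 m^2] because [m^2 c <= X], and
    [(q + 1) c >= 2X + 1]. Monotonicity of [q / (q + 1)] gives the loss factor. *)
Lemma count_unit_sqmod_ge_mulf (R : realType) X m c : sqfree c -> (0 < m)%N ->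
  (m ^ 2 * c <= X)%N ->
  2 * m%:R ^+ 2 / (2 * m%:R ^+ 2 + 1) * (2 * X%:R) *
    mulf (sqfree_weight R lower_classes) c <=
  (count_classes unit_sqmod X c)%:R.
Proof.
move=> sc m0 mc; have c0 := sqfree_gt0 sc; have c0R : (0 : R) < c%:R by rewrite ltr0n.
have m2 : (0 : R) < m%:R ^+ 2 by rewrite exprn_gt0// ltr0n.
have g0 : 0 <= mulf (sqfree_weight R lower_classes) c.
  by apply: mulf_ge0 => *; exact: sqfree_weight_ge0.
have := count_unit_sqmod_bound X sc; rewrite -(@ler_nat R) natrM.
rewrite -(mulf_sqfree R lower_classes sc) => h; apply: le_trans h.
rewrite [leRHS]mulrA; apply: ler_wpM2r => //.
set q := ((2 * X).+1 %/ c)%N.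
have h1 : (2 * m ^ 2 <= q)%N by rewrite leq_divRL// -mulnA; lia.
have h2 : ((2 * X).+1 <= q.+1 * c)%N by rewrite ltnW// ltn_ceil.
have h1R : 2 * m%:R ^+ 2 <= q%:R :> R by rewrite -natrX -natrM ler_nat.
have h2R : 2 * X%:R + 1 <= (q%:R + 1) * c%:R :> R.
  move: h2; rewrite -(@ler_nat R) natrM.
  by rewrite -[(2 * X).+1%:R]natr1 -[q.+1%:R]natr1 natrM.
rewrite mulrAC ler_pdivrMr; last by lra.
move: (m%:R ^+ 2) (X%:R) (q%:R) (c%:R) m2 h1R h2R c0R => A x Q C A0 a b C0.
have : 2 * A * (2 * x + 1) <= 2 * A * ((Q + 1) * C) by apply: ler_wpM2l => //; lra.
have : 2 * A * C <= Q * C by apply: ler_wpM2r => //; lra.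
nra.
Qed.

Lemma Nloc_lower (R : realType) n X M (T : R) : odd n -> X%:R < T -> T <= X.+1%:R ->
  2 * \sum_(1 <= m < M.+1) 2 * m%:R ^+ 2 / (2 * m%:R ^+ 2 + 1) * (2 * X%:R) *
     (mulf_sum R lower_classes (X %/ m ^ 2) - 1) <= (Nloc n T)%:R.
Proof.
move=> on XT TX; have := Nloc_ge M on XT TX; rewrite -(@ler_nat R) natrM.
apply: le_trans; apply: ler_wpM2l => //.
rewrite natr_sum big_geq_mkord [leLHS]big_mkcond; apply: ler_sum => m _ /=.
case: ifPn => [m0|]; last by rewrite -leqNgt leqn0 => /eqP ->; rewrite big1.
set r := _ * (2 * X%:R).
have r0 : 0 <= r by rewrite mulr_ge0// divr_ge0// ?addr_ge0// mulr_ge0// sqr_ge0.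
apply: (le_trans (ler_wpM2l r0 (mulf_sum_lower_odd R (X %/ m ^ 2)))).
have m2 : (0 < m ^ 2)%N by rewrite expn_gt0 m0.
have Xm : ((X %/ m ^ 2).+1 <= X.+1)%N by rewrite ltnS leq_div.
rewrite natr_sum (big_nat_widen _ _ _ _ _ Xm) mulr_sumr big_geq_mkord.
rewrite [leLHS]big_mkcond [leRHS]big_mkcond; apply: ler_sum => c _.
case: ifP => [/andP[/andP[hc cX] c0]|_]; last by case: ifP.
rewrite ltnS leq_divRL// mulnC in cX; rewrite hc cX /=.
by case/and3P: hc => sc _ _; exact: count_unit_sqmod_ge_mulf.
Qed.

(** The summand is the loss factor [2m^2 / (2m^2 + 1)] times [1/m^2]. Ten terms give about [1.179],
    just above [20/17]; nine would fall short. *)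
Lemma sum_density_ge (R : realType) :
  20 / 17 <= \sum_(1 <= m < 11) 2 / (2 * m%:R ^+ 2 + 1) :> R.
Proof.
rewrite (big_ltn (isT : (1 < 11)%N)).
rewrite (big_ltn (isT : (2 < 11)%N)).
rewrite (big_ltn (isT : (3 < 11)%N)).
rewrite (big_ltn (isT : (4 < 11)%N)).
rewrite (big_ltn (isT : (5 < 11)%N)).
rewrite (big_ltn (isT : (6 < 11)%N)).
rewrite (big_ltn (isT : (7 < 11)%N)).
rewrite (big_ltn (isT : (8 < 11)%N)).
rewrite (big_ltn (isT : (9 < 11)%N)).
rewrite (big_ltn (isT : (10 < 11)%N)).
rewrite big_geq; last exact: leqnn.
have -> : 2 * 1%:R ^+ 2 + 1 = 3%:R :> R by ring.
have -> : 2 * 2%:R ^+ 2 + 1 = 9%:R :> R by ring.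
have -> : 2 * 3%:R ^+ 2 + 1 = 19%:R :> R by ring.
have -> : 2 * 4%:R ^+ 2 + 1 = 33%:R :> R by ring.
have -> : 2 * 5%:R ^+ 2 + 1 = 51%:R :> R by ring.
have -> : 2 * 6%:R ^+ 2 + 1 = 73%:R :> R by ring.
have -> : 2 * 7%:R ^+ 2 + 1 = 99%:R :> R by ring.
have -> : 2 * 8%:R ^+ 2 + 1 = 129%:R :> R by ring.
have -> : 2 * 9%:R ^+ 2 + 1 = 163%:R :> R by ring.
have -> : 2 * 10%:R ^+ 2 + 1 = 201%:R :> R by ring.
lra.
Qed.

(** The constants combine to [2 * (3/8) * (20/17) = 15/17], and the excess over [7/8] absorbs
    [(X + 1)^2 / X^2], as [X >= 400]. *)
Lemma Nloc_lower_growth (R : realType) n : odd n ->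
  \forall T \near +oo%R, 7 / 8 * growth T <= (Nloc n T)%:R :> R.
Proof.
move=> on; have [U hU] := mulf_sum_lower_growth_sqr R 10.
have := near_sqrt_ln U; apply: filterS => T [X [XT TX u20 uU /andP[uv _]]].
apply: le_trans (Nloc_lower 10 on XT TX).
have X1 : (1 : R) <= X%:R.
  rewrite leNgt; apply/negP => /ltW h; move: u20; rewrite ler0_sqrtr ?ln_le0//; lra.
have [uE uX] := sqrt_ln_le X1.
have h := hU X uU.
set u := Num.sqrt (ln X%:R) in u20 uU uv uE uX h.
rewrite -natr1 in TX.
set x := X%:R in h uX XT X1 TX *.
have u0 : 0 < u by lra.
apply: (@le_trans _ _ (2 * \sum_(1 <= m < 11) (3 / 8 * x ^+ 2 / u) * (2 / (2 * m%:R ^+ 2 + 1)))); last first.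
  apply: ler_wpM2l => //; rewrite big_nat_cond [leRHS]big_nat_cond.
  apply: ler_sum => m /andP[hm _].
  have m1 : (0 : R) < m%:R by rewrite ltr0n; case/andP: hm.
  have m0 : (0 : R) < m%:R ^+ 2 by rewrite exprn_gt0.
  have r0 : 0 <= 2 * m%:R ^+ 2 / (2 * m%:R ^+ 2 + 1) * (2 * x).
    by apply: mulr_ge0; [apply: divr_ge0; lra|lra].
  apply: le_trans (ler_wpM2l r0 (h m hm)).
  rewrite le_eqVlt; apply/orP; left; apply/eqP.
  by field; rewrite ?gt_eqF//; lra.
rewrite -mulr_sumr.
have hs := sum_density_ge R.
set S := \sum_(_ <= _ < _) _ in hs *.
have hx : 0 <= 3 / 8 * x ^+ 2 / u.
  by apply: divr_ge0; [apply: mulr_ge0; [lra|exact: sqr_ge0]|exact: ltW].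
apply: (@le_trans _ _ (2 * (3 / 8 * x ^+ 2 / u * (20 / 17)))); last first.
  by apply: ler_wpM2l => //; exact: ler_wpM2l.
rewrite /growth; set v := Num.sqrt (ln T) in uv *.
apply: (@le_trans _ _ (7 / 8 * (T ^+ 2 / u))).
  apply: ler_wpM2l; first lra.
  apply: ler_wpM2l; first exact: sqr_ge0.
  by rewrite lef_pV2 ?posrE//; lra.
have -> : 2 * (3 / 8 * x ^+ 2 / u * (20 / 17)) = 15 / 17 * x ^+ 2 / u.
  by field; rewrite gt_eqF.
rewrite mulrA; apply: ler_wpM2r; first by rewrite invr_ge0 ltW.
have x2 : 20 * 20 <= x by apply: le_trans uX; rewrite expr2; nra.
apply: (@le_trans _ _ (7 / 8 * (x + 1) ^+ 2)).
  by apply: ler_wpM2l; [lra|rewrite ler_pXn2r ?nnegrE//; lra].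
nra.
Qed.

Lemma littleo_zero (R : realType) (g : R -> R) : (fun=> 0 : R) =o_ (+oo%R) g.
Proof.
apply/eqoP => e e0; near=> T; rewrite normr0 mulr_ge0// ltW//.
Unshelve. all: by end_near. Qed.

Lemma kappa1_gt0 (R : realType) : 0 < kappa1 R.
Proof.
have [P [-> P1 _]] := kappa1_limit R.
apply: divr_gt0; last by rewrite sqrtr_gt0 pi_gt0.
by apply: lt_le_trans P1; rewrite sqrtr_gt0 invr_gt0.
Qed.

Lemma sqrt_pi_ge (R : realType) : 12 / 7 <= Num.sqrt (pi : R).
Proof.
have -> : 12 / 7 = Num.sqrt ((12 / 7) ^+ 2) :> R by rewrite sqrtr_sqr ger0_norm//; lra.
rewrite ler_wsqrtr//; apply: le_trans (pi_ge3 R); rewrite expr2; lra.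
Qed.

(** Write [kappa_1 = P / sqrt(pi)]. Then [P / sqrt(1 - alpha) >= 1], and [(4/9) (12/7) 27], about
    [20.6], bounds the rest. *)
Lemma upper_constant (R : realType) (alpha : R) : 1 / 2 < alpha -> alpha < 1 ->
  20 <= 4 * pi ^+ 4 * kappa1 R / (9 * Num.sqrt (1 - alpha)).
Proof.
move=> a1 a2; have [P [-> P1 _]] := kappa1_limit R.
have w0 := sqrt_pi_ge R; have p3 := pi_ge3 R.
have wE : pi = Num.sqrt (pi : R) ^+ 2 by rewrite sqr_sqrtr// pi_ge0.
set w := Num.sqrt (pi : R) in w0 wE *.
have s0 : 0 < Num.sqrt (1 - alpha) by rewrite sqrtr_gt0; lra.
have sP : Num.sqrt (1 - alpha) <= P by apply: le_trans P1; rewrite ler_wsqrtr//; lra.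
set s := Num.sqrt (1 - alpha) in s0 sP *.
have -> : 4 * pi ^+ 4 * (P / w) / (9 * s) = 4 / 9 * (w * pi ^+ 3) * (P / s).
  rewrite {1 2}wE; field; rewrite ?gt_eqF//; lra.
have Ps : 1 <= P / s by rewrite ler_pdivlMr// mul1r.
have pp : 27 <= pi ^+ 3 :> R.
  have -> : 27 = 3 ^+ 3 :> R by ring.
  by rewrite ler_pXn2r ?nnegrE//; lra.
have wp : 12 / 7 * 27 <= w * pi ^+ 3 by apply: ler_pM => //; lra.
have : 4 / 9 * (12 / 7 * 27) * 1 <= 4 / 9 * (w * pi ^+ 3) * (P / s).
  by apply: ler_pM => //; lra.
by apply: le_trans; lra.
Qed.

(** Numerically [(16/5) (37/45) (7/12) (156/275)] is about [0.871]; this narrow margin decides how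
    many primes enter the bounds for [kappa_1] and [kappa_2]. *)
Lemma lower_constant (R : realType) : 16 * kappa1 R * kappa2 R / 5 <= 7 / 8.
Proof.
have [P [-> P1 P2]] := kappa1_limit R; have [k0 _] := kappa2_prop R.
have k1 := kappa2_le R; have w0 := sqrt_pi_ge R.
have P0 : 0 < P by apply: lt_le_trans P1; rewrite sqrtr_gt0 invr_gt0.
set w := Num.sqrt (pi : R) in w0 *.
have h1 : P / w <= 37 / 45 / (12 / 7).
  apply: ler_pM => //; [exact: ltW|by rewrite invr_ge0; lra|].
  by rewrite lef_pV2 ?posrE//; lra.
have h2 : P / w * kappa2 R <= 37 / 45 / (12 / 7) * (156 / 275).
  by apply: ler_pM => //; [rewrite divr_ge0//; lra|exact: ltW].
have -> : 16 * (P / w) * kappa2 R / 5 = 16 / 5 * (P / w * kappa2 R) by ring.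
by move: (P / w * kappa2 R) h2 => t; lra.
Qed.

Lemma growth_ge0 (R : realType) (T : R) : 0 <= growth T.
Proof. by rewrite /growth divr_ge0 ?sqr_ge0// sqrtr_ge0. Qed.

Unset Implicit Arguments.

Theorem theorem7p1 (R : realType) :
  [/\ 0 < kappa1 R,
      0 < kappa2 R
    & forall (n : nat) (alpha : R),
        odd n -> (3 <= n)%N -> 1 / 2 < alpha -> alpha < 1 ->
        (exists e : R -> R,
           e =o_ (+oo%R) growth /\
           \forall T \near +oo%R,
             (Nloc n T)%:R <=
               4 * pi ^+ 4 * kappa1 R / (9 * Num.sqrt (1 - alpha)) * growth T
               + e T) /\
        (exists e : R -> R,
           e =o_ (+oo%R) growth /\
           \forall T \near +oo%R,
             (Nloc n T)%:R >=
               16 * kappa1 R * kappa2 R / 5 * growth T + e T)].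
Proof.
split; [exact: kappa1_gt0|by case: (kappa2_prop R)|].
move=> n alpha on n3 a1 a2; have n0 : (0 < n)%N by exact: ltn_trans n3.
split; exists (fun=> 0); (split; first exact: littleo_zero).
  apply: filterS (Nloc_upper_growth R n0) => T h; rewrite addr0.
  apply: (le_trans h); apply: ler_wpM2r; first exact: growth_ge0.
  exact: upper_constant.
apply: filterS (Nloc_lower_growth R on) => T h; rewrite addr0.
apply: le_trans h; apply: ler_wpM2r; first exact: growth_ge0.
exact: lower_constant.
Qed.
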